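(* Let $N\ge 3$. There exist $\gamma\in(0,\frac1N)$ and $c>0$, both depending only on $N$, such that the following holds. Let $x_0\in\mathbb{R}^N$, $R>0$, $\rho\in C^1(\mathbb{R}^N)$, $q>N$ and $\beta:=\frac{2N}{q}$. Let $u\in C^3(\mathbb{R}^N)$ be a strictly spacelike classical solution of $$-\operatorname{div}\left(\frac{\nabla u}{\sqrt{1-|\nabla u|^2}}\right)=\rho\quad\text{in }\mathbb{R}^N,$$ put $v:=\sqrt{1-|\nabla u|^2}$, and suppose that the set $K_R(x_0)$ is bounded. Then, writing $|\rho|_{q,K_R(x_0)}$ for the norm of $\rho$ in $L^q(K_R(x_0))$, $$\begin{aligned} \omega_N v^\gamma(x_0)\ \ge\ & R^{-N}\int_{K_R(x_0)}v^{\gamma+1}\,dx + c\,R^{2-N}\int_{K_{R/2}(x_0)}v^{\gamma-1}\left(|D^2u|^2+|\nabla v|^2\right)dx\\ &-\frac32|\rho|_{q,K_R(x_0)}^2\int_0^R s^{1-\beta}\left(\omega_N^{\frac1q}+\frac{3\,\omega_N^{-\frac1q}|\rho|_{q,K_R(x_0)}^2}{2q(2-\beta)}s^{2-\beta}+\frac{|\rho|_{q,K_R(x_0)}}{2q(1-\frac\beta2)}s^{1-\frac\beta2}\right)^{q-2}ds\\ &-\frac12|\rho|_{q,K_R(x_0)}\int_0^R s^{-\frac\beta2}\left(\omega_N^{\frac1q}+\frac{3\,\omega_N^{-\frac1q}|\rho|_{q,K_R(x_0)}^2}{2q(2-\beta)}s^{2-\beta}+\frac{|\rho|_{q,K_R(x_0)}}{2q(1-\frac\beta2)}s^{1-\frac\beta2}\right)^{q-1}ds.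 \end{aligned}$$
   Context: A function $u\in C^1(\mathbb{R}^N)$ is strictly spacelike if $|\nabla u|<1$ everywhere in $\mathbb{R}^N$. $K_R(x_0)$ is the projection of the Lorentz ball of radius $R$ associated with $u$: $K_R(x_0):=\{x\in\mathbb{R}^N:\ [|x-x_0|^2-(u(x)-u(x_0))^2]^{1/2}<R\}$. $\omega_N$ is the volume of the Euclidean unit ball of $\mathbb{R}^N$. $D^2u$ is the Hessian matrix of $u$ and $|\cdot|$ is the Euclidean norm of a vector or of a matrix. *)

(* Defs.v *)
From HB Require Import structures.
From mathcomp Require Import all_boot all_order all_algebra.
From mathcomp Require Import all_classical all_reals all_analysis.

Set Implicit Arguments.
Unset Strict Implicit.
Unset Printing Implicit Defensive.

Import Order.TTheory GRing.Theory Num.Theory.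
Import numFieldNormedType.Exports.

Local Open Scope classical_set_scope.
Local Open Scope ring_scope.

Definition measure_row_display : measure_display. Proof. exact. Qed.

(* The sigma-algebra on R^n generated by the coordinates, that is, the Borel
   sigma-algebra. *)
Section measurable_row.
Context {R : realType} {n : nat}.

Let coors : 'I_n -> 'rV[R]_n -> measurableTypeR R := fun i x => x ord0 i.

Let row_set0 : g_sigma_preimage coors set0.
Proof. exact: sigma_algebra0. Qed.

Let row_setC A : g_sigma_preimage coors A -> g_sigma_preimage coors (~` A).
Proof. exact: sigma_algebraC. Qed.

Let row_bigcup (F : _^nat) : (forall i, g_sigma_preimage coors (F i)) ->
  g_sigma_preimage coors (\bigcup_i (F i)).
Proof. exact: sigma_algebra_bigcup. Qed.

HB.instance Definition _ := @isMeasurable.Build measure_row_display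
  'rV[R]_n (g_sigma_preimage coors) row_set0 row_setC row_bigcup.

End measurable_row.

Section row_measurability.
Context {R : realType}.

Lemma measurable_coord n (i : 'I_n) :
  measurable_fun [set: 'rV[R]_n]
    ((fun x : 'rV[R]_n => x ord0 i) : _ -> measurableTypeR R).
Proof.
move=> _ Y mY; rewrite setTI; apply: sub_sigma_algebra => /=.
rewrite -bigcup_seq/=; exists i => /=; first by rewrite mem_index_enum.
by exists Y => //; rewrite setTI.
Qed.

Lemma measurable_fun_row d (T : measurableType d) n (f : T -> 'rV[R]_n) :
  (forall i, measurable_fun [set: T]
    ((fun t => f t ord0 i) : _ -> measurableTypeR R)) ->
  measurable_fun [set: T] f.
Proof.
move=> mf _ A mA; rewrite setTI.
suff : [set B | measurable (f @^-1` B)] A by [].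
apply: (smallest_sub _ _ mA).
  split.
  - by rewrite /= preimage_set0.
  - by move=> B /= mB; rewrite setTD preimage_setC; exact: measurableC.
  - by move=> F /= mF; rewrite preimage_bigcup; exact: bigcup_measurable.
rewrite -bigcup_seq; apply: bigcup_sub => i _ _ [B mB <-] /=.
by rewrite setTI; have := mf i measurableT _ mB; rewrite setTI.
Qed.

Definition cons_row n (p : measurableTypeR R * 'rV[R]_n) : 'rV[R]_n.+1 :=
  row_mx (p.1%:M : 'rV[R]_1) p.2.

Lemma cons_row0 n p : @cons_row n p ord0 ord0 = p.1.
Proof.
rewrite /cons_row (_ : ord0 = lshift n (ord0 : 'I_1)); last exact: val_inj.
by rewrite [LHS]row_mxEl mxE eqxx mulr1n.
Qed.

Lemma cons_rowS n p (i : 'I_n) : @cons_row n p ord0 (lift ord0 i) = p.2 ord0 i.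
Proof.
rewrite /cons_row (_ : lift ord0 i = rshift 1 i); last exact: val_inj.
by rewrite [LHS]row_mxEr.
Qed.

Lemma measurable_cons_row n : measurable_fun setT (@cons_row n).
Proof.
apply: measurable_fun_row => i; have [j ->|->] := unliftP ord0 i.
- under eq_fun do rewrite cons_rowS.
  exact: (measurableT_comp (measurable_coord j) measurable_snd).
- under eq_fun do rewrite cons_row0.
  exact: measurable_fst.
Qed.

Let uncons_row n (x : 'rV[R]_n.+1) : measurableTypeR R * 'rV[R]_n :=
  (x ord0 ord0, \row_j x ord0 (lift ord0 j)).

Let cons_rowK n : cancel (@cons_row n) (@uncons_row n).
Proof.
move=> [t y]; rewrite /uncons_row cons_row0; congr (_, _).
by apply/rowP => j; rewrite mxE cons_rowS.
Qed.

Let measurable_uncons_row n : measurable_fun setT (@uncons_row n).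
Proof.
apply: measurable_fun_pair => /=; first exact: measurable_coord.
apply: measurable_fun_row => j; under eq_fun do rewrite mxE.
exact: measurable_coord.
Qed.

Lemma pushforward_cons_row_sigma_finite n
    (m1 : {sigma_finite_measure set (measurableTypeR R) -> \bar R})
    (m2 : {sigma_finite_measure set 'rV[R]_n -> \bar R}) :
  sigma_finite setT (pushforward (m1 \x m2)%E (@cons_row n)).
Proof.
have /sigma_finiteP[F [TF ndF Foo]] := sigma_finiteT m1.
have /sigma_finiteP[G [TG ndG Goo]] := sigma_finiteT m2.
pose H k := @uncons_row n @^-1` (F k `*` G k).
exists H => [|k].
  rewrite -preimage_bigcup predeqE => x; split=> // _.
  have [i _ Fi] : (\bigcup_k F k) (uncons_row x).1 by rewrite -TF.
  have [j _ Gj] : (\bigcup_k G k) (uncons_row x).2 by rewrite -TG.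
  exists (maxn i j) => //; split.
  - by move: Fi; exact/subsetPset/ndF/leq_maxl.
  - by move: Gj; exact/subsetPset/ndG/leq_maxr.
have [mF Fk] := Foo k; have [mG Gk] := Goo k; split.
  rewrite -[X in measurable X]setTI.
  by apply: measurable_uncons_row => //; exact: measurableX.
rewrite /pushforward (_ : _ @^-1` _ = F k `*` G k); last first.
  by apply/funext => p; rewrite /H /preimage /mkset cons_rowK.
by rewrite product_measure1E// lte_mul_pinfty// ge0_fin_numE.
Qed.

End row_measurability.

Section lebesgue_row.
Context {R : realType}.
Local Open Scope ereal_scope.

(* Lebesgue measure on R^n, as the n-fold product of the Lebesgue measure on R;
   lebesgue_row_box gives its value on boxes, which characterizes it. *)
Fixpoint lebesgue_row (n : nat) : set 'rV[R]_n -> \bar R :=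
  if n is n'.+1 then
    pushforward (@lebesgue_measure R \x @lebesgue_row n') (@cons_row R n')
  else \d_(0%R : 'rV[R]_0).

Let lebesgue_row_ex n : exists m : {sigma_finite_measure set 'rV[R]_n -> \bar R},
  @lebesgue_row n = m :> (set 'rV[R]_n -> \bar R).
Proof.
elim: n => [|n [m mE]]; first by exists (\d_(0%R : 'rV[R]_0)).
pose mu : {measure set _ -> \bar R} :=
  measure_function_pushforward__canonical__measure_function_Measure
    (@lebesgue_measure R \x m) (@measurable_cons_row R n).
pose H := Measure_isSigmaFinite.Build _ _ _ mu
  (@pushforward_cons_row_sigma_finite R n (@lebesgue_measure R) m).
pose mu' := HB.pack_for (SigmaFiniteMeasure.type 'rV[R]_n.+1 R)
  (Measure.sort mu) H.
by exists mu' => /=; rewrite mE.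
Qed.

Context (n : nat).

Let lebesgue_row0 : @lebesgue_row n set0 = 0.
Proof. by have [m ->] := lebesgue_row_ex n; rewrite measure0. Qed.

Let lebesgue_row_ge0 A : 0 <= @lebesgue_row n A.
Proof. by have [m ->] := lebesgue_row_ex n; exact: measure_ge0. Qed.

Let lebesgue_row_sigma_additive : semi_sigma_additive (@lebesgue_row n).
Proof.
by have [m ->] := lebesgue_row_ex n; exact: measure_semi_sigma_additive.
Qed.

HB.instance Definition _ := isMeasure.Build _ _ _ (@lebesgue_row n)
  lebesgue_row0 lebesgue_row_ge0 lebesgue_row_sigma_additive.

Let lebesgue_row_sigma_finite : sigma_finite setT (@lebesgue_row n).
Proof. by have [m ->] := lebesgue_row_ex n; exact: sigma_finiteT. Qed.

HB.instance Definition _ := Measure_isSigmaFinite.Build _ _ _ (@lebesgue_row n)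
  lebesgue_row_sigma_finite.

End lebesgue_row.
Arguments lebesgue_row R n _ : clear implicits.

Lemma lebesgue_row_box (R : realType) (n : nat)
    (A : 'I_n -> set (measurableTypeR R)) :
  (forall i, measurable (A i)) ->
  lebesgue_row R n [set x | forall i, A i (x ord0 i)] =
  (\prod_(i < n) lebesgue_measure (A i))%E.
Proof.
elim: n A => [|n IHn] A mA.
  by rewrite big_ord0 /= diracE mem_set//= => -[].
pose B := [set x : 'rV[R]_n | forall i, A (lift ord0 i) (x ord0 i)].
have mB : measurable B.
  rewrite (_ : B = \bigcap_(i in [set: 'I_n])
      ((fun x : 'rV[R]_n => x ord0 i) @^-1` A (lift ord0 i))); last first.
    by apply/seteqP; split=> x /= h i => [_|]; exact: h.
  apply: fin_bigcap_measurable => // i _.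
  by rewrite -[X in measurable X]setTI; exact: (measurable_coord i).
rewrite big_ord_recl -(IHn (fun i => A (lift ord0 i)))// -/B.
rewrite -product_measure1E//=; congr (product_measure1 _ _ _).
apply/seteqP; split=> [p /= h|p /= [h0 h] i].
  split=> [|i]; first by have := h ord0; rewrite cons_row0.
  by have := h (lift ord0 i); rewrite cons_rowS.
by have [j ->|->] := unliftP ord0 i; rewrite (cons_rowS, cons_row0).
Qed.

Section calculus.
Context {R : realType} {N : nat}.
Implicit Types (f u rho : 'rV[R]_N -> R) (x : 'rV[R]_N).

Definition partial (i : 'I_N) f : 'rV[R]_N -> R := 'D_(delta_mx ord0 i) f.

Fixpoint Ck (k : nat) f : Prop :=
  continuous f /\
  if k is k'.+1 then
    forall i, (forall x, derivable f x (delta_mx ord0 i)) /\ Ck k' (partial i f)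
  else True.

Definition grad f x : 'rV[R]_N := \row_i partial i f x.

Definition hessian f x : 'M[R]_N := \matrix_(i, j) partial j (partial i f) x.

Definition divergence (F : 'rV[R]_N -> 'rV[R]_N) x : R :=
  \sum_i partial i (fun y => F y ord0 i) x.

End calculus.

(* Euclidean norm of a vector or matrix: the library's `|A| is the sup norm. *)
Definition enorm {R : realType} {m n : nat} (A : 'M[R]_(m, n)) : R :=
  Num.sqrt (\sum_i \sum_j A i j ^+ 2).

Definition unit_ball_volume (R : realType) (N : nat) : R :=
  fine (lebesgue_row R N [set x | enorm x < 1]).

Definition Lq_norm {R : realType} {N : nat} (q : R) (K : set 'rV[R]_N)
    (f : 'rV[R]_N -> R) : R :=
  fine ('N[lebesgue_row R N]_(q%:E)[EFin \o (f \_ K)])%E.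

Section spacelike.
Context {R : realType} {N : nat}.
Implicit Types (u rho : 'rV[R]_N -> R).

Definition strictly_spacelike u : Prop :=
  Ck 1 u /\ forall x, enorm (grad u x) < 1.

Definition spacelike_factor u (x : 'rV[R]_N) : R :=
  Num.sqrt (1 - enorm (grad u x) ^+ 2).

Definition mean_curvature_eq u rho : Prop :=
  forall x, - divergence (fun y => (spacelike_factor u y)^-1 *: grad u y) x
            = rho x.

Definition lorentz_ball u (x0 : 'rV[R]_N) (r : R) : set 'rV[R]_N :=
  [set x | Num.sqrt (enorm (x - x0) ^+ 2 - (u x - u x0) ^+ 2) < r].

End spacelike.

(* Main.v *)
Require Import Defs.
From HB Require Import structures.
From mathcomp Require Import all_boot all_order all_algebra.
From mathcomp Require Import all_classical all_reals all_analysis.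
From mathcomp Require Import measurable_realfun.
From mathcomp Require Import ring lra.

Set Implicit Arguments.
Unset Strict Implicit.
Unset Printing Implicit Defensive.

Import Order.TTheory GRing.Theory Num.Theory.
Import numFieldNormedType.Exports.

Local Open Scope classical_set_scope.
Local Open Scope ring_scope.

(** Put y = x - x0, w = u(x) - u(x0), sigma = (y.Du - w)/v and p = Du/v, so that
  ell = |y|^2 - w^2 is the squared Lorentz distance to x0 and div p = - rho. Consider the
  vector field
    v^g eta(ell) (v y + (y.Du - w) p) - g E(ell) v^(g+1) V,  V_i = p_k d_k p_i + rho p_i,
  with E' = - eta/2. No third derivative of u survives in its divergence, which is v^(g+1)
  times
    N eta + 2 eta' (ell + sigma^2) + (terms in rho eta) - g E (|A|^2 - (1+g) T + (terms in rho)),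
  where A is the second fundamental form of the graph and T the part of |A|^2 carried by the
  gradient of v. As the mean curvature is rho, |A|^2 >= (1 + 1/(2(N-1))) T - rho^2, so
  the last bracket is coercive for small g. Integrate over R^N with eta a truncated
  primitive of s^(-N-1): N eta + 2 eta' ell becomes the difference of the mean values of
  v^(g+1) over a small and a large Lorentz ball, and 2 eta' sigma^2 absorbs rho eta sigma.
  The small ball is asymptotically an ellipsoid of volume omega s^N / v(x0). By the
  layer-cake formula and Hoelder's inequality the terms in rho are bounded by integrals
  over s of powers of G(s) = s^(-N) int_{K_s} v^(g+1), and the resulting integral
  inequality for G gives G <= S^q by comparison. *)

(** * Lebesgue integration on row vectors *)

(** The first part of the field alone yields a mean value formula, but the derivative of v^g leaves
    a term linear in D^2u Du that has no sign. The second part removes it: since E' = - eta/2, the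
    gradient of E(ell) is - eta (y - w Du), and its product with V cancels that term up to a
    multiple of rho eta. The terms still carrying E form a quadratic form in the second derivatives,
    which pays for the Hessian integral. The choice g = 1/(16(N-1)) lets the gain 1/(2(N-1)) of
    |A|^2 over T cover g T, the cross term in rho and a retained multiple of |A|^2. Fields supported
    in a bounded Lorentz ball avoid integrals over the boundary of K_s, and the layer-cake formula
    takes the place of a coarea formula. Boundedness of K_r gives the compact support and makes
    small Lorentz balls shrink to x0. Inside the small ball, where eta' is cut off, rho eta sigma
    cannot be absorbed; it stays there with the factor e^(-N) and disappears in the limit because
    sigma vanishes at x0. *)

Lemma integral_row_recl (R : realType) n (f : 'rV[R]_n.+1 -> \bar R) :
  measurable_fun [set: 'rV[R]_n.+1] f -> (forall x, 0 <= f x)%E ->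
  (\int[lebesgue_row R n.+1]_x f x =
   \int[lebesgue_measure]_t \int[lebesgue_row R n]_y f (cons_row (t, y)))%E.
Proof.
move=> mf f0.
rewrite [LHS](@ge0_integral_pushforward _ _ _ _ _ _ (@measurable_cons_row R n) (lebesgue_measure \x lebesgue_row R n)%E)//.
rewrite preimage_setT fubini_tonelli1//=.
exact: (measurableT_comp mf (@measurable_cons_row R n)).
Qed.

Lemma integral_row_recr (R : realType) n (f : 'rV[R]_n.+1 -> \bar R) :
  measurable_fun [set: 'rV[R]_n.+1] f -> (forall x, 0 <= f x)%E ->
  (\int[lebesgue_row R n.+1]_x f x =
   \int[lebesgue_row R n]_y \int[lebesgue_measure]_t f (cons_row (t, y)))%E.
Proof.
move=> mf f0.
rewrite [LHS](@ge0_integral_pushforward _ _ _ _ _ _ (@measurable_cons_row R n) (lebesgue_measure \x lebesgue_row R n)%E)//.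
rewrite preimage_setT fubini_tonelli2//=.
exact: (measurableT_comp mf (@measurable_cons_row R n)).
Qed.

Lemma ge0_integral_affine (R : realType) (a b : R) (f : R -> \bar R) : 0 < a ->
  measurable_fun [set: measurableTypeR R] f -> (forall x, 0 <= f x)%E ->
  (\int[lebesgue_measure]_t f (a * t + b)%R = a^-1%:E * \int[lebesgue_measure]_t f t)%E.
Proof.
move=> a0 mf f0.
pose phi : measurableTypeR R -> measurableTypeR R := fun t => a * t + b.
have mphi : measurable_fun [set: measurableTypeR R] phi.
  by apply: measurable_funD => //; exact: measurable_funM.
have a'0 : 0 <= a by rewrite ltW.
(* This multiple of the image measure gives every interval ]c, d] the mass d - c, so it is Lebesgue
   measure by uniqueness. *)
pose m' : {measure set measurableTypeR R -> \bar R} := mscale (NngNum a'0) (measure_function_pushforward__canonical__measure_function_Measure (@lebesgue_measure R) mphi).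
have E : forall A, measurable A -> lebesgue_measure A = m' A.
  apply: lebesgue_measure_unique => _ [[c d] _ <-] /=.
  rewrite /m' /= /mscale /= /pushforward.
  rewrite (_ : phi @^-1` _ = `](c - b) / a, (d - b) / a]%classic); last first.
    apply/seteqP; split => x /=; rewrite !in_itv /= ltr_pdivrMr // ler_pdivlMr // ltrBlDr lerBrDr mulrC //.
  rewrite !lebesgue_measure_itv /= !lte_fin ltr_pM2r ?invr_gt0// ltrD2r.
  case: ifP => _; last by rewrite mule0.
  rewrite -!EFinB -EFinM; congr (_%:E); field; exact: lt0r_neq0.
have -> : (\int[lebesgue_measure]_t f t = \int[m']_t f t)%E.
  by apply: eq_measure_integral => A mA _; exact: E.
rewrite ge0_integral_mscale// muleA -EFinM mulVf ?lt0r_neq0// mul1e.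
by rewrite ge0_integral_pushforward// preimage_setT.
Qed.

(** * Affine substitutions and the Lorentz quadratic form *)

Section row_affine.
Context {R : realType}.
Implicit Types (n : nat).

Lemma measurable_row_scale n (s : R) (c : 'rV[R]_n) :
  measurable_fun [set: 'rV[R]_n] (fun x : 'rV[R]_n => s *: x + c).
Proof.
apply: measurable_fun_row => i; under eq_fun do rewrite !mxE.
apply: measurable_funD => //; apply: measurable_funM => //; exact: measurable_coord.
Qed.

Lemma cons_row_affine n (s : R) (c : 'rV[R]_n.+1) t y :
  s *: cons_row (t, y) + c = cons_row (s * t + c ord0 ord0, s *: y + \row_j c ord0 (lift ord0 j)).
Proof.
apply/rowP => i.
rewrite [LHS]mxE [X in X + _]mxE.
by have [j ->|->] := unliftP ord0 i; rewrite ?cons_rowS ?cons_row0 //= !mxE.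
Qed.

Lemma integral_row0 (f : 'rV[R]_0 -> \bar R) : measurable_fun [set: 'rV[R]_0] f ->
  (\int[lebesgue_row R 0]_x f x = f 0%R)%E.
Proof. by move=> mf; rewrite integral_dirac// diracT mul1e. Qed.

Lemma ge0_integral_row_affine n (s : R) (c : 'rV[R]_n) (f : 'rV[R]_n -> \bar R) : 0 < s ->
  measurable_fun [set: 'rV[R]_n] f -> (forall x, 0 <= f x)%E ->
  (\int[lebesgue_row R n]_x f (s *: x + c)%R = (s ^- n)%:E * \int[lebesgue_row R n]_x f x)%E.
Proof.
move=> s0; elim: n c f => [|n IH] c f mf f0.
  rewrite !integral_row0//; first by rewrite expr0 invr1 mul1e; congr f; apply/rowP => -[].
  by apply: (measurableT_comp mf); exact: measurable_row_scale.
rewrite !integral_row_recl//; last by apply: (measurableT_comp mf); exact: measurable_row_scale.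
under eq_integral => t _.
  under eq_integral => y _ do rewrite cons_row_affine.
  rewrite (IH _ (fun y => f (cons_row (s * t + c ord0 ord0, y))))//; last first.
    apply: (measurableT_comp mf); apply: (measurableT_comp (@measurable_cons_row _ _)).
    exact: measurable_fun_pair.
  over.
have mg : measurable_fun [set: measurableTypeR R] (fun t => \int[lebesgue_row R n]_x f (cons_row (t, x)))%E.
  apply: (@measurable_fun_fubini_tonelli_F _ _ (measurableTypeR R) 'rV[R]_n R (lebesgue_row R n) (fun p => f (cons_row p))) => //.
  exact: (measurableT_comp mf (@measurable_cons_row R n)).
have mga : measurable_fun [set: measurableTypeR R]
    (fun t => \int[lebesgue_row R n]_x f (cons_row ((s * t + c ord0 ord0)%R, x)))%E.
  by apply: (measurableT_comp mg); apply: measurable_funD => //; exact: measurable_funM.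
rewrite (@ge0_integralZl _ _ _ _ _ measurableT _ mga); first last.
- by rewrite lee_fin invr_ge0 exprn_ge0 // ltW.
- by move=> x _; apply: integral_ge0.
rewrite (ge0_integral_affine _ s0 mg); last by move=> x; apply: integral_ge0.
by rewrite muleA -EFinM exprS invfM mulrC.
Qed.


Definition dotr n (a b : 'rV[R]_n) : R := \sum_i a ord0 i * b ord0 i.

Lemma dotr_cons n (a : 'rV[R]_n.+1) t (y : 'rV[R]_n) :
  dotr a (cons_row (t, y)) = a ord0 ord0 * t + dotr (\row_j a ord0 (lift ord0 j)) y.
Proof.
rewrite /dotr big_ord_recl cons_row0; congr (_ + _).
by apply: eq_bigr => i _; rewrite cons_rowS mxE.
Qed.

Lemma dotrr_cons n t (y : 'rV[R]_n) :
  dotr (cons_row (t, y)) (cons_row (t, y)) = t ^+ 2 + dotr y y.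
Proof.
rewrite /dotr big_ord_recl cons_row0; congr (_ + _).
by apply: eq_bigr => i _; rewrite cons_rowS.
Qed.

Lemma dotrr_ge0 n (a : 'rV[R]_n) : 0 <= dotr a a.
Proof. by apply: sumr_ge0 => i _; rewrite -expr2 sqr_ge0. Qed.

Lemma dotrZl n k (a b : 'rV[R]_n) : dotr (k *: a) b = k * dotr a b.
Proof. by rewrite /dotr mulr_sumr; apply: eq_bigr => i _; rewrite mxE mulrA. Qed.

Lemma dotrC n (a b : 'rV[R]_n) : dotr a b = dotr b a.
Proof. by apply: eq_bigr => i _; rewrite mulrC. Qed.

Lemma measurable_dotr n (a : 'rV[R]_n) :
  measurable_fun [set: 'rV[R]_n] (dotr a : _ -> measurableTypeR R).
Proof.
apply: measurable_sum => i; apply: measurable_funM => //; exact: measurable_coord.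
Qed.

Lemma measurable_dotrr n :
  measurable_fun [set: 'rV[R]_n] ((fun y => dotr y y) : _ -> measurableTypeR R).
Proof.
apply: measurable_sum => i; apply: measurable_funM; exact: measurable_coord.
Qed.

(** The factor is det(I - a a^T)^(-1/2), obtained without rotations. Completing the square in the
    first coordinate t, with b^2 = 1 - a0^2, turns the form into (b t - a0 a'.y / b)^2 + |y|^2 -
    (a2.y)^2, where a2 = a'/b. The substitution in t costs 1/b, the induction hypothesis for a2
    gives the rest, and b^2 (1 - |a2|^2) = 1 - |a|^2. *)
Lemma integral_lorentz_form n (a : 'rV[R]_n) (g : R -> \bar R) : dotr a a < 1 ->
  measurable_fun [set: measurableTypeR R] g -> (forall x, 0 <= g x)%E ->
  (\int[lebesgue_row R n]_y g (dotr y y - dotr a y ^+ 2)%R =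
   (Num.sqrt (1 - dotr a a))^-1%:E * \int[lebesgue_row R n]_y g (dotr y y))%E.
Proof.
have mQ m (c : 'rV[R]_m) : measurable_fun [set: 'rV[R]_m]
    ((fun y => dotr y y - dotr c y ^+ 2) : _ -> measurableTypeR R).
  apply: measurable_funB; first exact: measurable_dotrr.
  apply: measurable_funX; exact: measurable_dotr.
elim: n a g => [|n IH] a g a1 mg g0.
  rewrite !integral_row0.
  - by rewrite /dotr !big_ord0 expr0n /= !subr0 sqrtr1 invr1 mul1e.
  - by apply: (measurableT_comp mg); exact: measurable_dotrr.
  - by apply: (measurableT_comp mg); exact: mQ.
pose a0 := a ord0 ord0; pose a' := \row_j a ord0 (lift ord0 j).
have aE : dotr a a = a0 ^+ 2 + dotr a' a'.
  by rewrite /dotr big_ord_recl; congr (_ + _); apply: eq_bigr => i _; rewrite !mxE.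
have b0 : 0 < 1 - a0 ^+ 2 by move: a1 (dotrr_ge0 a'); rewrite aE; lra.
pose b := Num.sqrt (1 - a0 ^+ 2).
have b_gt0 : 0 < b by rewrite sqrtr_gt0.
have bE : b ^+ 2 = 1 - a0 ^+ 2 by rewrite sqr_sqrtr// ltW.
pose a2 := b^-1 *: a'.
have a2E : dotr a2 a2 = dotr a' a' / b ^+ 2.
  by rewrite dotrZl dotrC dotrZl expr2 invfM; ring.
have a21 : dotr a2 a2 < 1.
  by rewrite a2E ltr_pdivrMr ?exprn_gt0// bE mul1r; move: a1; rewrite aE; lra.
rewrite integral_row_recr//; last by apply: (measurableT_comp mg); exact: mQ.
transitivity (\int[lebesgue_row R n]_y (b^-1%:E * \int[lebesgue_measure]_t (g (t ^+ 2 + (dotr y y - dotr a2 y ^+ 2)))%R))%E.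
  apply: eq_integral => y _.
  pose G : R -> \bar R := fun t => g (t ^+ 2 + (dotr y y - dotr a2 y ^+ 2)).
  rewrite -[RHS](@ge0_integral_affine _ b (- (a0 * dotr a' y / b)) G b_gt0); first last.
  - by move=> t; exact: g0.
  - by apply: (measurableT_comp mg); apply: measurable_funD => //; exact: measurable_funX.
  apply: eq_integral => t _; rewrite /G dotrr_cons dotr_cons -/a0 -/a' dotrZl; congr g.
  apply: (@mulfI _ (b ^+ 2)); first by rewrite expf_neq0// lt0r_neq0.
  rewrite (_ : b ^+ 2 * (t ^+ 2 + _ - _) = b ^+ 2 * t ^+ 2 + b ^+ 2 * dotr y y - b^+2 * (a0 * t + dotr a' y)^+2); last by ring.
  transitivity ((b ^+ 2 * t - a0 * dotr a' y) ^+ 2 + b ^+ 2 * dotr y y - dotr a' y ^+ 2).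
    by rewrite bE; ring.
  by field; exact: lt0r_neq0.
have mg2 : measurable_fun [set: 'rV[R]_n * measurableTypeR R]
  (fun p => g (p.2 ^+ 2 + (dotr p.1 p.1 - dotr a2 p.1 ^+ 2))).
  apply: (measurableT_comp mg); apply: measurable_funD => //.
    by apply: measurable_funX; exact: measurable_snd.
  exact: (measurableT_comp (mQ _ a2) measurable_fst).
rewrite ge0_integralZl//; first last.
- by rewrite lee_fin invr_ge0 ltW.
- by move=> y _; exact: integral_ge0.
- exact: (@measurable_fun_fubini_tonelli_F _ _ 'rV[R]_n (measurableTypeR R) R lebesgue_measure _ mg2).
(* With t outermost, the induction hypothesis applies for each fixed t to the shifted function s ->
   g (t^2 + s). *)
rewrite (@fubini_tonelli _ _ 'rV[R]_n (measurableTypeR R) R (lebesgue_row R n) lebesgue_measure _ mg2)//.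
under eq_integral => t _.
  rewrite /fubini_G /=.
  rewrite (IH a2 (fun s => g (t ^+ 2 + s)))//; last first.
    by apply: (measurableT_comp mg); exact: measurable_funD.
  over.
have mg3 : measurable_fun [set: 'rV[R]_n.+1] (fun y => g (dotr y y)).
  by apply: (measurableT_comp mg); exact: measurable_dotrr.
rewrite integral_row_recl// ge0_integralZl//; first last.
- by move=> y _; exact: integral_ge0.
- apply: (@measurable_fun_fubini_tonelli_F _ _ (measurableTypeR R) 'rV[R]_n R (lebesgue_row R n) (fun p => g (p.1 ^+ 2 + dotr p.2 p.2))) => //.
  apply: (measurableT_comp mg); apply: measurable_funD => //.
    by apply: measurable_funX; exact: measurable_fst.
  by rewrite /dotr; apply: measurable_sum => i; apply: measurable_funM;
    exact: (measurableT_comp (measurable_coord i) measurable_snd).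
rewrite muleA -EFinM; congr (_%:E * _)%E.
  rewrite -invfM /b -sqrtrM; last exact: ltW.
  apply: congr1; apply: congr1.
  by rewrite a2E aE bE; field; exact: lt0r_neq0.
by apply: eq_integral => t _; apply: eq_integral => y _; rewrite dotrr_cons.
Qed.


(** * Borel sets, boundedness and integrability for row vectors *)

Lemma norm_coord_lt n (c x : 'rV[R]_n) (e : R) : 0 < e ->
  (`|c - x| < e) <-> forall i, `|c ord0 i - x ord0 i| < e.
Proof.
move=> e0; have E : `|c - x| < e <-> ball c e x by rewrite -ball_normE.
split; first by move=> /E[_ h] i; exact: h.
by move=> h; apply/E; split => // i j; rewrite (ord1 i); exact: h.
Qed.

Lemma norm_coord_le n (x : 'rV[R]_n) i : `|x ord0 i| <= `|x|.
Proof.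
rewrite leNgt; apply/negP => h.
have x0 : 0 < `|x ord0 i| by exact: le_lt_trans h.
have := (norm_coord_lt x 0 x0).1; rewrite subr0 => /(_ h i).
by rewrite mxE subr0 ltxx.
Qed.

(** The link between the topology of the sup norm and the sigma-algebra of the coordinates: an open
    set is the countable union of the boxes with rational centre and radius that it contains. Boxes
    not contained in it are replaced by the empty set, so that the index set stays countable and
    explicit. *)
Lemma open_measurable_row n (U : set 'rV[R]_n) : open U -> measurable U.
Proof.
move=> oU.
pose box (p : 'rV[rat]_n * rat) : set 'rV[R]_n :=
  [set x | forall i, `|ratr (p.1 ord0 i) - x ord0 i| < ratr p.2].
pose F p : set 'rV[R]_n := if `[< box p `<=` U >] then box p else set0.
have mbox p : measurable (box p).
  rewrite (_ : box p = \bigcap_(i in [set: 'I_n])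
      ((fun x : 'rV[R]_n => x ord0 i) @^-1` ball (ratr (p.1 ord0 i) : R) (ratr p.2 : R))); last first.
    by apply/seteqP; split=> x /= h i => [_|]; have := h i; exact.
  apply: fin_bigcap_measurable => // i _.
  by rewrite -[X in measurable X]setTI; apply: (measurable_coord i) => //; exact: measurable_ball.
have -> : U = \bigcup_p F p.
  apply/seteqP; split => [x Ux|x [p _]]; last first.
    by rewrite /F; case: asboolP => // bU bx; exact: bU.
  have /nbhs_ballP[e /= e0 xeU] := open_nbhs_nbhs (conj oU Ux).
  have [q] := rat_in_itvoo (divr_gt0 e0 (ltr0Sn R 1)); rewrite in_itv/= => /andP[q0 qe].
  have /choice[c Hc] : forall i, exists c : rat, `|ratr c - x ord0 i| < ratr q.
    move=> i; have : x ord0 i - ratr q < x ord0 i + ratr q by rewrite ltrBlDr -addrA ltrDl addr_gt0.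
    by move=> /rat_in_itvoo[c]; rewrite in_itv /= => h; exists c; rewrite ltr_distl.
  exists (\row_i c i, q) => //; rewrite /F; case: asboolP => [_|].
    by move=> i /=; rewrite mxE.
  case=> z /= zb; apply: xeU; rewrite -ball_normE /=; apply/norm_coord_lt => // i.
  have := zb i; have := Hc i; rewrite mxE => h1 h2.
  rewrite (_ : _ - _ = (ratr (c i) - z ord0 i) - (ratr (c i) - x ord0 i)); last by ring.
  by rewrite (le_lt_trans (ler_normB _ _))//; move: h1 h2 qe; lra.
apply: countable_bigcupT_measurable; first exact: countableP.
by move=> p; rewrite /F; case: asboolP.
Qed.

Lemma continuous_measurable_row n (f : 'rV[R]_n -> R) :
  continuous f -> measurable_fun [set: 'rV[R]_n] (f : _ -> measurableTypeR R).
Proof.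
move=> /continuousP cf; apply: (measurability _ (RGenOpens.measurableE R)).
move=> _ [_ [a [b ->] <-]]; rewrite setTI; apply: open_measurable_row.
exact/cf/interval_open.
Qed.

Lemma bounded_lebesgue_row n (A : set 'rV[R]_n) (M : R) : measurable A ->
  (forall x, A x -> `|x| <= M) -> (lebesgue_row R n A < +oo)%E.
Proof.
move=> mA AM; pose I : 'I_n -> set (measurableTypeR R) := fun=> `[- M, M]%classic.
have mB : measurable [set x : 'rV[R]_n | forall i, I i (x ord0 i)].
  rewrite (_ : [set x | _] = \bigcap_(i in [set: 'I_n])
      ((fun x : 'rV[R]_n => x ord0 i) @^-1` I i)); last first.
    by apply/seteqP; split=> x /= h i => [_|]; have := h i; exact.
  apply: fin_bigcap_measurable => // i _.
  by rewrite -[X in measurable X]setTI; apply: (measurable_coord i) => //; exact: measurable_itv.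
apply: (@le_lt_trans _ _ (lebesgue_row R n [set x | forall i, I i (x ord0 i)])).
  apply: le_measure; rewrite ?inE // => x /AM xM i.
  by rewrite /I /= in_itv /= -ler_norml (le_trans (norm_coord_le _ _)).
rewrite [X in (X < _)%E](@lebesgue_row_box R n I); last by move=> i; exact: measurable_itv.
have h : (\prod_(i < n) lebesgue_measure (I i))%E \is a fin_num.
  elim/big_ind : (\prod_(i < n) _)%E => [//|x y|i _]; first exact: fin_numM.
  by rewrite lebesgue_measure_itv /=; case: ifP.
by rewrite -(fineK h) ltry.
Qed.


Lemma measurable_norm_row n :
  measurable_fun [set: 'rV[R]_n] ((fun x => `|x|) : _ -> measurableTypeR R).
Proof. by apply: continuous_measurable_row => x; exact: norm_continuous. Qed.

Lemma measurable_norm_le n (M : R) : measurable [set x : 'rV[R]_n | `|x| <= M].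
Proof.
rewrite -[X in measurable X]setTI.
rewrite (_ : mkset _ = (fun x : 'rV[R]_n => `|x|) @^-1` `]-oo, M]%classic); last first.
  by apply/seteqP; split => x /=; rewrite in_itv.
exact: (@measurable_norm_row n measurableT _ (measurable_itv `]-oo, M])).
Qed.

Lemma integrable_bounded_support n (f : 'rV[R]_n -> R) (C M : R) :
  measurable_fun [set: 'rV[R]_n] (f : _ -> measurableTypeR R) ->
  (forall x, `|f x| <= C) -> (forall x, M < `|x| -> f x = 0) ->
  (lebesgue_row R n).-integrable setT (EFin \o f).
Proof.
move=> mf fC fM; pose B := [set x : 'rV[R]_n | `|x| <= M].
have mB : measurable B by exact: measurable_norm_le.
rewrite (_ : f = f \_ B); last first.
  apply/funext => x; rewrite patchE; case: ifPn => // /negP.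
  by rewrite inE /B /= => /negP; rewrite -ltNge => /fM.
rewrite -restrict_EFin; apply/integrable_restrict => //; rewrite setTI.
apply: measurable_bounded_integrable => //.
- by apply: (bounded_lebesgue_row mB (M := M)).
- exact: measurable_funTS.
- by exists C; split; rewrite ?num_real // => y Cy x _ /=; rewrite (le_trans (fC x))// ltW.
Qed.

Lemma bounded_setP {V : normedModType R} (A : set V) :
  bounded_set A <-> exists M, forall x, A x -> `|x| <= M.
Proof.
split=> [[M [_ H]]|[M H]]; first by exists (M + 1) => x; apply: H; rewrite ltrDl.
by exists M; split => [|M' MM' x /H h]; [exact: num_real|exact: le_trans h (ltW MM')].
Qed.

Lemma continuous_bounded_row (n : nat) (A : set 'rV[R]_n) (f : 'rV[R]_n -> R) :
  bounded_set A -> continuous f -> exists C, forall x, A x -> `|f x| <= C.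
Proof.
move=> /bounded_setP[M AM] cf; pose B := [set x : 'rV[R]_n | `|x| <= M].
have cB : compact B.
  apply: bounded_closed_compact; first by apply/bounded_setP; exists M.
  rewrite (_ : B = (fun x : 'rV[R]_n => `|x|) @^-1` [set x | x <= M]) //.
  apply: closed_comp; last exact: closed_le.
  by move=> x _; exact: norm_continuous.
have /(@continuous_compact _ _ f B) : {within B, continuous f} by exact: continuous_subspaceT.
move=> /(_ cB)/compact_bounded/bounded_setP[C HC]; exists C => x /AM Ax.
by apply: HC; exists x.
Qed.

Lemma continuous_support_bounded n (f : 'rV[R]_n -> R) (M : R) :
  continuous f -> (forall x, M < `|x| -> f x = 0) -> exists C, 0 <= C /\ forall x, `|f x| <= C.
Proof.
move=> cf fM; have bB : bounded_set [set x : 'rV[R]_n | `|x| <= M].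
  by apply/bounded_setP; exists M.
have [C HC] := continuous_bounded_row bB cf.
exists `|C|; split => // x; have [xM|Mx] := leP `|x| M; last by rewrite fM// normr0.
by rewrite (le_trans (HC x xM))// ler_norm.
Qed.

Lemma integral_row_translate n (f : 'rV[R]_n -> \bar R) c :
  measurable_fun [set: 'rV[R]_n] f ->
  (\int[lebesgue_row R n]_x f (x + c)%R = \int[lebesgue_row R n]_x f x)%E.
Proof.
have H (g : 'rV[R]_n -> \bar R) : measurable_fun [set: 'rV[R]_n] g -> (forall x, 0 <= g x)%E ->
    (\int[lebesgue_row R n]_x g (x + c)%R = \int[lebesgue_row R n]_x g x)%E.
  move=> mg g0; have := ge0_integral_row_affine c ltr01 mg g0.
  rewrite expr1n invr1 mul1e => <-.
  by apply: eq_integral => x _; rewrite scale1r.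
move=> mf; rewrite integralE [RHS]integralE; congr (_ - _)%E.
  by rewrite -[RHS](H _ (measurable_funepos mf)) => [|x]; [apply: eq_integral => x _; by rewrite !(funeposE,funenegE)|exact: funepos_ge0].
by rewrite -[RHS](H _ (measurable_funeneg mf)) => [|x]; [apply: eq_integral => x _; by rewrite !(funeposE,funenegE)|exact: funeneg_ge0].
Qed.

Lemma is_derive_line n (f : 'rV[R]_n -> R) (x v : 'rV[R]_n) (t d : R) :
  is_derive (x + t *: v) v f d -> is_derive t 1 (fun s => f (x + s *: v)) d.
Proof.
have E : (fun h : R => h^-1 *: (((fun s => f (x + s *: v)) \o shift t) (h *: 1) - f (x + t *: v)))
    = (fun h => h^-1 *: ((f \o shift (x + t *: v)) (h *: v) - f (x + t *: v))).
  apply/funext => h /=; congr (_ *: (f _ - _)).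
  by rewrite scalerDl [h *: 1]mulr1 addrCA.
by move=> [dv dE]; split; rewrite ?/derivable ?/derive E.
Qed.

(** Turns the limit defining a derivative into the limit of a sequence, the form in which dominated
    convergence applies. *)
Lemma cvg_harmonic_dnbhs : (@harmonic R) @ \oo --> 0^'.
Proof.
move=> A hA.
have H : \forall k \near \oo, (harmonic k : R) != 0 -> A (harmonic k) := @cvg_harmonic R _ hA.
by apply: filterS H => k; apply; rewrite /harmonic invr_eq0 pnatr_eq0.
Qed.

Lemma norm_delta n (i : 'I_n) : `|delta_mx ord0 i : 'rV[R]_n| <= 1.
Proof.
rewrite leNgt; apply/negP => h.
have h0 : 0 < `|delta_mx ord0 i : 'rV[R]_n| by rewrite (lt_trans _ h).
have := (norm_coord_lt (delta_mx ord0 i) 0 h0).2; rewrite subr0 ltxx => H.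
suff : false by []. apply: H => j; rewrite !mxE subr0 eqxx /=.
by apply: le_lt_trans h; case: eqP => _; rewrite ?normr1 ?normr0.
Qed.

End row_affine.

(** * The integral of a partial derivative of a function with bounded support *)

Section divergence_theorem.
Context {R : realType} {n : nat}.
Variables (i : 'I_n) (f : 'rV[R]_n -> R) (M : R).
Hypothesis cf : continuous f.
Hypothesis df : forall x, derivable f x (delta_mx ord0 i).
Hypothesis cdf : continuous (partial i f).
Hypothesis fM : forall x, M < `|x| -> f x = 0.

Let e : 'rV[R]_n := delta_mx ord0 i.

Let quot (k : nat) x := (harmonic k)^-1 * (f (harmonic k *: e + x) - f x).

Let quot_cvg x : quot ^~ x @ \oo --> partial i f x.
Proof.
have : h^-1 *: ((f \o shift x) (h *: e) - f x) @[h --> 0^'] --> partial i f x.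
  exact: df.
move=> /(cvg_comp _ _ cvg_harmonic_dnbhs); exact.
Qed.

Lemma partial_support x : M < `|x| -> partial i f x = 0.
Proof.
move=> Mx; rewrite /partial -(@derive_cst R 'rV[R]_n R 0 x e).
apply: near_eq_derive; near=> y; apply: fM; near: y.
exact: (cvgr_gt _ (@norm_continuous _ _ x) _ Mx).
Unshelve. all: by end_near. Qed.

Let mf : measurable_fun [set: 'rV[R]_n] (f : _ -> measurableTypeR R).
Proof. exact: continuous_measurable_row. Qed.

Lemma integrable_partial : (lebesgue_row R n).-integrable setT (EFin \o partial i f).
Proof.
have [C [C0 HC]] := continuous_support_bounded cdf partial_support.
exact: (integrable_bounded_support (continuous_measurable_row cdf) HC partial_support).
Qed.

Let quot_bound C : (forall x, `|partial i f x| <= C) -> forall k x, `|quot k x| <= C.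
Proof.
move=> HC k x; have h0 : 0 < harmonic k :> R by rewrite /harmonic invr_gt0.
have [||c _] := @MVT R (fun t => f (x + t *: e)) (fun t => partial i f (x + t *: e)) 0 (harmonic k) h0.
- by move=> t _; apply: is_derive_line; exact: derivableP.
- apply/continuous_subspaceT => t.
  apply: differentiable_continuous; apply/derivable1_diffP.
  have D : derivable f (x + t *: e) e := @df _.
  by have [] := is_derive_line (derivableP D).
rewrite scale0r addr0 subr0 => E.
rewrite /quot [X in f X - _]addrC E mulrC mulfK ?lt0r_neq0//; exact: HC.
Qed.

(** Every difference quotient has integral zero by translation invariance. The quotients are bounded
    by the supremum of the partial derivative (mean value theorem), so dominated convergence carries
    the zero to the limit. *)
Lemma Rintegral_partial : \int[lebesgue_row R n]_x partial i f x = 0.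
Proof.
have [C [C0 HC]] := continuous_support_bounded cdf partial_support.
(* The steps 1/(k+1) are at most 1 and the direction has norm at most 1, so all quotients vanish
   outside radius M + 1. *)
pose g x := C * \1_[set x : 'rV[R]_n | `|x| <= M + 1] x.
have mq k : measurable_fun [set: 'rV[R]_n] (quot k : _ -> measurableTypeR R).
  apply: measurable_funM => //; apply: measurable_funB => //.
  have -> : (fun x => f (harmonic k *: e + x)) = (fun x => f (1 *: x + harmonic k *: e)).
    by apply/funext => x; rewrite scale1r addrC.
  apply: (measurableT_comp mf); exact: measurable_row_scale.
have [Cf [Cf0 HCf]] := continuous_support_bounded cf fM.
have If : (lebesgue_row R n).-integrable setT (EFin \o f).
  exact: (integrable_bounded_support mf HCf fM).
have Ift k : (lebesgue_row R n).-integrable setT (EFin \o (fun x => f (harmonic k *: e + x))).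
  apply: (integrable_bounded_support (C := Cf) (M := M + 1)) => //.
    have -> : (fun x => f (harmonic k *: e + x)) = (fun x => f (1 *: x + harmonic k *: e)).
      by apply/funext => x; rewrite scale1r addrC.
    by apply: (measurableT_comp mf); exact: measurable_row_scale.
  move=> x Mx; apply: fM.
  have : `|x| <= `|harmonic k *: e + x| + `|harmonic k *: e|.
    by rewrite -{1}[x](addKr (harmonic k *: e)) addrC ler_normB.
  have : `|harmonic k *: e| <= 1.
    rewrite normrZ ger0_norm ?mulr_ile1 ?norm_delta ?normr_ge0 ?invr_ge0//.
    by rewrite /harmonic invf_le1 // ler1n.
  by move: Mx; lra.
have q0 k : (\int[lebesgue_row R n]_x (quot k x)%:E = 0)%E.
  have Id : (lebesgue_row R n).-integrable setT
      (EFin \o (fun x => f (harmonic k *: e + x) - f x)) .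
    have := integrableB measurableT (Ift k) If; apply: eq_integrable => // x _.
  rewrite /quot; under eq_integral do rewrite EFinM.
  rewrite (integralZl measurableT Id).
  rewrite (integralB_EFin measurableT (Ift k) If).
  have -> : (\int[lebesgue_row R n]_x (f (harmonic k *: e + x))%:E = \int[lebesgue_row R n]_x (f x)%:E)%E.
    under eq_integral do rewrite addrC.
    by apply: (integral_row_translate (harmonic k *: e) (f := EFin \o f)); exact/measurable_EFinP.
  rewrite subee ?mule0//; exact: integrable_fin_num.
have ig : (lebesgue_row R n).-integrable setT (EFin \o g).
  apply: (integrable_bounded_support (C := C) (M := M + 1)).
  - by apply: measurable_funM => //; apply: measurable_indic; exact: measurable_norm_le.
  - move=> x; rewrite /g indicE; case: (x \in _); rewrite ?mulr1 ?mulr0 ?normr0 ?ger0_norm//.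
  - by move=> x Mx; rewrite /g indicE memNset ?mulr0//= => xM; move: Mx; rewrite ltNge xM.
have qg k x : `|quot k x| <= g x.
  rewrite /g indicE; have [xM|Mx] := leP `|x| (M + 1).
    by rewrite mem_set// mulr1; exact: quot_bound.
  rewrite memNset/=; last by move=> xM; move: Mx; rewrite ltNge xM.
  rewrite mulr0 /quot.
  have : `|x| <= `|harmonic k *: e + x| + `|harmonic k *: e|.
    by rewrite -{1}[x](addKr (harmonic k *: e)) addrC ler_normB.
  have : `|harmonic k *: e| <= 1.
    rewrite normrZ ger0_norm ?mulr_ile1 ?norm_delta ?normr_ge0 ?invr_ge0//.
    by rewrite /harmonic invf_le1 // ler1n.
  by move=> h1 h2; rewrite !fM ?subr0 ?mulr0 ?normr0//; move: Mx h1 h2; lra.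
have mqE k : measurable_fun [set: 'rV[R]_n] (EFin \o quot k) by apply/measurable_EFinP; exact: mq.
have qc x : (quot k x)%:E @[k --> \oo] --> (partial i f x)%:E.
  by apply: cvg_EFin; [exact: nearW|exact: quot_cvg].
have [_ _] := @dominated_convergence _ _ R (lebesgue_row R n) setT measurableT
  (fun k => EFin \o quot k) (EFin \o partial i f) (EFin \o g)
  mqE
  (measurable_int _ integrable_partial)
  (aeW _ (fun x _ => qc x)) ig
  (aeW _ (fun x k _ => qg k x)).
rewrite (_ : [sequence _]_k = fun=> 0%E); last by apply/funext => k; rewrite /= q0.
by move=> /cvg_lim; rewrite lim_cst// /Rintegral => <-.
Qed.

End divergence_theorem.

(** * Functions with continuous partial derivatives *)

Section gradient_calculus.
Context {R : realType} {n : nat}.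
Implicit Types (f g : 'rV[R]_n -> R) (df dg : 'I_n -> 'rV[R]_n -> R) (x y : 'rV[R]_n).

(** C^1 regularity with the partial derivatives carried as explicit data, so that the rules below
    compute gradients of compound expressions by unification. *)
Definition has_grad f df :=
  continuous f /\
  forall i, (forall x, is_derive x (delta_mx ord0 i) f (df i x)) /\ continuous (df i).

Lemma partial_has_grad f df i : has_grad f df -> partial i f = df i.
Proof. by case=> _ /(_ i)[h _]; apply/funext => x; have [] := h x. Qed.

Lemma has_grad_Ck k f : Ck k.+1 f -> has_grad f (fun i => partial i f).
Proof.
move=> [cf h]; split => // i; have [h1 h2] := h i; split => [x|].
  exact: derivableP.
by case: k h2 {h} => [|k] [].
Qed.

Lemma partial_Ck k f i : Ck k.+1 f -> Ck k (partial i f).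
Proof. by move=> [_ /(_ i)[]]. Qed.

Lemma eq_has_grad f df dg : (forall i x, df i x = dg i x) -> has_grad f df -> has_grad f dg.
Proof. by move=> E; have -> : df = dg by apply/funext => i; apply/funext => x. Qed.

Lemma has_grad_cst (c : R) : has_grad (cst c) (fun _ _ => 0).
Proof.
split; first by move=> x; exact: cst_continuous.
by move=> i; split => x; [exact: is_derive_cst|exact: cst_continuous].
Qed.

Lemma has_grad_coord j : has_grad (fun x => x ord0 j) (fun i _ => (i == j)%:R).
Proof.
split; first by move=> x; exact: coord_continuous.
move=> i; split => x; last exact: cst_continuous.
apply: DeriveDef.
  by apply: diff_derivable; exact: differentiable_coord.
rewrite /derive.
have -> : (fun h : R => h^-1 *: (((fun x : 'rV[R]_n => x ord0 j) \o shift x)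
    (h *: delta_mx ord0 i) - x ord0 j)) = fun h => h^-1 * h * (i == j)%:R.
  apply/funext => h; rewrite /= !mxE eqxx /= addrK eq_sym.
  by rewrite /GRing.scale /= mulrA.
apply: lim_near_cst => //; near=> h.
have h0 : h != 0 by near: h; exact: nbhs_dnbhs_neq.
by rewrite mulVf // mul1r.
Unshelve. all: by end_near. Qed.

Lemma has_gradD f g df dg : has_grad f df -> has_grad g dg ->
  has_grad (fun x => f x + g x) (fun i x => df i x + dg i x).
Proof.
move=> [cf hf] [cg hg]; split; first by move=> x; apply: continuousD; [exact: cf|exact: cg].
move=> i; have [hf1 hf2] := hf i; have [hg1 hg2] := hg i; split => x.
  exact: is_deriveD.
by apply: continuousD; [exact: hf2|exact: hg2].
Qed.

Lemma has_gradM f g df dg : has_grad f df -> has_grad g dg ->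
  has_grad (fun x => f x * g x) (fun i x => df i x * g x + f x * dg i x).
Proof.
move=> [cf hf] [cg hg]; split; first by move=> x; apply: continuousM; [exact: cf|exact: cg].
move=> i; have [hf1 hf2] := hf i; have [hg1 hg2] := hg i; split => x.
  apply: is_derive_eq (is_deriveM (hf1 x) (hg1 x)) _.
  by rewrite /GRing.scale /= addrC mulrC.
exact: (continuousD (continuousM (hf2 x) (cg x)) (continuousM (cf x) (hg2 x))).
Qed.

Lemma has_gradN f df : has_grad f df -> has_grad (fun x => - f x) (fun i x => - df i x).
Proof.
move=> [cf hf]; split; first by move=> x; apply: continuousN; exact: cf.
move=> i; have [hf1 hf2] := hf i; split => x; first exact: is_deriveN.
by apply: continuousN; exact: hf2.
Qed.

Lemma has_gradB f g df dg : has_grad f df -> has_grad g dg ->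
  has_grad (fun x => f x - g x) (fun i x => df i x - dg i x).
Proof. by move=> hf hg; apply: has_gradD => //; exact: has_gradN. Qed.

Lemma has_gradZ (c : R) f df : has_grad f df ->
  has_grad (fun x => c * f x) (fun i x => c * df i x).
Proof.
move=> hf; have := has_gradM (has_grad_cst c) hf; apply: eq_has_grad => i x.
by rewrite mul0r add0r.
Qed.

Lemma has_grad_sum m (F : 'I_m -> 'rV[R]_n -> R) (dF : 'I_m -> 'I_n -> 'rV[R]_n -> R) :
  (forall k, has_grad (F k) (dF k)) ->
  has_grad (fun x => \sum_k F k x) (fun i x => \sum_k dF k i x).
Proof.
elim: m F dF => [|m IH] F dF h.
  have -> : (fun x => \sum_(k < 0) F k x) = cst 0 by apply/funext => x; rewrite big_ord0.
  by apply: eq_has_grad (has_grad_cst 0) => i x; rewrite big_ord0.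
have -> : (fun x => \sum_(k < m.+1) F k x) =
    (fun x => F ord0 x + \sum_(k < m) F (lift ord0 k) x).
  by apply/funext => x; rewrite big_ord_recl.
have := has_gradD (h ord0) (IH _ _ (fun k => h (lift ord0 k))).
by apply: eq_has_grad => i x; rewrite big_ord_recl.
Qed.

Lemma is_derive_line0 f x (v : 'rV[R]_n) d :
  is_derive (0 : R) 1 (fun s : R => f (x + s *: v)) d -> is_derive x v f d.
Proof.
have E : (fun h : R => h^-1 *: (((fun s => f (x + s *: v)) \o shift 0) (h *: 1) - f (x + 0 *: v)))
    = (fun h => h^-1 *: ((f \o shift x) (h *: v) - f x)).
  apply/funext => h /=; rewrite scale0r !addr0; congr (_ *: (f _ - _)).
  by rewrite [h *: 1]mulr1 addrC.
by move=> [dv dE]; split; move: dv dE; rewrite /derivable /derive E.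
Qed.

Lemma has_grad_comp (phi dphi : R -> R) f df : has_grad f df ->
  (forall x, is_derive (f x) 1 phi (dphi (f x))) ->
  (forall x, {for f x, continuous dphi}) ->
  has_grad (phi \o f) (fun i x => dphi (f x) * df i x).
Proof.
move=> [cf hf] dp cdp; split.
  move=> x; apply: continuous_comp; first exact: cf.
  by apply: differentiable_continuous; apply/derivable1_diffP; have [] := dp x.
move=> i; have [hf1 hf2] := hf i; split => x.
  apply: is_derive_line0.
  apply: (@is_derive1_comp _ phi (fun s => f (x + s *: delta_mx ord0 i))).
    by rewrite scale0r addr0.
  by apply: is_derive_line; rewrite scale0r addr0.
apply: continuousM; last exact: hf2.
by apply: continuous_comp; [exact: cf|exact: cdp].
Qed.

Lemma has_grad_shift f df (c : 'rV[R]_n) : has_grad f df ->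
  has_grad (fun y => f (y + c)) (fun k y => df k (y + c)).
Proof.
have cs (g : 'rV[R]_n -> R) : continuous g -> continuous (fun y => g (y + c)).
  move=> cg y; apply: (@continuous_comp _ _ _ (fun y => y + c) g); last exact: cg.
  exact: (cvgD cvg_id (cvg_cst _)).
move=> [cf hf]; split; first exact: cs.
move=> i; have [hf1 hf2] := hf i; split => [x|]; last exact: cs.
apply: is_derive_line0.
rewrite (_ : (fun s : R => _) = fun s : R => f (x + c + s *: delta_mx ord0 i)).
  by apply: is_derive_line; rewrite scale0r addr0.
by apply/funext => s; rewrite addrAC.
Qed.

Lemma has_grad_mvt f df i x (h : R) : has_grad f df -> 0 < h ->
  exists2 t, 0 < t < h & f (x + h *: delta_mx ord0 i) - f x = h * df i (x + t *: delta_mx ord0 i).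
Proof.
move=> [_ /(_ i)[hf _]] h0; set e := delta_mx ord0 i.
have D (t : R) : is_derive t 1 (fun t : R => f (x + t *: e)) (df i (x + t *: e)).
  exact: is_derive_line.
have [|c] := @MVT R (fun t => f (x + t *: e)) (fun t => df i (x + t *: e)) 0 h h0.
- apply/continuous_subspaceT => t.
  by apply: differentiable_continuous; apply/derivable1_diffP; have [] := D t.
by rewrite in_itv /= scale0r addr0 subr0 => ch E; exists c => //; rewrite E mulrC.
Qed.

Lemma has_grad_mvt0 f df i x (h : R) : has_grad f df ->
  exists2 t, `|t| <= `|h| & f (x + h *: delta_mx ord0 i) - f x = h * df i (x + t *: delta_mx ord0 i).
Proof.
move=> hf; have [h0|h0|->] := ltrgt0P h.
- have [t /andP[t0 th] E] := has_grad_mvt i x hf h0.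
  by exists t => //; rewrite !gtr0_norm// ltW.
- have h1 : 0 < - h by rewrite oppr_gt0.
  have [t /andP[t0 th] E] := has_grad_mvt i (x + h *: delta_mx ord0 i) hf h1.
  exists (h + t).
    by rewrite ler_norml; move: t0 th; rewrite !opprK => t0 th; apply/andP; split; lra.
  rewrite scaleNr addrK in E.
  by rewrite -opprB E -addrA -scalerDl mulNr opprK.
- by exists 0; rewrite ?normr0// scale0r addr0 subrr mul0r.
Qed.

(** Schwarz: the second difference of f over a square of side h, evaluated by the mean value theorem
    in the two possible orders, equals h^2 times either mixed derivative at some point of the
    square. Continuity brings both points to x; by symmetry of the claim one inequality up to e
    suffices. *)
Lemma has_grad_symm f df (d2 : 'I_n -> 'I_n -> 'rV[R]_n -> R) :
  has_grad f df -> (forall i, has_grad (df i) (d2 i)) ->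
  forall i j x, d2 i j x = d2 j i x.
Proof.
move=> hf hd.
suff H i j x e : 0 < e -> d2 i j x <= d2 j i x + e.
  move=> i j x; apply/eqP; rewrite eq_le; apply/andP; split; apply/ler_addgt0Pr => e; exact: H.
move=> e0.
have cvg a b : \forall y \near x, `|d2 a b x - d2 a b y| <= e / 2.
  have [_ /(_ b)[_ c]] := hd a.
  by have /cvgrPdist_le := c x; apply; rewrite divr_gt0.
have : \forall y \near x, `|d2 i j x - d2 i j y| <= e / 2 /\ `|d2 j i x - d2 j i y| <= e / 2.
  by near=> y; split; near: y; exact: cvg.
move=> /nbhs_ballP[d /= d0 Hd].
(* Points of the square are at distance less than 2h < d from x, inside the ball of continuity. *)
pose h := d / 3; have h0 : 0 < h by rewrite divr_gt0.
pose ei : 'rV[R]_n := delta_mx ord0 i; pose ej : 'rV[R]_n := delta_mx ord0 j.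
have inb s t : 0 < s < h -> 0 < t < h -> ball x d (x + s *: ei + t *: ej).
  move=> /andP[s0 sh] /andP[t0 th]; rewrite -ball_normE /=.
  rewrite (_ : x - _ = - (s *: ei + t *: ej)); last by rewrite -addrA opprD addNKr.
  rewrite normrN (le_lt_trans (ler_normD _ _))// !normrZ !gtr0_norm//.
  have := @norm_delta R n i; have := @norm_delta R n j; rewrite -/ei -/ej => n1 n2.
  have a1 : s * `|ei| <= s by rewrite ger_pMr.
  have a2 : t * `|ej| <= t by rewrite ger_pMr.
  by move: a1 a2 sh th; rewrite /h; lra.
have gi : has_grad (fun y => f (y + h *: ej) - f y) (fun k y => df k (y + h *: ej) - df k y).
  by apply: has_gradB => //; exact: has_grad_shift.
have gj : has_grad (fun y => f (y + h *: ei) - f y) (fun k y => df k (y + h *: ei) - df k y).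
  by apply: has_gradB => //; exact: has_grad_shift.
have [s sh E1] := has_grad_mvt i x gi h0.
have [t th E2] := has_grad_mvt j (x + s *: delta_mx ord0 i) (hd i) h0.
have [t' th' E3] := has_grad_mvt j x gj h0.
have [s' sh' E4] := has_grad_mvt i (x + t' *: delta_mx ord0 j) (hd j) h0.
rewrite E2 in E1; rewrite E4 in E3.
have E : d2 i j (x + s *: ei + t *: ej) = d2 j i (x + t' *: ej + s' *: ei).
  apply: (mulfI (lt0r_neq0 h0)); apply: (mulfI (lt0r_neq0 h0)); rewrite -E1 -E3.
  by rewrite [x + h *: delta_mx ord0 j + _]addrAC; ring.
have [H1 _] := Hd _ (inb s t sh th).
have [_] := Hd _ (inb s' t' sh' th'); rewrite [x + s' *: ei + _]addrAC -E => H2.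
by move: H1 H2; rewrite !ler_norml => /andP[a1 a2] /andP[a3 a4]; lra.
Unshelve. all: by end_near. Qed.

(** The path from x to x + y changes one coordinate at a time, [p k] being its k-th vertex. Each
    increment is a one-variable mean value, and the intermediate points stay in the sup-norm ball of
    radius |y|, where the partial derivatives vary by at most e. *)
Lemma has_grad_taylor f df x : has_grad f df -> forall e : R, 0 < e ->
  \forall y \near (0 : 'rV[R]_n),
    `|f (x + y) - f x - \sum_i y ord0 i * df i x| <= e * \sum_i `|y ord0 i|.
Proof.
move=> hf e e0.
have C : \forall z \near x, forall i, `|df i x - df i z| <= e.
  have H i : \forall z \near x, `|df i x - df i z| <= e.
    have [_ /(_ i)[_ c]] := hf.
    by have /cvgrPdist_le := c x; apply.
  exact: (@filter_forall _ 'I_n (fun i z => `|df i x - df i z| <= e) (nbhs x) _ H).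
move: C => /nbhs_ballP[d /= d0 Hd].
apply/nbhs_ballP; exists d => //= y; rewrite -ball_normE /= sub0r normrN => yd.
pose p k : 'rV[R]_n := \row_i (if (i < k)%N then y ord0 i else 0).
have pS (k : 'I_n) : p k.+1 = p k + y ord0 k *: delta_mx ord0 k.
  apply/rowP => i; rewrite !mxE eqxx /= ltnS leq_eqVlt.
  have [->|ik] := eqVneq i k; first by rewrite eqxx ltnn /= add0r mulr1.
  by rewrite (negbTE (_ : (i != k :> nat)))//= mulr0 addr0.
have p0 : p 0%N = 0 by apply/rowP => i; rewrite !mxE ltn0.
have pn : p n = y by apply/rowP => i; rewrite !mxE ltn_ord.
have -> : f (x + y) - f x = \sum_(k < n) (f (x + p k.+1) - f (x + p k)).
  rewrite -(big_mkord xpredT (fun k => f (x + p k.+1) - f (x + p k))).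
  by rewrite (telescope_sumr (fun k => f (x + p k)))// pn p0 addr0.
rewrite -sumrB mulr_sumr (le_trans (ler_norm_sum _ _ _))//; apply: ler_sum => k _.
rewrite pS addrA; have [t ty ->] := has_grad_mvt0 k (x + p k) (y ord0 k) hf.
rewrite -mulrBr normrM mulrC ler_wpM2r// distrC.
apply: Hd; rewrite -ball_normE /=.
rewrite (_ : x - _ = - (p k + t *: delta_mx ord0 k)); last by rewrite -addrA opprD addNKr.
rewrite normrN -[X in `|X|]subr0; apply/norm_coord_lt => // i; rewrite !mxE subr0 eqxx /=.
have yi := le_lt_trans (norm_coord_le y _) yd.
case: ltnP => ik.
  have [E|_] := eqVneq i k; first by move: ik; rewrite E ltnn.
  by rewrite mulr0 addr0.
by rewrite add0r; case: eqVneq => [_|_]; rewrite ?mulr1 ?mulr0 ?normr0// (le_lt_trans ty).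
Qed.

Lemma has_grad_derive f df x y : has_grad f df ->
  is_derive x y f (\sum_i y ord0 i * df i x).
Proof.
move=> hf; pose S := \sum_i `|y ord0 i|.
have S0 : 0 <= S by apply: sumr_ge0.
suff H : h^-1 *: ((f \o shift x) (h *: y) - f x) @[h --> 0^'] --> \sum_i y ord0 i * df i x.
  by apply: DeriveDef; [apply/cvg_ex; eexists; exact: H|exact: cvg_lim H].
apply/cvgrPdist_le => e e0.
(* The +1 keeps the quotient meaningful when y = 0. *)
have e1 : 0 < e / (S + 1) by rewrite divr_gt0// ltr_wpDl.
have T := has_grad_taylor x hf e1.
have Z : (fun h : R => h *: y) @ 0^' --> (0 : 'rV[R]_n).
  rewrite -(scale0r y); apply: cvgZr_tmp => //; exact: nbhs_dnbhs.
have {}T := Z _ T.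
near=> h.
have h0 : h != 0 by near: h; exact: nbhs_dnbhs_neq.
have : `|f (x + h *: y) - f x - \sum_i (h *: y) ord0 i * df i x| <= e / (S + 1) * \sum_i `|(h *: y) ord0 i|.
  by near: h.
have -> : \sum_i (h *: y) ord0 i * df i x = h * \sum_i y ord0 i * df i x.
  by rewrite mulr_sumr; apply: eq_bigr => i _; rewrite mxE mulrA.
have -> : \sum_i `|(h *: y) ord0 i| = `|h| * S.
  by rewrite mulr_sumr; apply: eq_bigr => i _; rewrite mxE normrM.
move=> H; rewrite /= [_ + x]addrC /GRing.scale /= distrC.
rewrite -(ler_pM2l (_ : 0 < `|h|)) ?normr_gt0// -normrM mulrBr mulrA divff// mul1r.
apply: (le_trans H); rewrite mulrCA ler_wpM2l// -mulrA ger_pMr//.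
by rewrite mulrC ler_pdivrMr ?mul1r ?ltr_wpDl// lerDl.
Unshelve. all: by end_near. Qed.

Lemma has_grad_segment f df x y : has_grad f df ->
  exists2 t, 0 < t < 1 & f (x + y) - f x = \sum_i y ord0 i * df i (x + t *: y).
Proof.
move=> hf.
have D (t : R) : is_derive t 1 (fun t : R => f (x + t *: y)) (\sum_i y ord0 i * df i (x + t *: y)).
  by apply: is_derive_line; exact: has_grad_derive.
have [|c] := @MVT R (fun t => f (x + t *: y)) (fun t => \sum_i y ord0 i * df i (x + t *: y)) 0 1 ltr01.
- apply/continuous_subspaceT => t.
  by apply: differentiable_continuous; apply/derivable1_diffP; have [] := D t.
by rewrite in_itv /= scale0r addr0 subr0 scale1r mulr1 => ch E; exists c.
Qed.

Lemma has_grad_continuous_grad f df i : has_grad f df -> continuous (df i).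
Proof. by case=> _ /(_ i)[]. Qed.

End gradient_calculus.

(** * Algebra of the second fundamental form *)

Section curvature_algebra.
Context {R : realType} {N : nat}.
Implicit Types (D : 'I_N -> 'I_N -> R) (a b : 'I_N -> R).

Definition sdot a b : R := \sum_i a i * b i.

Definition mulv D b : 'I_N -> R := fun i => \sum_j D i j * b j.

Lemma sdotC a b : sdot a b = sdot b a.
Proof. by apply: eq_bigr => i _; rewrite mulrC. Qed.

Lemma sum_delta (i : 'I_N) a : \sum_j (i == j)%:R * a j = a i.
Proof.
rewrite (bigD1 i)//= eqxx mul1r big1 ?addr0// => j ji.
by rewrite eq_sym (negbTE ji) mul0r.
Qed.

Lemma sdot_ge0 a : 0 <= sdot a a.
Proof. by apply: sumr_ge0 => i _; rewrite -expr2 sqr_ge0. Qed.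

Lemma sdot_eq0 a : sdot a a = 0 -> forall i, a i = 0.
Proof.
move=> h i; apply/eqP; rewrite -sqrf_eq0 expr2.
have H j : true -> 0 <= a j * a j by rewrite -expr2 sqr_ge0.
by rewrite (psumr_eq0P H h).
Qed.

Lemma sdot_CS a b : sdot a b ^+ 2 <= sdot a a * sdot b b.
Proof.
have := sdot_ge0 a; rewrite le_eqVlt => /predU1P[a0|a0].
  have z := sdot_eq0 (esym a0).
  by rewrite /sdot big1 ?expr0n/= ?mulr_ge0 ?sdot_ge0// => i _; rewrite z mul0r.
pose k := sdot a b / sdot a a.
have : 0 <= sdot (fun i => b i - k * a i) (fun i => b i - k * a i) by exact: sdot_ge0.
have -> : sdot (fun i => b i - k * a i) (fun i => b i - k * a i) =
    sdot b b + (- 2 * k) * sdot a b + k ^+ 2 * sdot a a.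
  rewrite /sdot !mulr_sumr -!big_split /=; apply: eq_bigr => i _; ring.
rewrite (_ : _ + _ = (sdot a a * sdot b b - sdot a b ^+ 2) / sdot a a); last first.
  by rewrite /k; field; exact: lt0r_neq0.
by rewrite pmulr_lge0 ?invr_gt0// subr_ge0.
Qed.

(** Squared distance of D to a three-parameter family of symmetric matrices built from b and D b;
    [hessian_split] inserts the member closest to D. The vector D b is generalised to [be], so that
    [ring] sees only its scalar products. *)
Lemma sum_sqr_test D b (s t k : R) : (forall i j, D i j = D j i) ->
  let be := mulv D b in
  \sum_i \sum_j (D i j - (s * (be i * b j + b i * be j) - t * (b i * b j) + k * (i == j)%:R)) ^+ 2 =
  \sum_i \sum_j D i j ^+ 2
  - 2 * (2 * s * sdot be be - t * sdot b be + k * \sum_i D i i)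
  + (2 * s ^+ 2 * (sdot be be * sdot b b + sdot b be ^+ 2) + t ^+ 2 * sdot b b ^+ 2
     + k ^+ 2 * N%:R - 4 * s * t * sdot b be * sdot b b + 4 * s * k * sdot b be
     - 2 * t * k * sdot b b).
Proof.
move=> symD be; rewrite {}/be.
move: (mulv D b) (fun i => erefl : \sum_j D i j * b j = mulv D b i) => be HB.
have inner i : \sum_j (D i j - (s * (be i * b j + b i * be j) - t * (b i * b j) + k * (i == j)%:R)) ^+ 2 =
   \sum_j D i j ^+ 2 - 2 * (s * be i - t * b i) * be i - 2 * s * b i * (\sum_j D i j * be j)
   + (s * be i - t * b i) ^+ 2 * sdot b b + (s * b i) ^+ 2 * sdot be be
   + 2 * (s * be i - t * b i) * (s * b i) * sdot b be
   + k ^+ 2 - 2 * k * D i i + 2 * k * (s * be i - t * b i) * b i + 2 * k * s * b i * be i.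
  transitivity (\sum_j D i j ^+ 2 + (- 2 * (s * be i - t * b i)) * (\sum_j D i j * b j)
     + (- 2 * s * b i) * (\sum_j D i j * be j)
   + (s * be i - t * b i) ^+ 2 * sdot b b + (s * b i) ^+ 2 * sdot be be
   + (2 * (s * be i - t * b i) * (s * b i)) * sdot b be
   + \sum_j (i == j)%:R * (k ^+ 2 - 2 * k * D i j + 2 * k * (s * be i - t * b i) * b j + 2 * k * s * b i * be j)).
    rewrite /sdot !mulr_sumr -!big_split /=; apply: eq_bigr => j _.
    by case: (i == j); rewrite /=; ring.
  by rewrite sum_delta HB; ring.
rewrite (eq_bigr _ (fun i _ => inner i)).
have E1 : \sum_i b i * (\sum_j D i j * be j) = sdot be be.
  under eq_bigr do rewrite mulr_sumr.
  rewrite exchange_big; apply: eq_bigr => j _; rewrite -[X in _ = X * _]HB mulr_suml.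
  by apply: eq_bigr => i _; rewrite (symD i j); ring.
move: (sdot b b) (erefl : \sum_i b i * b i = sdot b b) inner => bb Hbb _.
move: (sdot b be) (erefl : \sum_i b i * be i = sdot b be) => bbe Hbbe.
move: (sdot be be) (erefl : \sum_i be i * be i = sdot be be) E1 => ee Hee E1.
transitivity (\sum_i \sum_j D i j ^+ 2 + (- 2 * s + s ^+ 2 * bb) * (\sum_i be i * be i)
  + (2 * t - 2 * s * t * bb + 2 * s ^+ 2 * bbe + 4 * k * s) * (\sum_i b i * be i)
  + (- 2 * s) * (\sum_i b i * (\sum_j D i j * be j))
  + (t ^+ 2 * bb + s ^+ 2 * ee - 2 * s * t * bbe - 2 * k * t) * (\sum_i b i * b i)
  + (- 2 * k) * (\sum_i D i i) + \sum_(i < N) k ^+ 2).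
  by rewrite !mulr_sumr -!big_split /=; apply: eq_bigr => i _; ring.
by rewrite E1 Hbb Hbbe Hee sumr_const card_ord -[in LHS]mulr_natr; ring.
Qed.

(** The subtracted matrix agrees with D on b, has the same trace, and acts as k times the identity
    on the complement of b. It has least norm among symmetric matrices with this action on b and
    this trace, so its squared distance to D is the difference of the squared norms, and that is
    nonnegative. *)
Lemma hessian_split D b : (1 < N)%N -> (forall i j, D i j = D j i) -> 0 < sdot b b ->
  2 * sdot (mulv D b) (mulv D b) / sdot b b - (sdot b (mulv D b) / sdot b b) ^+ 2
  + (\sum_i D i i - sdot b (mulv D b) / sdot b b) ^+ 2 / (N%:R - 1)
  <= \sum_i \sum_j D i j ^+ 2.
Proof.
move=> N1 symD b0; set be := mulv D b; set al := sdot b be / sdot b b.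
have N0 : 0 < N%:R - 1 :> R by rewrite subr_gt0 ltr1n.
pose k := (\sum_i D i i - al) / (N%:R - 1).
have := sum_sqr_test b (sdot b b)^-1 ((al + k) / sdot b b) k symD; rewrite /= -/be => E.
have : 0 <= \sum_i \sum_j (D i j - ((sdot b b)^-1 * (be i * b j + b i * be j) - ((al + k) / sdot b b) * (b i * b j) + k * (i == j)%:R)) ^+ 2.
  by apply: sumr_ge0 => i _; apply: sumr_ge0 => j _; exact: sqr_ge0.
rewrite E => h; rewrite -subr_ge0; apply: (le_trans h).
rewrite le_eqVlt; apply/orP; left; apply/eqP.
have e1 : sdot b be = al * sdot b b by rewrite /al mulfVK// lt0r_neq0.
have e2 : \sum_i D i i = k * (N%:R - 1) + al by rewrite /k mulfVK ?lt0r_neq0//; ring.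
rewrite e1 e2; field; rewrite ?lt0r_neq0//.
Qed.

(** A refined Kato inequality, with W = 1/v. The trace constraint is the source of the gain: if the
    curvature in the direction of b is a, the other N-1 diagonal entries sum to - rho - a and
    contribute at least (rho + a)^2/(N-1). *)
Lemma shape_operator_bound D b (W rho : R) : (2 < N)%N -> (forall i j, D i j = D j i) ->
  sdot b b < 1 -> W ^+ 2 * (1 - sdot b b) = 1 ->
  W * (\sum_i D i i) + W ^+ 3 * sdot b (mulv D b) = - rho ->
  (1 + (2 * (N%:R - 1))^-1) * (W ^+ 4 * sdot (mulv D b) (mulv D b) + W ^+ 6 * sdot b (mulv D b) ^+ 2) - rho ^+ 2 <=
  W ^+ 2 * (\sum_i \sum_j D i j ^+ 2) + 2 * W ^+ 4 * sdot (mulv D b) (mulv D b) + W ^+ 6 * sdot b (mulv D b) ^+ 2.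
Proof.
move=> N2 symD b1 WE; set be := mulv D b => Hrho.
have D2 : 0 <= \sum_i \sum_j D i j ^+ 2.
  by apply: sumr_ge0 => i _; apply: sumr_ge0 => j _; exact: sqr_ge0.
have N1 : 2 <= N%:R - 1 :> R by have : 3%:R <= N%:R :> R by [rewrite ler_nat]; lra.
(* The split divides by |b|^2; for b = 0 both D b and the left-hand form vanish. *)
have := sdot_ge0 b; rewrite le_eqVlt => /predU1P[b0|b0].
  have bz := sdot_eq0 (esym b0).
  have bez i : be i = 0 by rewrite /be /mulv big1// => j _; rewrite bz mulr0.
  have -> : sdot be be = 0 by rewrite /sdot big1// => i _; rewrite bez mul0r.
  have -> : sdot b be = 0 by rewrite /sdot big1// => i _; rewrite bez mulr0.
  rewrite expr0n /= !mulr0 !addr0 mulr0 sub0r.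
  by rewrite (@le_trans _ _ 0)// ?oppr_le0 ?sqr_ge0// mulr_ge0 ?sqr_ge0.
have := hessian_split (ltnW N2) symD b0; rewrite /= -/be.
set al := sdot b be / sdot b b; set r := sdot b b; set S := \sum_i D i i; set DD := \sum_i _ => HS.
(* The squared length of the part of D b / |b| orthogonal to b, hence nonnegative by
   Cauchy-Schwarz. *)
pose B := sdot be be / r - al ^+ 2.
have B0 : 0 <= B.
  rewrite /B subr_ge0 /al expr_div_n ler_pdivrMr ?exprn_gt0//.
  rewrite -/r (_ : _ / _ * _ = r * sdot be be); last by field; exact: lt0r_neq0.
  exact: sdot_CS.
have e1 : sdot b be = al * r by rewrite /al mulfVK// lt0r_neq0.
have e2 : sdot be be = r * (B + al ^+ 2) by rewrite /B; field; exact: lt0r_neq0.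
have W2r : W ^+ 2 * r = W ^+ 2 - 1 by rewrite -WE -/r; ring.
pose a := W ^+ 3 * al.
have e3 : W * (S - al) = - rho - a.
  rewrite -Hrho -/S e1 /a (_ : W ^+ 3 * (al * r) = W * al * (W ^+ 2 * r)); last by ring.
  by rewrite W2r; ring.
have e4 : W ^+ 4 * sdot be be + W ^+ 6 * sdot b be ^+ 2 = r * (a ^+ 2 + W ^+ 4 * B).
  rewrite e1 e2 (_ : W ^+ 6 * (al * r) ^+ 2 = W ^+ 4 * r * al ^+ 2 * (W ^+ 2 * r)); last by ring.
  by rewrite W2r /a; ring.
have H : a ^+ 2 + 2 * (W ^+ 4 * B) + (rho + a) ^+ 2 / (N%:R - 1) <=
   W ^+ 2 * DD + 2 * W ^+ 4 * sdot be be + W ^+ 6 * sdot b be ^+ 2.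
  have : W ^+ 2 * (2 * sdot be be / r - al ^+ 2 + (S - al) ^+ 2 / (N%:R - 1)) <= W ^+ 2 * DD.
    by rewrite ler_wpM2l// sqr_ge0.
  have Mn0 : N%:R - 1 != 0 :> R by apply: lt0r_neq0; exact: lt_le_trans N1.
  have rn0 : r != 0 by exact: lt0r_neq0.
  move: (W ^+ 2 * DD) => X.
  have -> : W ^+ 2 * (2 * sdot be be / r - al ^+ 2 + (S - al) ^+ 2 / (N%:R - 1)) =
      a ^+ 2 + 2 * (W ^+ 4 * B) + (rho + a) ^+ 2 / (N%:R - 1)
      - W ^+ 4 * sdot be be - (W ^+ 4 * sdot be be + W ^+ 6 * sdot b be ^+ 2); last by lra.
  have -> : W ^+ 2 * (2 * sdot be be / r - al ^+ 2 + (S - al) ^+ 2 / (N%:R - 1)) =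
      W ^+ 2 * (2 * sdot be be / r - al ^+ 2) + (W * (S - al)) ^+ 2 / (N%:R - 1).
    by field; rewrite ?Mn0 ?rn0.
  rewrite e4 e3 e2 (_ : W ^+ 4 * (_ * _) = W ^+ 2 * (W ^+ 2 * r) * (B + al ^+ 2)); last by ring.
  rewrite (_ : r * (a ^+ 2 + _) = W ^+ 2 * r * (W ^+ 4 * al ^+ 2 + W ^+ 2 * B)); last by rewrite /a; ring.
  by rewrite W2r /a; field; rewrite ?Mn0 ?rn0.
apply: le_trans H; rewrite e4.
have WB : 0 <= W ^+ 4 * B by rewrite mulr_ge0// (_ : W ^+ 4 = (W ^+ 2) ^+ 2) ?sqr_ge0// -exprM.
set M := N%:R - 1 in N1 *; set WB' := W ^+ 4 * B in WB *.
have M0 : 0 < M by apply: lt_le_trans N1.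
have X0 : 0 <= a ^+ 2 + WB' by rewrite addr_ge0 ?sqr_ge0.
pose c := M^-1; have c0 : 0 <= c by rewrite invr_ge0 ltW.
have c1 : c <= 1 by rewrite invf_le1//; lra.
rewrite invfM -/c.
have : (1 + 2^-1 * c) * (r * (a ^+ 2 + WB')) <= (1 + 2^-1 * c) * (a ^+ 2 + WB').
  by apply: ler_wpM2l; [lra|rewrite ler_piMl// ltW].
(* With c = 1/(N-1), completing the square gives c (rho + a)^2 - c a^2/2 + rho^2 = (c/2)(2 rho +
   a)^2 + (1 - c) rho^2. *)
have := mulr_ge0 c0 (sqr_ge0 (2 * rho + a)).
have : 0 <= (1 - c) * rho ^+ 2 by rewrite mulr_ge0 ?sqr_ge0// subr_ge0.
have : 0 <= (1 - 2^-1 * c) * WB' by rewrite mulr_ge0//; lra.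
by lra.
Qed.

(** With d = 1/(2M), the share d/4 = 1/(8M) of [A2] is retained for the Hessian integral. The
    remaining share dominates (1 + g + d/2) [T2], as g <= d/8 and d <= 1/4, and the spare d/2
    absorbs the cross term rho tau by Young at the price 4 M rho^2. *)
Lemma coercive_form (M g A2 T2 tau rho : R) : 2 <= M -> 0 < g -> g <= (16 * M)^-1 ->
  tau ^+ 2 <= T2 -> (1 + (2 * M)^-1) * T2 - rho ^+ 2 <= A2 ->
  (8 * M)^-1 * A2 - (2 + 4 * M) * rho ^+ 2 <=
  A2 - (1 + g) * T2 - (1 + g) * rho * tau - rho ^+ 2.
Proof.
move=> M2 g0 gM tT HA; have M0 : 0 < M by lra.
pose d := (2 * M)^-1; have d0 : 0 < d by rewrite invr_gt0 mulr_gt0.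
have dM : d * M = 2^-1 by rewrite /d; field; exact: lt0r_neq0.
have d14 : d <= 4^-1 by rewrite lef_pV2 ?posrE ?mulr_gt0//; lra.
have -> : (8 * M)^-1 = d / 4 by rewrite /d; field; exact: lt0r_neq0.
have {}gM : g <= d / 8 by rewrite (le_trans gM)// /d -invfM lef_pV2 ?posrE ?mulr_gt0//; lra.
have T0 : 0 <= T2 by apply: le_trans tT; exact: sqr_ge0.
rewrite -/d in HA.
have H1 : (1 - d / 4) * ((1 + d) * T2 - rho ^+ 2) <= (1 - d / 4) * A2.
  by rewrite ler_wpM2l//; lra.
have r0 := sqr_ge0 rho.
have H2 : 0 <= d * rho ^+ 2 by rewrite mulr_ge0// ltW.
have H3 : (1 + g + d / 2) * T2 <= (1 - d / 4) * (1 + d) * T2.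
  by rewrite ler_wpM2r//; nra.
have H4 : d / 2 * tau ^+ 2 <= d / 2 * T2 by rewrite ler_wpM2l//; lra.
have H5 : (1 + g) * rho * tau <= d / 2 * tau ^+ 2 + 4 * M * rho ^+ 2.
  have : 0 <= (d * tau - (1 + g) * rho) ^+ 2 by exact: sqr_ge0.
  have g2 : (1 + g) ^+ 2 <= 2 by nra.
  have : (1 + g) ^+ 2 * rho ^+ 2 <= 2 * rho ^+ 2 by rewrite ler_wpM2r.
  move=> h1 h2; rewrite -(ler_pM2l d0).
  have -> : d * (d / 2 * tau ^+ 2 + 4 * M * rho ^+ 2) = d ^+ 2 / 2 * tau ^+ 2 + 4 * (d * M) * rho ^+ 2 by ring.
  by rewrite dM; lra.
lra.
Qed.

End curvature_algebra.

(** * The divergence identity *)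

Section lorentz_calculus.
Context {R : realType} {N : nat}.
Variables (u rho : 'rV[R]_N -> R) (x0 : 'rV[R]_N).
Hypothesis C3u : Ck 3 u.
Hypothesis u_spacelike : forall x, enorm (grad u x) < 1.
Hypothesis C1rho : Ck 1 rho.
Hypothesis u_eq : mean_curvature_eq u rho.

Definition du x : 'I_N -> R := fun i => partial i u x.
Definition d2u x : 'I_N -> 'I_N -> R := fun i j => partial j (partial i u) x.
Definition factor2 x : R := 1 - sdot (du x) (du x).

Lemma enorm_grad x : enorm (grad u x) ^+ 2 = sdot (du x) (du x).
Proof.
rewrite /enorm sqr_sqrtr; last first.
  by apply: sumr_ge0 => i _; apply: sumr_ge0 => j _; exact: sqr_ge0.
rewrite (bigD1 ord0)//= [X in _ + X]big1 ?addr0; last by move=> i; rewrite (ord1 i) eqxx.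
by apply: eq_bigr => j _; rewrite mxE expr2.
Qed.

Lemma factor2_gt0 x : 0 < factor2 x.
Proof.
rewrite /factor2 -enorm_grad subr_gt0 expr_lt1//; exact: sqrtr_ge0.
Qed.

Lemma factor2_le1 x : factor2 x <= 1.
Proof. by rewrite /factor2 gerBl sdot_ge0. Qed.

Local Notation v := (spacelike_factor u).

Lemma spacelike_factorE x : v x = Num.sqrt (factor2 x).
Proof. by rewrite /spacelike_factor enorm_grad. Qed.

Lemma spacelike_factor_gt0 x : 0 < v x.
Proof. by rewrite spacelike_factorE sqrtr_gt0 factor2_gt0. Qed.

Lemma spacelike_factor_le1 x : v x <= 1.
Proof. by rewrite spacelike_factorE -sqrtr1 ler_wsqrtr// factor2_le1. Qed.

Lemma spacelike_factor_sqr x : v x ^+ 2 = 1 - sdot (du x) (du x).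
Proof. by rewrite spacelike_factorE sqr_sqrtr// ltW// factor2_gt0. Qed.

Lemma powR_spacelike_factor a x : v x `^ a = factor2 x `^ (a / 2).
Proof. by rewrite spacelike_factorE -powR12_sqrt ?(ltW (factor2_gt0 x))// -powRrM mulrC. Qed.

Lemma has_grad_u : has_grad u (fun i x => du x i).
Proof. exact: (has_grad_Ck C3u). Qed.

Lemma has_grad_du i : has_grad (fun x => du x i) (fun j x => d2u x i j).
Proof. exact: (has_grad_Ck (partial_Ck i C3u)). Qed.

Lemma has_grad_d2u i j : has_grad (fun x => d2u x i j) (fun k => partial k (partial j (partial i u))).
Proof. exact: (has_grad_Ck (partial_Ck j (partial_Ck i C3u))). Qed.

Lemma d2u_sym x i j : d2u x i j = d2u x j i.
Proof.
exact: (has_grad_symm (d2 := fun i j x => d2u x i j) has_grad_u has_grad_du).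
Qed.

(* D^2 u Du, so that [d_i v = - hess_grad i / v]. *)
Definition hess_grad x : 'I_N -> R := mulv (d2u x) (du x).

Lemma has_grad_factor2 : has_grad factor2 (fun i x => - 2 * hess_grad x i).
Proof.
have := has_gradB (has_grad_cst 1) (has_grad_sum (fun k => has_gradM (has_grad_du k) (has_grad_du k))).
apply: eq_has_grad => i x; rewrite /hess_grad /mulv mulr_sumr sub0r -sumrN.
by apply: eq_bigr => k _; rewrite (d2u_sym x i k); ring.
Qed.

Lemma continuous_powR (a z : R) : 0 < z -> {for z, continuous (fun t : R => t `^ a)}.
Proof.
move=> z0; apply: differentiable_continuous; apply/derivable1_diffP.
by have [] := is_derive1_powR a z0.
Qed.

(** Differentiated as the power a/2 of v^2, which is positive and polynomial in Du; no square root
    is differentiated, and a single rule serves every real exponent. *)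
Lemma has_grad_powR_spacelike a :
  has_grad (fun x => v x `^ a) (fun i x => - a * (v x `^ (a - 2) * hess_grad x i)).
Proof.
have -> : (fun x => v x `^ a) = (fun t => t `^ (a / 2)) \o factor2.
  by apply/funext => x; rewrite powR_spacelike_factor.
have := @has_grad_comp _ _ (fun t => t `^ (a / 2)) (fun t => a / 2 * t `^ (a / 2 - 1)) _ _ has_grad_factor2 _ _.
move=> /(_ (fun x => is_derive1_powR _ (factor2_gt0 x))) H.
have C x : {for factor2 x, continuous (fun t : R => a / 2 * t `^ (a / 2 - 1))}.
  apply: continuousM; first exact: cst_continuous.
  exact: continuous_powR (factor2_gt0 x).
apply: eq_has_grad (H C) => i x.
by rewrite powR_spacelike_factor (_ : (a - 2) / 2 = a / 2 - 1); [field|field].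
Qed.

(* The horizontal part Du / v of the unit normal to the graph of u; [dflux i k] is its
   k-th partial derivative. *)
Definition flux (i : 'I_N) x : R := v x `^ (-1) * du x i.
Definition dflux (i k : 'I_N) x : R :=
  v x `^ (-3) * hess_grad x k * du x i + v x `^ (-1) * d2u x i k.

Lemma has_grad_flux i : has_grad (flux i) (fun k => dflux i k).
Proof.
have := has_gradM (has_grad_powR_spacelike (-1)) (has_grad_du i).
apply: eq_has_grad => k x; rewrite /dflux opprK mul1r.
by rewrite (_ : -1 - 2 = -3)//; ring.
Qed.

Lemma has_grad_hess_grad k : exists dbet, has_grad (fun x => hess_grad x k) dbet.
Proof.
eexists; exact: (has_grad_sum (fun l => has_gradM (has_grad_d2u k l) (has_grad_du l))).
Qed.

(** The third derivatives of [u] stay anonymous: below, only the symmetry of the second derivatives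
    of [flux] and the derivative of its divergence are used. *)
Lemma has_grad_dflux : exists d2hp : 'I_N -> 'I_N -> 'I_N -> 'rV[R]_N -> R,
  forall i k, has_grad (dflux i k) (d2hp i k).
Proof.
have /choice[dbet Hb] := has_grad_hess_grad.
eexists => i k; rewrite /dflux.
exact: (has_gradD (has_gradM (has_gradM (has_grad_powR_spacelike (-3)) (Hb k)) (has_grad_du i))
                  (has_gradM (has_grad_powR_spacelike (-1)) (has_grad_d2u i k))).
Qed.

Lemma div_flux x : \sum_i dflux i i x = - rho x.
Proof.
rewrite -u_eq opprK /divergence; apply: eq_bigr => i _.
rewrite -(partial_has_grad i (has_grad_flux i)); congr (partial i _ x).
by apply/funext => y; rewrite !mxE /flux powR_inv1// ltW// spacelike_factor_gt0.
Qed.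

(* Its divergence involves no third derivative of u: the trace of [dflux] is [- rho]. *)
Definition flux_drift i x : R := \sum_k flux k x * dflux i k x + rho x * flux i x.

(** Schwarz gives sum_i d_i d_k p_i = d_k (div p) = - d_k rho. Contracted with p_k this cancels the
    derivative of rho in div (rho p), and rho div p supplies - rho^2. *)
Lemma has_grad_flux_drift : exists dcurv : 'I_N -> 'I_N -> 'rV[R]_N -> R,
  (forall i, has_grad (flux_drift i) (dcurv i)) /\
  forall x, \sum_i dcurv i i x = \sum_i \sum_k dflux k i x * dflux i k x - rho x ^+ 2.
Proof.
have [d2hp H2] := has_grad_dflux.
have Hr := has_grad_Ck C1rho.
exists (fun i j x => \sum_k (dflux k j x * dflux i k x + flux k x * d2hp i k j x)
   + (partial j rho x * flux i x + rho x * dflux i j x)); split.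
  move=> i; apply: has_gradD; last exact: has_gradM Hr (has_grad_flux i).
  exact: (has_grad_sum (fun k => has_gradM (has_grad_flux k) (H2 i k))).
move=> x.
have S i k : d2hp i k i x = d2hp i i k x by exact: (has_grad_symm (has_grad_flux i) (H2 i)).
have T k : \sum_i d2hp i i k x = - partial k rho x.
  have E1 := partial_has_grad k (has_grad_sum (fun i => H2 i i)).
  have E2 := partial_has_grad k (has_gradN Hr).
  have := congr1 (@^~ x) E1; rewrite /= => <-; have := congr1 (@^~ x) E2; rewrite /= => <-.
  by congr (partial k _ x); apply/funext => y; rewrite div_flux.
transitivity (\sum_i \sum_k dflux k i x * dflux i k x + \sum_k \sum_i flux k x * d2hp i k i x
    + \sum_k partial k rho x * flux k x + rho x * \sum_i dflux i i x).
  rewrite mulr_sumr [X in _ + X + _ + _]exchange_big -!big_split /=.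
  by apply: eq_bigr => i _; rewrite -big_split /= addrA.
rewrite div_flux [X in _ + X + _ + _](_ : _ = - \sum_k partial k rho x * flux k x); first by ring.
rewrite -sumrN; apply: eq_bigr => k _.
by rewrite -mulr_sumr (eq_bigr _ (fun i _ => S i k)) T; ring.
Qed.

Definition disp (x : 'rV[R]_N) : 'I_N -> R := fun i => x ord0 i - x0 ord0 i.
Definition height (x : 'rV[R]_N) : R := u x - u x0.
Definition support_fun (x : 'rV[R]_N) : R := sdot (disp x) (du x) - height x.
Definition lorentz_sq (x : 'rV[R]_N) : R := sdot (disp x) (disp x) - height x ^+ 2.

Lemma has_grad_disp j : has_grad (fun x => disp x j) (fun i _ => (i == j)%:R).
Proof.
have := has_gradB (has_grad_coord j) (has_grad_cst (x0 ord0 j)).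
by apply: eq_has_grad => i x; rewrite subr0.
Qed.

Lemma has_grad_height : has_grad height (fun i x => du x i).
Proof.
have := has_gradB has_grad_u (has_grad_cst (u x0)).
by apply: eq_has_grad => i x; rewrite subr0.
Qed.

Lemma has_grad_support : has_grad support_fun (fun i x => mulv (d2u x) (disp x) i).
Proof.
have := has_gradB (has_grad_sum (fun j => has_gradM (has_grad_disp j) (has_grad_du j))) has_grad_height.
apply: eq_has_grad => i x; rewrite big_split /=.
rewrite (eq_bigr _ (fun j _ => mulrC _ _)) -[X in X + _ - _](eq_bigr _ (fun j _ => mulrC _ _)).
rewrite (sum_delta i (du x)) addrAC subrr add0r.
by apply: eq_bigr => j _; rewrite d2u_sym mulrC.
Qed.

Lemma has_grad_lorentz_sq : has_grad lorentz_sq (fun i x => 2 * (disp x i - height x * du x i)).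
Proof.
have := has_gradB (has_grad_sum (fun j => has_gradM (has_grad_disp j) (has_grad_disp j)))
   (has_gradM has_grad_height has_grad_height).
apply: eq_has_grad => i x; rewrite big_split /=.
rewrite (sum_delta i (disp x)) (eq_bigr _ (fun j _ => mulrC _ _)) (sum_delta i (disp x)); ring.
Qed.


Section divergence_identity.
Variables (g : R) (eta deta E : R -> R).
Hypothesis deta_derive : forall l : R, is_derive l 1 eta (deta l).
Hypothesis deta_cont : continuous deta.
Hypothesis E_derive : forall l : R, is_derive l 1 E (- (eta l / 2)).

Let eta_cont : continuous eta.
Proof.
move=> l; apply: differentiable_continuous; apply/derivable1_diffP.
by have [] := deta_derive l.
Qed.

Definition test_field (i : 'I_N) (x : 'rV[R]_N) : R :=
  v x `^ g * (eta (lorentz_sq x) * (v x `^ 1 * disp x i + flux i x * support_fun x))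
  - g * (E (lorentz_sq x) * (v x `^ (g + 1) * flux_drift i x)).

(** The Lorentz product of the position vector (y, w) with the unit normal (Du, 1)/v. Hence ell +
    sigma^2 is the squared length of the tangential part of the position vector. *)
Definition sigma x : R := support_fun x / v x.
(* The squared norm of the second fundamental form of the graph of u; [tilt2] is the part
   of it carried by the gradient of v, and [tau ^+ 2 <= tilt2]. *)
Definition shape2 x : R := (v x) ^- 2 * (\sum_i \sum_j d2u x i j ^+ 2)
  + 2 * (v x) ^- 4 * sdot (hess_grad x) (hess_grad x) + (v x) ^- 6 * sdot (du x) (hess_grad x) ^+ 2.
Definition tilt2 x : R := (v x) ^- 4 * sdot (hess_grad x) (hess_grad x) + (v x) ^- 6 * sdot (du x) (hess_grad x) ^+ 2.
Definition tau x : R := (v x) ^- 3 * sdot (du x) (hess_grad x).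

(** [dflux] is the matrix of the shape operator in graph coordinates. It need not be symmetric
    there, so |A|^2 is the trace of its square and not its sum of squares. *)
Lemma sum_dflux x : \sum_i \sum_k dflux k i x * dflux i k x = shape2 x.
Proof.
rewrite /shape2 /dflux powR_inv1 ?(ltW (spacelike_factor_gt0 x))// powR_invn ?(ltW (spacelike_factor_gt0 x))//.
move: (spacelike_factor_gt0 x) => /lt0r_neq0; move: (v x) => w w0.
have HB k : \sum_j d2u x k j * du x j = hess_grad x k by [].
move: (hess_grad x) HB => be HB.
have inner i : \sum_k (w ^- 3 * be i * du x k + w^-1 * d2u x k i) * (w ^- 3 * be k * du x i + w^-1 * d2u x i k) =
   w ^- 2 * (\sum_j d2u x i j ^+ 2) + w ^- 6 * (be i * du x i) * (\sum_k du x k * be k)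
   + w ^- 4 * (be i * be i) + w ^- 4 * (du x i * \sum_k (d2u x i k * be k)).
  transitivity (w ^- 2 * (\sum_j d2u x i j ^+ 2) + w ^- 6 * (be i * du x i) * (\sum_k du x k * be k)
   + w ^- 4 * be i * (\sum_k d2u x i k * du x k) + w ^- 4 * du x i * \sum_k (d2u x i k * be k)).
    rewrite !mulr_sumr -!big_split /=; apply: eq_bigr => k _.
    by rewrite (d2u_sym x k i); field.
  by rewrite HB !mulrA.
rewrite (eq_bigr _ (fun i _ => inner i)).
have E1 : \sum_i du x i * (\sum_k d2u x i k * be k) = sdot be be.
  under eq_bigr do rewrite mulr_sumr.
  rewrite exchange_big; apply: eq_bigr => k _.
  rewrite -[X in _ = X * _]HB mulr_suml; apply: eq_bigr => i _.
  by rewrite (d2u_sym x i k); ring.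
rewrite !big_split /= -!mulr_sumr -mulr_suml -mulr_sumr E1.
rewrite [\sum_i be i * du x i](_ : _ = sdot (du x) be); last exact: sdotC.
by rewrite -/(sdot be be) -/(sdot (du x) be); field.
Qed.

Lemma flux_driftE i x : flux_drift i x = (v x) ^- 2 * hess_grad x i
  + (v x) ^- 4 * sdot (du x) (hess_grad x) * du x i + rho x / v x * du x i.
Proof.
rewrite /flux_drift /flux /dflux powR_inv1 ?(ltW (spacelike_factor_gt0 x))// powR_invn ?(ltW (spacelike_factor_gt0 x))//.
move: (spacelike_factor_gt0 x) => /lt0r_neq0; move: (v x) => w w0; congr (_ + _); last by ring.
have HB k : \sum_j d2u x k j * du x j = hess_grad x k by [].
move: (hess_grad x) HB => be HB.
rewrite -[X in w ^- 2 * X]HB /sdot !(mulr_sumr, mulr_suml) -big_split /=.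
by apply: eq_bigr => k _; field.
Qed.

(** The derivative matrix contains third derivatives of [u] and is left existential; only its trace
    is evaluated. Real powers of v are first written as v^g times integer powers, after which the
    identity is rational. *)
Lemma has_grad_test_field : exists dF : 'I_N -> 'I_N -> 'rV[R]_N -> R,
  (forall i, has_grad (test_field i) (dF i)) /\
  forall x, \sum_i dF i i x = v x `^ (g + 1) * (
    N%:R * eta (lorentz_sq x) + 2 * deta (lorentz_sq x) * (lorentz_sq x + sigma x ^+ 2)
    - eta (lorentz_sq x) * rho x * sigma x
    + g * eta (lorentz_sq x) * rho x * (sigma x + height x * v x)
    - g * E (lorentz_sq x) * (shape2 x - (1 + g) * tilt2 x - (1 + g) * rho x * tau x - rho x ^+ 2)).
Proof.
have [dcurv [Hc Hdiv]] := has_grad_flux_drift.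
have HE : has_grad (eta \o lorentz_sq) (fun i x => deta (lorentz_sq x) * (2 * (disp x i - height x * du x i))).
  by apply: has_grad_comp has_grad_lorentz_sq _ _ => x //; apply: deta_cont.
have HEE : has_grad (E \o lorentz_sq) (fun i x => - (eta (lorentz_sq x) / 2) * (2 * (disp x i - height x * du x i))).
  apply: (has_grad_comp (dphi := fun l => - (eta l / 2))) has_grad_lorentz_sq _ _ => x //.
  apply: continuousN; apply: continuousM; [exact: eta_cont|exact: cst_continuous].
pose X i x := v x `^ 1 * disp x i + flux i x * support_fun x.
pose dX i j x := - 1 * (v x `^ (1 - 2) * hess_grad x j) * disp x i + v x `^ 1 * (j == i)%:R
  + (dflux i j x * support_fun x + flux i x * mulv (d2u x) (disp x) j).
have HX i : has_grad (X i) (dX i).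
  exact: has_gradD (has_gradM (has_grad_powR_spacelike 1) (has_grad_disp i)) (has_gradM (has_grad_flux i) has_grad_support).
eexists; split.
  move=> i; apply: has_gradB.
    exact: has_gradM (has_grad_powR_spacelike g) (has_gradM HE (HX i)).
  apply: has_gradZ; exact: has_gradM HEE (has_gradM (has_grad_powR_spacelike (g + 1)) (Hc i)).
move=> x /=.
have w0 : v x != 0 by rewrite lt0r_neq0 ?spacelike_factor_gt0.
have pw (k : R) : v x `^ (g + k) = v x `^ g * v x `^ k by rewrite powRD// w0 implybT.
(* The derivative of v along y and the term p . (D^2u y) cancel by symmetry of D^2u; there remain N
   v and the support function times div p. *)
have trX : \sum_i dX i i x = N%:R * v x - rho x * support_fun x.
  transitivity (\sum_i (- (v x)^-1 * (hess_grad x i * disp x i)) + \sum_(i < N) v x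
     + support_fun x * (\sum_i dflux i i x) + (v x)^-1 * \sum_i du x i * mulv (d2u x) (disp x) i).
    rewrite !mulr_sumr -!big_split /=; apply: eq_bigr => i _.
    rewrite /dX eqxx powRr1 ?(ltW (spacelike_factor_gt0 x))// (_ : 1 - 2 = -1); last by ring.
    by rewrite /flux !powR_inv1 ?(ltW (spacelike_factor_gt0 x))//=; ring.
  rewrite div_flux sumr_const card_ord -mulr_sumr.
  have -> : \sum_i du x i * mulv (d2u x) (disp x) i = \sum_i hess_grad x i * disp x i.
    rewrite /hess_grad /mulv; under eq_bigr do rewrite mulr_sumr.
    rewrite exchange_big; apply: eq_bigr => k _; rewrite mulr_suml.
    by apply: eq_bigr => i _; rewrite (d2u_sym x i k); ring.
  by rewrite -mulr_natl; ring.
have b2 := spacelike_factor_sqr x.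
have w2 : v x `^ (g - 2) = v x `^ g * (v x) ^- 2.
  by rewrite pw powR_invn// ltW// spacelike_factor_gt0.
have w1 : v x `^ (g + 1) = v x `^ g * v x by rewrite pw powRr1// ltW// spacelike_factor_gt0.
have w12 : v x `^ (g + 1 - 2) = v x `^ g * (v x)^-1.
  by rewrite (_ : g + 1 - 2 = g + -1) ?pw ?powR_inv1// ?(ltW (spacelike_factor_gt0 x))//; ring.
rewrite w1 w12 w2.
have tc := Hdiv x; rewrite sum_dflux in tc.
have XE i : X i x = v x * disp x i + (v x)^-1 * support_fun x * du x i.
  by rewrite /X powRr1 ?(ltW (spacelike_factor_gt0 x))// /flux powR_inv1 ?(ltW (spacelike_factor_gt0 x))//; ring.
rewrite -/(X _ x); under eq_bigr => i _ do rewrite -/(dX i i x) -/(X i x) XE flux_driftE.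
move: (v x `^ g) => h.
have yb : \sum_i disp x i * du x i = support_fun x + height x by rewrite /support_fun subrK.
have yy : \sum_i disp x i * disp x i = lorentz_sq x + height x ^+ 2 by rewrite /lorentz_sq subrK.
have bb : \sum_i du x i * du x i = 1 - v x ^+ 2 by rewrite b2 /sdot; ring.
have bbe : \sum_i du x i * hess_grad x i = sdot (du x) (hess_grad x) by [].
have bee : \sum_i hess_grad x i * hess_grad x i = sdot (hess_grad x) (hess_grad x) by [].
rewrite /sigma /tilt2 /tau.
move: (sdot (du x) (hess_grad x)) bbe => be bbe; move: (sdot (hess_grad x) (hess_grad x)) bee => ee bee.
move: (eta (lorentz_sq x)) (deta (lorentz_sq x)) (E (lorentz_sq x)) => et de EE.
move: (support_fun x) yb trX XE => sp yb trX _; move: (height x) yb yy => H yb yy.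
move: (lorentz_sq x) yy => l yy; move: (shape2 x) tc => sh tc.
move: (v x) w0 bb trX {b2 w1 w12 w2 pw} => w w0 bb trX; move: (rho x) trX tc => r trX tc.
(* Terms grouped by scalar products. The coefficient of y . (D^2u Du) is zero, which is what E' = -
   eta/2 is for; the eta part of the Du . (D^2u Du) terms cancels once y . Du and |Du|^2 are
   expressed through the support function, the height and v. *)
transitivity ((- g * h / w ^+ 2 * et * w + g * et * h * w / w ^+ 2) * (\sum_i disp x i * hess_grad x i)
  + (- g * h / w ^+ 2 * et * sp / w - g * et * H * h * w / w ^+ 2 + g * EE * (g + 1) * h / w * (be / w ^+ 4 + r / w)) * (\sum_i du x i * hess_grad x i)
  + (h * de * 2 * w) * (\sum_i disp x i * disp x i)
  + (h * de * 2 * (sp / w - H * w) + g * et * h * w * (be / w ^+ 4 + r / w)) * (\sum_i disp x i * du x i)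
  + (- h * de * 2 * H * sp / w - g * et * H * h * w * (be / w ^+ 4 + r / w)) * (\sum_i du x i * du x i)
  + (g * EE * (g + 1) * h / w / w ^+ 2) * (\sum_i hess_grad x i * hess_grad x i)
  + h * et * (\sum_i dX i i x) - g * EE * h * w * (\sum_i dcurv i i x)).
  rewrite !mulr_sumr -!big_split -sumrB /=; apply: eq_bigr => i _.
  move: (disp x i) (du x i) (hess_grad x i) (dX i i x) (dcurv i i x) => y b bt dx dc.
  by field.
rewrite yb yy bb bbe bee trX tc.
by field.
Qed.

End divergence_identity.
End lorentz_calculus.

(** * Radial weights *)

Lemma Rintegral_FTC2 {R : realType} (f F : R -> R) (a b : R) : a < b ->
  (forall x, a <= x -> x <= b -> is_derive x 1 F (f x)) ->
  (forall x, a <= x -> x <= b -> {for x, continuous f}) ->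
  \int[lebesgue_measure]_(x in `[a, b]) f x = F b - F a.
Proof.
move=> ab dF cf.
have cF x : a <= x -> x <= b -> {for x, continuous F}.
  move=> ax xb; apply: differentiable_continuous; apply/derivable1_diffP.
  by have [] := dF _ ax xb.
rewrite /Rintegral (continuous_FTC2 ab (F := F)) //.
- apply: continuous_in_subspaceT => x; rewrite inE /= in_itv /= => /andP[ax xb].
  exact: cf.
- split.
  + by move=> x; rewrite in_itv /= => /andP[/ltW ax /ltW xb]; have [] := dF _ ax xb.
  + by apply: cvg_at_right_filter; apply: cF => //; exact: ltW.
  + by apply: cvg_at_left_filter; apply: cF => //; exact: ltW.
- move=> x; rewrite in_itv /= => /andP[/ltW ax /ltW xb].
  by rewrite derive1E; have [] := dF _ ax xb.
Qed.

Lemma is_derive_invX {R : realType} (m : nat) (x : R) : 0 < x ->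
  is_derive x 1 (fun s => - (s ^- m.+1) / m.+1%:R) (x ^- m.+2).
Proof.
move=> x0; have xn0 : x != 0 by rewrite lt0r_neq0.
have D : is_derive x 1 (fun s : R => s ^+ m.+1) (m.+1%:R * x ^+ m).
  apply: DeriveDef; first exact: exprn_derivable.
  by rewrite exp_derive /GRing.scale /= mulr1.
have xm0 : x ^+ m.+1 != 0 by rewrite expf_neq0.
have V := is_deriveV (f := fun s : R => s ^+ m.+1) xm0 D.
have E : is_derive x 1 (fun s : R => - (s ^- m.+1) / m.+1%:R) _ :=
  is_deriveM (is_deriveN V) (is_derive_cst (m.+1%:R^-1 : R) x 1).
apply: (is_derive_eq E); rewrite scaler0 add0r /GRing.scale /=.
by rewrite !exprS; field; rewrite ?expf_neq0 ?xn0 ?nat1r ?natr1 ?pnatr_eq0.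
Qed.

Lemma continuous_invX {R : realType} (m : nat) (x : R) : 0 < x ->
  {for x, continuous (fun s : R => s ^- m)}.
Proof.
move=> x0; apply: differentiable_continuous; apply/derivable1_diffP.
by apply: derivableV; [rewrite expf_neq0// lt0r_neq0|exact: exprn_derivable].
Qed.

Lemma continuousM_for {R : realType} (f g : R -> R) (x : R) :
  {for x, continuous f} -> {for x, continuous g} -> {for x, continuous (fun t => f t * g t)}.
Proof. by move=> cf cg; apply: cvgM. Qed.

Lemma integrableZl_EFin d (T : measurableType d) (R : realType)
    (m : {measure set T -> \bar R}) (D : set T) (f : T -> R) (c : R) :
  measurable D -> m.-integrable D (EFin \o f) -> m.-integrable D (EFin \o (fun x => c * f x)).
Proof. by move=> mD /(integrableZl mD c); apply: eq_integrable. Qed.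

Lemma integrableB_EFin d (T : measurableType d) (R : realType)
    (m : {measure set T -> \bar R}) (D : set T) (f g : T -> R) :
  measurable D -> m.-integrable D (EFin \o f) -> m.-integrable D (EFin \o g) ->
  m.-integrable D (EFin \o (fun x => f x - g x)).
Proof. by move=> mD If Ig; have := integrableB mD If Ig; apply: eq_integrable. Qed.

Lemma integrableD_EFin d (T : measurableType d) (R : realType)
    (m : {measure set T -> \bar R}) (D : set T) (f g : T -> R) :
  measurable D -> m.-integrable D (EFin \o f) -> m.-integrable D (EFin \o g) ->
  m.-integrable D (EFin \o (fun x => f x + g x)).
Proof. by move=> mD If Ig; have := integrableD mD If Ig; apply: eq_integrable. Qed.

Lemma Rintegral_invX {R : realType} (m : nat) (a b : R) : 0 < a -> a < b ->
  \int[lebesgue_measure]_(s in `[a, b]) (s ^- m.+2) = (a ^- m.+1 - b ^- m.+1) / m.+1%:R.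
Proof.
move=> a0 ab.
transitivity (- (b ^- m.+1) / m.+1%:R - (- (a ^- m.+1) / m.+1%:R)); last first.
  by rewrite !mulNr opprK addrC mulrBl.
apply: (@Rintegral_FTC2 _ _ (fun s => - (s ^- m.+1) / m.+1%:R)) => // x ax _.
  by apply: is_derive_invX; exact: lt_le_trans ax.
by apply: continuous_invX; exact: lt_le_trans ax.
Qed.

Lemma ge0_subset_Rintegral d (T : measurableType d) (R : realType)
    (mu : {measure set T -> \bar R}) (A B : set T) (f : T -> R) :
  measurable A -> measurable B -> A `<=` B -> mu.-integrable B (EFin \o f) ->
  (forall x, B x -> 0 <= f x) ->
  \int[mu]_(x in A) f x <= \int[mu]_(x in B) f x.
Proof.
move=> mA mB AB fi f0; have fA := integrableS mB mA AB fi.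
rewrite /Rintegral fine_le//; [exact: integrable_fin_num|exact: integrable_fin_num|].
by apply: ge0_subset_integral => //; exact: measurable_int fi.
Qed.

Section weights.
Context {R : realType}.
Local Notation mu := (@lebesgue_measure R).
Variables (kap : R -> R) (e e' R1 r : R).
Hypothesis e0 : 0 < e.
Hypothesis ee' : e < e'.
Hypothesis er : e' < R1.
Hypothesis R1r : R1 < r.
Hypothesis kapc : continuous kap.
Hypothesis kap0 : forall s, 0 <= kap s.
Hypothesis kap1 : forall s, kap s <= 1.
Hypothesis kape : forall s, s <= e -> kap s = 0.
Hypothesis kapr : forall s, r <= s -> kap s = 0.
Hypothesis kap_one : forall s, e' <= s -> s <= R1 -> kap s = 1.
Hypothesis kap_decr : forall s t, e' <= s -> s <= t -> kap t <= kap s.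

Definition cutpow (m : nat) (s : R) : R := kap s * s ^- m.
(* Weights are functions of the squared Lorentz distance l, hence the square root. *)
Definition weight (m : nat) (l : R) : R := \int[mu]_(s in `]Num.sqrt l, r]) cutpow m s.

Lemma cutpow_ge0 m s : 0 <= s -> 0 <= cutpow m s.
Proof. by move=> s0; rewrite mulr_ge0// invr_ge0 exprn_ge0. Qed.

Lemma cutpow_cont m : continuous (cutpow m).
Proof.
move=> s; have [s0|s0] := leP s 0.
  have E0 : cutpow m s = 0 by rewrite /cutpow kape ?mul0r// (le_trans s0)// ltW.
  rewrite /continuous_at E0; apply: cvg_near_cst.
  near=> t; rewrite /cutpow kape ?mul0r//; apply/ltW; near: t.
  exact: (cvgr_lt _ cvg_id _ (le_lt_trans s0 e0)).
exact: (@continuousM_for R kap (fun t => t ^- m) s (@kapc s) (@continuous_invX R m s s0)).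
Unshelve. all: by end_near. Qed.

Lemma cutpow_int m a b : mu.-integrable `[a, b] (EFin \o cutpow m).
Proof.
apply: continuous_compact_integrable; first exact: segment_compact.
by apply: continuous_subspaceT; exact: cutpow_cont.
Qed.

Lemma cutpow_intS m (A : set (measurableTypeR R)) a b : measurable A -> A `<=` `[a, b] -> mu.-integrable A (EFin \o cutpow m).
Proof. by move=> mA Aab; apply: (integrableS _ mA Aab); [|exact: cutpow_int]. Qed.

Definition cutpow_prim (m : nat) (t : R) : R := \int[mu]_(s in `[0, t]) cutpow m s.

Let r0 : 0 < r.
Proof. by apply: (lt_trans e0); apply: (lt_trans ee'); apply: (lt_trans er). Qed.

Lemma weightE m l : weight m l = cutpow_prim m r - cutpow_prim m (Num.sqrt l).
Proof.
have L0 := sqrtr_ge0 l; rewrite /weight /cutpow_prim.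
have [Lr|rL] := leP (Num.sqrt l) r.
  by rewrite Rintegral_itvB// ?bnd_simp//; exact: cutpow_int.
rewrite set_itv_ge ?bnd_simp -?leNgt ?ltW// Rintegral_set0.
have := @Rintegral_itvB R (cutpow m) (BLeft 0) (BRight (Num.sqrt l)) r (cutpow_int m 0 _).
rewrite !bnd_simp => /(_ (ltW r0) (ltW rL)) E.
apply/esym/eqP; rewrite subr_eq0 eq_sym -subr_eq0 E; apply/eqP.
under eq_Rintegral => s do [rewrite inE /= in_itv /= => /andP[/ltW rs _]; rewrite /cutpow kapr// mul0r].
by rewrite Rintegral_cst// mul0r.
Qed.

Lemma cutpow_prim_small m t : t <= e -> cutpow_prim m t = 0.
Proof.
move=> te; rewrite /cutpow_prim.
under eq_Rintegral => s do [rewrite inE /= in_itv /= => /andP[_ st]; rewrite /cutpow kape ?(le_trans st)// mul0r].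
by rewrite Rintegral_cst// mul0r.
Qed.

Lemma is_derive_cutpow_prim m (t : R) : 0 < t -> is_derive t 1 (cutpow_prim m) (cutpow m t).
Proof.
move=> t0; have t1 : t < t + 1 by rewrite ltrDl.
have [d1 d2] := continuous_FTC1_closed t1 (cutpow_int m 0 _) t0 (@cutpow_cont m t).
by split; [exact: d1|rewrite -derive1E d2].
Qed.

Lemma is_derive_sqrt_pos (l : R) : 0 < l -> is_derive l 1 Num.sqrt (2 * Num.sqrt l)^-1.
Proof. exact: is_derive1_sqrt. Qed.

(** For l > e^2/2 this is the fundamental theorem composed with the square root, whose derivative
    supplies one more inverse power. For l <= e^2/2 < e^2 the weight is locally constant, so the
    formula also holds at l <= 0, where the square root is not smooth. *)
Lemma is_derive_weight m (l : R) :
  is_derive l 1 (weight m) (- (cutpow m.+1 (Num.sqrt l) / 2)).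
Proof.
have [l0|l0] := ltP (e ^+ 2 / 2) l.
  have lp : 0 < l by apply: lt_trans l0; rewrite divr_gt0// exprn_gt0.
  have L0 : 0 < Num.sqrt l by rewrite sqrtr_gt0.
  rewrite (_ : weight m = (fun l => cutpow_prim m r - (cutpow_prim m \o Num.sqrt) l)); last first.
    by apply/funext => x; rewrite weightE.
  apply: is_derive_eq.
    apply: is_deriveB; apply: is_derive1_comp; first exact: is_derive_cutpow_prim.
    exact: is_derive_sqrt_pos.
  rewrite sub0r /cutpow exprS invfM; congr (- _).
  by rewrite invfM; field; rewrite expf_neq0//= lt0r_neq0.
have Ls x : x < e ^+ 2 -> Num.sqrt x <= e.
  move=> xe; rewrite -(ger0_norm (ltW e0)) -sqrtr_sqr ler_wsqrtr// ltW//.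
have le2 : l < e ^+ 2.
  by apply: le_lt_trans l0 _; rewrite ltr_pdivrMr// ltr_pMr ?exprn_gt0// ltr1n.
rewrite (_ : - _ = 0); last by rewrite /cutpow kape ?Ls// mul0r mul0r oppr0.
have H : \forall x \near l, (cst (cutpow_prim m r) : R -> R) x = weight m x.
  near=> x; rewrite weightE [X in _ - X]cutpow_prim_small ?subr0//; apply: Ls.
  near: x; exact: (cvgr_lt _ cvg_id _ le2).
apply: (near_eq_is_derive H); exact: is_derive_cst.
Unshelve. all: by end_near. Qed.

Lemma cont_dweight m : continuous ((fun l => - (cutpow m (Num.sqrt l) / 2)) : R -> R).
Proof.
have H : continuous (fun l : R => cutpow m (Num.sqrt l)).
  by move=> l; apply: continuous_comp; [exact: sqrt_continuous|exact: cutpow_cont].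
move=> l; apply: cvgN.
have Hc : {for l, continuous (cst (2^-1) : R -> R)} by exact: cst_continuous.
exact: (@continuousM_for R (fun l => cutpow m (Num.sqrt l)) (cst 2^-1) l (H l) Hc).
Qed.

Lemma weight_ge0 m l : 0 <= weight m l.
Proof.
apply: Rintegral_ge0 => s; rewrite /= in_itv /= => /andP[Ls _].
by apply: cutpow_ge0; apply: le_trans (ltW Ls); exact: sqrtr_ge0.
Qed.

Lemma le_weight m n c l : (forall s, Num.sqrt l < s -> s <= r -> c * cutpow m s <= cutpow n s) ->
  c * weight m l <= weight n l.
Proof.
move=> H; rewrite /weight.
have sub : `]Num.sqrt l, r]%classic `<=` `[Num.sqrt l, r]%classic by exact: subset_itv_oc_cc.
have I k : mu.-integrable `]Num.sqrt l, r] (EFin \o cutpow k) by exact: (cutpow_intS _ (measurable_itv _) sub).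
rewrite -RintegralZl//; apply: le_Rintegral => //.
  by apply: integrableZl_EFin.
by move=> s; rewrite /= in_itv /= => /andP[]; exact: H.
Qed.

Lemma sqrt_weight_le m l : Num.sqrt l * weight m.+1 l <= weight m l.
Proof.
apply: le_weight => s Ls _; rewrite /cutpow mulrCA; apply: ler_wpM2l => //.
have L0 := sqrtr_ge0 l; have s0 := le_lt_trans L0 Ls.
by rewrite exprS invfM mulrA ler_piMl ?invr_ge0 ?exprn_ge0 ?(ltW s0)// ler_pdivrMr// mul1r ltW.
Qed.

Lemma sq_weight_le m l : 0 <= l -> l * weight m.+2 l <= weight m l.
Proof.
move=> l0; rewrite -{1}(sqr_sqrtr l0) expr2 -mulrA.
apply: le_trans (sqrt_weight_le _ _).
by apply: ler_wpM2l; [exact: sqrtr_ge0|exact: sqrt_weight_le].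
Qed.

Let int_invX m a : 0 < a -> mu.-integrable `[a, r] (EFin \o (fun s : R => s ^- m)).
Proof.
move=> a0; apply: continuous_compact_integrable; first exact: segment_compact.
apply: continuous_in_subspaceT => x; rewrite inE /= in_itv /= => /andP[ax _].
by apply: continuous_invX; exact: lt_le_trans ax.
Qed.

(** Past [e'] the cutoff only decreases, so its value at the lower end of the integral can be pulled
    out and the remaining power integrated exactly. The second alternative covers sqrt l >= r, where
    the domain of integration is empty. *)
Lemma weight_le_decr m l : e' <= Num.sqrt l ->
  m.+1%:R * weight m.+2 l <= kap (Num.sqrt l) * (Num.sqrt l) ^- m.+1
                             - kap (Num.sqrt l) * r ^- m.+1 \/ weight m.+2 l = 0.
Proof.
move=> eL; have L0 : 0 < Num.sqrt l by apply: lt_le_trans eL; exact: lt_trans ee'.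
have [Lr|rL] := ltP (Num.sqrt l) r; last first.
  by right; rewrite /weight set_itv_ge ?bnd_simp -?leNgt// Rintegral_set0.
left; rewrite -mulrBr -ler_pdivlMl// mulrCA.
rewrite [_^-1 * _]mulrC -Rintegral_invX// -RintegralZl//; last exact: int_invX.
rewrite /weight Rintegral_itv_obnd_cbnd; last first.
  by apply: (cutpow_intS _ (measurable_itv _)); exact: subset_itv_oc_cc.
apply: le_Rintegral => //; first exact: cutpow_int.
  by apply: integrableZl_EFin => //; exact: int_invX.
move=> s; rewrite /= in_itv /= => /andP[Ls _]; rewrite /cutpow ler_wpM2r//.
  by rewrite invr_ge0 exprn_ge0// (le_trans _ Ls)// ltW.
exact: kap_decr.
Qed.

Lemma weight_le_kap m l : e' <= Num.sqrt l ->
  m.+1%:R * weight m.+2 l <= kap (Num.sqrt l) * (Num.sqrt l) ^- m.+1.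
Proof.
move=> eL; have L0 : 0 < Num.sqrt l by apply: lt_le_trans eL; exact: lt_trans ee'.
have rm : 0 <= r ^- m.+1 by rewrite invr_ge0 exprn_ge0// ltW.
have Lm : 0 <= (Num.sqrt l) ^- m.+1 by rewrite invr_ge0 exprn_ge0// ltW.
have [h|->] := weight_le_decr m eL; last by rewrite mulr0 mulr_ge0.
by apply: (le_trans h); rewrite gerBl mulr_ge0.
Qed.

Lemma weight_le_e m l : m.+1%:R * weight m.+2 l <= e ^- m.+1 - r ^- m.+1.
Proof.
have e_r : e < r by apply: (lt_trans ee'); apply: (lt_trans er).
rewrite -ler_pdivlMl// [_^-1 * _]mulrC -Rintegral_invX//.
apply: (@le_trans _ _ (cutpow_prim m.+2 r)).
  rewrite weightE gerBl; apply: Rintegral_ge0 => s; rewrite /= in_itv /= => /andP[s0 _].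
  exact: cutpow_ge0.
have := @Rintegral_itvB R (cutpow m.+2) (BLeft 0) (BRight r) e (cutpow_int m.+2 0 _).
rewrite !bnd_simp => /(_ (ltW e0) (ltW e_r)); rewrite -/(cutpow_prim m.+2 r) -/(cutpow_prim m.+2 e) (cutpow_prim_small _ (lexx e)) subr0 => ->.
rewrite Rintegral_itv_obnd_cbnd; last first.
  by apply: (cutpow_intS _ (measurable_itv _)); exact: subset_itv_oc_cc.
apply: le_Rintegral => //; [exact: cutpow_int|exact: int_invX|].
move=> s; rewrite /= in_itv /= => /andP[es _]; rewrite /cutpow ler_piMl//.
by rewrite invr_ge0 exprn_ge0// (le_trans _ es)// ltW.
Qed.

(** With N = m.+1 and eta = [weight m.+2], the right-hand side is - (N eta + 2 eta' ell). For a
    sharp cutoff at e and r it would equal r^(-N) on K_r minus e^(-N) on K_e; the two transition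
    layers replace r by [R1] and e by [e'] in the balls. *)
Lemma weight_mass m (l : R) :
  r ^- m.+1 * (Num.sqrt l < R1)%R%:R - e ^- m.+1 * (Num.sqrt l < e')%R%:R <=
  cutpow m.+1 (Num.sqrt l) - m.+1%:R * weight m.+2 l.
Proof.
have rm : 0 <= r ^- m.+1 by rewrite invr_ge0 exprn_ge0// ltW.
have [Le|eL] := ltP (Num.sqrt l) e'.
  rewrite (lt_trans Le er) !mulr1 /=.
  have := weight_le_e m l; have := cutpow_ge0 m.+1 (sqrtr_ge0 l); lra.
rewrite mulr0 subr0.
have [LR|RL] := ltP (Num.sqrt l) R1.
  rewrite mulr1; have [h|->] := weight_le_decr m eL.
    by rewrite -subr_ge0 /cutpow; move: h; rewrite (kap_one eL (ltW LR)); lra.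
  rewrite mulr0 subr0 /cutpow (kap_one eL (ltW LR)) mul1r.
  rewrite lef_pV2 ?posrE ?exprn_gt0//; last by apply: lt_le_trans eL; exact: lt_trans ee'.
  by apply: lerXn2r; rewrite ?nnegrE ?sqrtr_ge0 ?ltW// (lt_trans LR).
rewrite mulr0; have := weight_le_kap m eL; rewrite /cutpow; lra.
Qed.

(* The primitive of [- weight m.+2 / 2] that vanishes for [r <= sqrt l]. *)
Definition energy (m : nat) (l : R) : R := (weight m l - l * weight m.+2 l) / 2.

Lemma is_derive_energy m (l : R) : is_derive l 1 (energy m) (- (weight m.+2 l / 2)).
Proof.
have D : is_derive l 1 (energy m) _ := is_deriveM (is_deriveB (is_derive_weight m l)
  (is_deriveM (is_derive_id l 1) (is_derive_weight m.+2 l))) (is_derive_cst (2^-1 : R) l 1).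
apply: (is_derive_eq D); rewrite scaler0 add0r /GRing.scale /=.
rewrite mulrN mulrA (_ : l * cutpow m.+3 (Num.sqrt l) = cutpow m.+1 (Num.sqrt l)).
  by field.
have [l0|l0] := leP l 0.
  by rewrite /cutpow ler0_sqrtr// kape ?(ltW e0)// !mul0r mulr0.
have L0 : 0 < Num.sqrt l by rewrite sqrtr_gt0.
rewrite -{1}(sqr_sqrtr (ltW l0)) /cutpow !exprS; field.
by rewrite expf_neq0 ?lt0r_neq0.
Qed.

Lemma energy_ge0 m l : 0 <= energy m l.
Proof.
rewrite /energy divr_ge0// subr_ge0; have [l0|l0] := leP 0 l; first exact: sq_weight_le.
by apply: le_trans (weight_ge0 m l); rewrite mulr_le0_ge0 ?weight_ge0 ?ltW.
Qed.

Lemma energy_le m l : 0 <= l -> energy m l <= weight m l / 2.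
Proof.
by move=> l0; rewrite /energy ler_wpM2r// gerBl mulr_ge0// weight_ge0.
Qed.

(** The energy is the integral of [cutpow m.+2 s] times (s^2 - l)/2 over s > sqrt l. It is
    restricted to 3r/4 <= s <= 7r/8, where the cutoff is 1. There s^2 - l >= (9/16 - 1/4) r^2, and
    the interval has length r/8, whence 5/32 times 1/8. *)
Lemma energy_ge m l : 0 <= l -> Num.sqrt l <= r / 2 -> e' <= 3 / 4 * r -> 7 / 8 * r <= R1 ->
  5 / 256 * r ^+ 3 * r ^- m.+2 <= energy m l.
Proof.
move=> l0 Lr er' Rr; set L := Num.sqrt l in Lr *.
have L0 : 0 <= L by exact: sqrtr_ge0.
have I k : mu.-integrable `]L, r] (EFin \o cutpow k).
  by apply: (cutpow_intS _ (measurable_itv _)); exact: subset_itv_oc_cc.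
have -> : energy m l = \int[mu]_(s in `]L, r]) (cutpow m.+2 s * ((s ^+ 2 - l) / 2)).
  rewrite /energy /weight -/L -RintegralZl// -RintegralB//; last by apply: integrableZl_EFin.
  rewrite mulrC -RintegralZl//; last first.
    by apply: integrableB_EFin => //; exact: integrableZl_EFin.
  apply: eq_Rintegral => s; rewrite inE /= in_itv /= => /andP[Ls _].
  have s0 : 0 < s by exact: le_lt_trans Ls.
  by rewrite /cutpow !exprS; field; rewrite expf_neq0 lt0r_neq0.
pose f s := cutpow m.+2 s * ((s ^+ 2 - l) / 2).
have cf : continuous f.
  move=> s; apply: (@continuousM_for R (cutpow m.+2) (fun s => (s ^+ 2 - l) / 2) s (@cutpow_cont _ s)).
  have Hc : {for s, continuous (cst (2^-1) : R -> R)} by exact: cst_continuous.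
  apply: (@continuousM_for R (fun s => s ^+ 2 - l) (cst 2^-1) s _ Hc).
  by apply: cvgB; [exact: exprn_continuous|exact: cvg_cst].
have If a b : mu.-integrable `[a, b] (EFin \o f).
  apply: continuous_compact_integrable; first exact: segment_compact.
  by apply: continuous_subspaceT.
have Lr' : L < r by move: Lr r0; lra.
rewrite -/f Rintegral_itv_obnd_cbnd; last first.
  by apply: (integrableS _ _ _ (If L r)) => //; exact: subset_itv_oc_cc.
set J := `[3 / 4 * r, 7 / 8 * r]%classic : set (measurableTypeR R).
have JS : J `<=` `[L, r]%classic.
  by move=> s; rewrite /J /= !in_itv /= => /andP[a b]; move: Lr r0 a b; lra.
have f0 s : L <= s -> 0 <= f s.
  move=> Ls; have s0 : 0 <= s by exact: le_trans Ls.
  rewrite mulr_ge0 ?cutpow_ge0// divr_ge0// subr_ge0 -(sqr_sqrtr l0) -/L.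
  by apply: lerXn2r; rewrite ?nnegrE.
apply: (@le_trans _ _ (\int[mu]_(s in J) f s)); last first.
  apply: ge0_subset_Rintegral => //; first exact: measurable_itv.
  by move=> s; rewrite /= in_itv /= => /andP[? _]; exact: f0.
have -> : 5 / 256 * r ^+ 3 * r ^- m.+2 = \int[mu]_(s in J) (5 / 32 * r ^+ 2 * r ^- m.+2).
  rewrite Rintegral_cst; last exact: measurable_itv.
  have := @lebesgue_measure_itv R `[3 / 4 * r, 7 / 8 * r].
  rewrite -/J /= lte_fin ifT; last by lra.
  by move=> ->; rewrite -EFinB /=; field; rewrite lt0r_neq0// exprn_gt0.
apply: le_Rintegral.
- exact: measurable_itv.
- apply: continuous_compact_integrable; first exact: segment_compact.
  by apply: continuous_subspaceT => s; exact: cvg_cst.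
- exact: If.
move=> s; rewrite /J /= in_itv /= => /andP[a b].
have s0 : 0 < s by lra.
rewrite /f /cutpow kap_one; [|lra|lra].
rewrite mul1r mulrC; apply: ler_pM.
- by rewrite invr_ge0 exprn_ge0// ltW.
- by rewrite mulr_ge0// exprn_ge0// ltW.
- by rewrite lef_pV2 ?posrE ?exprn_gt0//; apply: lerXn2r; rewrite ?nnegrE ?ltW//; lra.
have : l <= (r / 2) ^+ 2.
  rewrite -(sqr_sqrtr l0) -/L; apply: lerXn2r; rewrite ?nnegrE//; lra.
by have : (3 / 4 * r) ^+ 2 <= s ^+ 2; [apply: lerXn2r; rewrite ?nnegrE; lra|lra].
Qed.

End weights.

(** * Geometry of Lorentz balls *)

Definition ramp {R : realType} (a b s : R) : R := Num.min 1 (Num.max 0 ((s - a) / (b - a))).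

Section ramp.
Context {R : realType}.
Variables (a b : R).
Hypothesis ab : a < b.

Lemma ramp_ge0 s : 0 <= ramp a b s.
Proof. by rewrite /ramp le_min ler01 le_max lexx. Qed.

Lemma ramp_le1 s : ramp a b s <= 1.
Proof. by rewrite /ramp ge_min lexx. Qed.

Lemma ramp_eq0 s : s <= a -> ramp a b s = 0.
Proof.
move=> sa; rewrite /ramp max_l ?min_r//.
by rewrite ler_pdivrMr ?mul0r ?subr_le0// subr_gt0.
Qed.

Lemma ramp_eq1 s : b <= s -> ramp a b s = 1.
Proof.
move=> bs; rewrite /ramp min_l// le_max; apply/orP; right.
by rewrite ler_pdivlMr ?mul1r ?lerB// subr_gt0.
Qed.

Lemma le_ramp s t : s <= t -> ramp a b s <= ramp a b t.
Proof.
move=> st; have h : (s - a) / (b - a) <= (t - a) / (b - a).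
  by rewrite ler_wpM2r ?lerB// invr_ge0 subr_ge0 ltW.
by rewrite /ramp le_min ge_min lexx /= ge_min ge_max !le_max lexx h !orbT.
Qed.

Lemma continuous_ramp : continuous (ramp a b).
Proof.
move=> s; apply: (@continuous_min R R (cst 1) (fun s => Num.max 0 ((s - a) / (b - a)))).
  exact: cst_continuous.
apply: (@continuous_max R R (cst 0) (fun s => (s - a) / (b - a))).
  exact: cst_continuous.
by apply: cvgM; [apply: cvgB; [exact: cvg_id|exact: cvg_cst]|exact: cvg_cst].
Qed.

End ramp.

Lemma cutoff_ex {R : realType} (e e' R1 r : R) : e < e' -> e' < R1 -> R1 < r ->
  exists kap : R -> R,
  [/\ continuous kap, forall s, 0 <= kap s <= 1,
      forall s, s <= e -> kap s = 0, forall s, r <= s -> kap s = 0 &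
      (forall s, e' <= s -> s <= R1 -> kap s = 1) /\
      (forall s t, e' <= s -> s <= t -> kap t <= kap s)].
Proof.
move=> ee' er Rr; exists (fun s => ramp e e' s * (1 - ramp R1 r s)); split.
- move=> s; apply: (@continuousM_for R (ramp e e') (fun s => 1 - ramp R1 r s)).
    exact: continuous_ramp.
  by apply: cvgB; [exact: cvg_cst|exact: continuous_ramp].
- move=> s; rewrite mulr_ge0 ?ramp_ge0 ?subr_ge0 ?ramp_le1//=.
  by rewrite mulr_ile1 ?ramp_ge0 ?subr_ge0 ?ramp_le1// gerBl ramp_ge0.
- by move=> s se; rewrite ramp_eq0// mul0r.
- by move=> s rs; rewrite (ramp_eq1 Rr rs) subrr mulr0.
split=> [s es sR|s t es st]; first by rewrite ramp_eq1// ramp_eq0// subr0 mulr1.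
rewrite !(ramp_eq1 ee')// ?(le_trans es)// !mul1r lerB//; exact: le_ramp.
Qed.

Section lorentz_geometry.
Context {R : realType} {N : nat}.
Variables (u : 'rV[R]_N -> R) (x0 : 'rV[R]_N).
Hypothesis C3u : Ck 3 u.
Hypothesis u_spacelike : forall x, enorm (grad u x) < 1.
Local Notation v := (spacelike_factor u).
Local Notation ell := (lorentz_sq u x0).

Lemma enorm_disp x : enorm (x - x0) ^+ 2 = sdot (disp x0 x) (disp x0 x).
Proof.
rewrite /enorm sqr_sqrtr; last first.
  by apply: sumr_ge0 => i _; apply: sumr_ge0 => j _; exact: sqr_ge0.
rewrite (bigD1 ord0)//= [X in _ + X]big1 ?addr0; last by move=> i; rewrite (ord1 i) eqxx.
by apply: eq_bigr => j _; rewrite !mxE expr2.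
Qed.

Lemma lorentz_ballE s : lorentz_ball u x0 s = [set x | Num.sqrt (ell x) < s].
Proof. by apply/seteqP; split => x; rewrite /lorentz_ball /= enorm_disp. Qed.

Lemma sdot_disp_gt0 x : x != x0 -> 0 < sdot (disp x0 x) (disp x0 x).
Proof.
move=> xx0; rewrite lt0r sdot_ge0 andbT; apply: contra xx0 => /eqP/sdot_eq0 H.
apply/eqP/rowP => i; have := H i; rewrite /disp; lra.
Qed.

(** By the mean value theorem the height is y . Du(z) at a point z of the segment; Cauchy-Schwarz
    and |Du(z)| < 1 conclude. *)
Lemma lorentz_sq_gt0 x : x != x0 -> 0 < ell x.
Proof.
move=> xx0; have [t _] := has_grad_segment x0 (x - x0) (has_grad_u C3u).
rewrite [x0 + (x - x0)]addrC subrK => H.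
set z := x0 + _ in H.
have {}H : height u x0 x = sdot (disp x0 x) (du u z).
  by rewrite /height H; apply: eq_bigr => i _; rewrite !mxE.
rewrite /lorentz_sq H subr_gt0; apply: le_lt_trans (sdot_CS _ _) _.
rewrite -[ltRHS]mulr1 ltr_pM2l ?sdot_disp_gt0//.
by have := spacelike_factor_sqr u_spacelike z; have := exprn_gt0 2 (spacelike_factor_gt0 u_spacelike z); lra.
Qed.

Lemma lorentz_sq_center : ell x0 = 0.
Proof.
rewrite /lorentz_sq /height subrr expr0n /= subr0; apply: big1 => i _.
by rewrite /disp subrr mul0r.
Qed.

Lemma lorentz_sq_ge0 x : 0 <= ell x.
Proof.
have [->|xx0] := eqVneq x x0; first by rewrite lorentz_sq_center.
exact/ltW/lorentz_sq_gt0.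
Qed.

Lemma sigma_center : sigma u x0 x0 = 0.
Proof.
rewrite /sigma /support_fun /height subrr subr0 [sdot _ _]big1 ?mul0r// => i _.
by rewrite /disp subrr mul0r.
Qed.

(** The difference of the two sides is |y - w Du|^2. *)
Lemma sqr_sigma_height x : (sigma u x0 x + height u x0 x * v x) ^+ 2 <= ell x + sigma u x0 x ^+ 2.
Proof.
have v0 := spacelike_factor_gt0 u_spacelike x; have v2 := spacelike_factor_sqr u_spacelike x.
pose y := disp x0 x; pose b := du u x; pose w := height u x0 x.
rewrite -subr_ge0.
have -> : ell x + sigma u x0 x ^+ 2 - (sigma u x0 x + height u x0 x * v x) ^+ 2 =
    sdot (fun i => y i - w * b i) (fun i => y i - w * b i).
  have -> : sdot (fun i => y i - w * b i) (fun i => y i - w * b i) =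
      sdot y y - 2 * w * sdot y b + w ^+ 2 * sdot b b.
    rewrite /sdot !mulr_sumr -sumrB -big_split /=; apply: eq_bigr => i _; ring.
  have -> : sdot b b = 1 - v x ^+ 2 by rewrite v2 /b; ring.
  rewrite /sigma /support_fun /lorentz_sq -/y -/b -/w.
  by field; rewrite lt0r_neq0.
exact: sdot_ge0.
Qed.

Lemma sigma_height_le x :
  `|sigma u x0 x + height u x0 x * v x| <= Num.sqrt (ell x) + `|sigma u x0 x|.
Proof.
rewrite -(@ler_pXn2r _ 2) ?nnegrE ?addr_ge0 ?sqrtr_ge0// real_normK ?num_real//.
apply: le_trans (sqr_sigma_height x) _.
rewrite sqrrD sqr_sqrtr ?lorentz_sq_ge0// real_normK ?num_real//.
by rewrite lerD2r lerDl mulrn_wge0// mulr_ge0// sqrtr_ge0.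
Qed.

Lemma continuous_lorentz_sq : continuous ell.
Proof. by have [] := has_grad_lorentz_sq x0 C3u. Qed.

Lemma continuous_sqrt_lorentz : continuous (fun x => Num.sqrt (ell x)).
Proof.
move=> x; apply: (@continuous_comp _ _ _ ell Num.sqrt); first exact: continuous_lorentz_sq.
exact: sqrt_continuous.
Qed.

Lemma measurable_lorentz_ball s : measurable (lorentz_ball u x0 s).
Proof.
rewrite lorentz_ballE; apply: open_measurable_row.
apply: (@open_comp _ _ (fun x => Num.sqrt (ell x)) [set t | t < s]) => [x _|].
  exact: continuous_sqrt_lorentz.
exact: open_lt.
Qed.

Lemma subset_lorentz_ball s t : s <= t -> lorentz_ball u x0 s `<=` lorentz_ball u x0 t.
Proof. by move=> st x; rewrite !lorentz_ballE /= => h; exact: lt_le_trans st. Qed.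

Lemma continuous_sigma : continuous (sigma u x0).
Proof.
have [+ _] := has_gradM (has_grad_support x0 C3u) (has_grad_powR_spacelike C3u u_spacelike (-1)).
rewrite (_ : sigma u x0 = fun x => support_fun u x0 x * v x `^ (-1))//.
apply/funext => x; by rewrite /sigma powR_inv1 ?(ltW (spacelike_factor_gt0 u_spacelike x)).
Qed.

Lemma enorm_grad_spacelike_factor x : enorm (grad v x) ^+ 2 = (v x) ^- 2 * sdot (hess_grad u x) (hess_grad u x).
Proof.
rewrite /enorm sqr_sqrtr; last first.
  by apply: sumr_ge0 => i _; apply: sumr_ge0 => j _; exact: sqr_ge0.
rewrite (bigD1 ord0)//= [X in _ + X]big1 ?addr0; last by move=> i; rewrite (ord1 i) eqxx.
rewrite /sdot mulr_sumr; apply: eq_bigr => j _; rewrite mxE.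
have v1 : (fun x => v x `^ 1) = v.
  by apply/funext => y; rewrite powRr1// ltW// spacelike_factor_gt0.
have := partial_has_grad j (has_grad_powR_spacelike C3u u_spacelike 1).
rewrite v1 => ->; rewrite (_ : 1 - 2 = -1); last by ring.
rewrite powR_inv1 ?(ltW (spacelike_factor_gt0 u_spacelike x))//.
by field; rewrite lt0r_neq0// spacelike_factor_gt0.
Qed.

(** Passes from |A|^2 to the integrand of the theorem: v^2 |A|^2 contains |D^2u|^2 with coefficient
    one and |Dv|^2 = v^(-2) |D^2u Du|^2 with coefficient two. *)
Lemma enorm_hessian_grad_le g x :
  v x `^ (g - 1) * (enorm (hessian u x) ^+ 2 + enorm (grad v x) ^+ 2)
  <= v x `^ (g + 1) * shape2 u x.
Proof.
have v0 := spacelike_factor_gt0 u_spacelike x.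
rewrite enorm_grad_spacelike_factor (_ : enorm (hessian u x) ^+ 2 = \sum_i \sum_j d2u u x i j ^+ 2); last first.
  rewrite /enorm sqr_sqrtr; last first.
    by apply: sumr_ge0 => i _; apply: sumr_ge0 => j _; exact: sqr_ge0.
  by apply: eq_bigr => i _; apply: eq_bigr => j _; rewrite mxE.
have -> : v x `^ (g + 1) = v x `^ (g - 1) * v x ^+ 2.
  rewrite -(powR_mulrn 2 (ltW v0)) -powRD ?(lt0r_neq0 v0) ?implybT//.
  by congr (_ `^ _); ring.
rewrite -mulrA ler_wpM2l ?powR_ge0// /shape2.
have b0 := sdot_ge0 (hess_grad u x); move: (sdot (hess_grad u x) _) b0 => b b0.
move: (\sum_i _) (sdot (du u x) _) => D s.
have -> : v x ^+ 2 * (v x ^- 2 * D + 2 * v x ^- 4 * b + v x ^- 6 * s ^+ 2) =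
    D + v x ^- 2 * b + (v x ^- 2 * b + v x ^- 4 * s ^+ 2).
  by field; rewrite lt0r_neq0.
have vk k : 0 <= v x ^- k by rewrite invr_ge0 exprn_ge0// ltW.
have := mulr_ge0 (vk 2%N) b0; have := mulr_ge0 (vk 4%N) (sqr_ge0 s); lra.
Qed.

Lemma shape2_ge0 x : 0 <= shape2 u x.
Proof.
have v0 := spacelike_factor_gt0 u_spacelike x; rewrite /shape2 !addr_ge0// mulr_ge0 ?sdot_ge0 ?sqr_ge0//.
- by rewrite invr_ge0 exprn_ge0// ltW.
- by apply: sumr_ge0 => i _; apply: sumr_ge0 => j _; exact: sqr_ge0.
- by rewrite mulr_ge0// invr_ge0 exprn_ge0// ltW.
- by rewrite invr_ge0 exprn_ge0// ltW.
Qed.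

(* Compactness of the ball of radius r is what makes small balls shrink to the center. *)
Lemma lorentz_ball_shrink r (d : R) : 0 < r -> bounded_set (lorentz_ball u x0 r) -> 0 < d ->
  exists2 s0, 0 < s0 <= r & forall x, lorentz_ball u x0 s0 x -> `|x - x0| < d.
Proof.
move=> r0 /bounded_setP[M KM] d0.
pose C := [set x | `|x| <= M] `&` [set x | d <= `|x - x0|].
have [[z Cz]|C0] := pselect (C !=set0); last first.
  exists r; rewrite ?r0 ?lexx// => x Kx; rewrite ltNge; apply/negP => dx.
  by apply: C0; exists x; split => //; exact: KM.
have cn : continuous (fun x : 'rV[R]_N => `|x - x0|).
  have cs : continuous (fun x : 'rV[R]_N => x - x0).
    move=> x; apply: (@cvgB R 'rV[R]_N 'rV[R]_N (nbhs x) _ id (cst x0) x x0).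
      exact: cvg_id.
    exact: cvg_cst.
  by move=> x; exact: (continuous_comp (cs x) (@norm_continuous _ _ _)).
have cC : compact C.
  apply: bounded_closed_compact.
    by apply/bounded_setP; exists M => x [].
  apply: closedI.
    apply: (@closed_comp _ _ (fun x : 'rV[R]_N => `|x|) [set t | t <= M]); last exact: closed_le.
    by move=> x _; exact: norm_continuous.
  apply: (@closed_comp _ _ (fun x : 'rV[R]_N => `|x - x0|) [set t | d <= t]); last exact: closed_ge.
  by move=> x _; exact: cn.
have [c cC' cmin] := @EVT_min_rV R N (fun x => Num.sqrt (ell x)) C (ex_intro _ z Cz) cC
  (continuous_subspaceT continuous_sqrt_lorentz).
have c0 : 0 < Num.sqrt (ell c).
  rewrite sqrtr_gt0 lorentz_sq_gt0//; apply: contraTneq (d0) => cx.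
  by move: cC'; rewrite inE => -[_] /=; rewrite cx subrr normr0 -leNgt.
exists (Num.min r (Num.sqrt (ell c))); first by rewrite lt_min r0 c0 ge_min lexx.
move=> x; rewrite lorentz_ballE /= lt_min => /andP[xr xc].
rewrite ltNge; apply/negP => dx; move: xc; rewrite ltNge => /negP; apply.
by apply: cmin; rewrite inE; split => //; apply: KM; rewrite lorentz_ballE.
Qed.

End lorentz_geometry.

(** * The localized integral inequality *)

Lemma sqr_cutpow {R : realType} (kap : R -> R) (m : nat) (l : R) : 0 <= l ->
  (Num.sqrt l = 0 -> kap 0 = 0) -> l * cutpow kap m.+2 (Num.sqrt l) = cutpow kap m (Num.sqrt l).
Proof.
move=> l0 k0; have [s0|s0] := eqVneq (Num.sqrt l) 0.
  by rewrite /cutpow s0 k0// !mul0r mulr0.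
by rewrite -{1}(sqr_sqrtr l0) /cutpow !exprS; field; rewrite expf_neq0.
Qed.

(* AM-GM, after [x] and [K] have been bounded below by multiples of [a]. *)
Lemma weighted_young {R : realType} (n L a x K p s c : R) : 0 < n -> 0 < L -> 0 <= a ->
  L ^+ 2 * a <= x -> n * a <= K ->
  c * a * (p * s) <= K * L ^- 2 * s ^+ 2 + c ^+ 2 / (4 * n) * x * p ^+ 2.
Proof.
move=> n0 L0 a0 Lx nK.
have L2 : 0 <= L ^- 2 * s ^+ 2 by rewrite mulr_ge0 ?sqr_ge0// invr_ge0 exprn_ge0// ltW.
have cp : 0 <= c ^+ 2 / (4 * n) * p ^+ 2.
  by rewrite mulr_ge0 ?sqr_ge0// divr_ge0 ?sqr_ge0// mulr_ge0// ltW.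
have h1 : (n * a) * (L ^- 2 * s ^+ 2) <= K * (L ^- 2 * s ^+ 2) by rewrite ler_wpM2r.
have h2 : (L ^+ 2 * a) * (c ^+ 2 / (4 * n) * p ^+ 2) <= x * (c ^+ 2 / (4 * n) * p ^+ 2).
  by rewrite ler_wpM2r.
have h3 : 0 <= a * n * (s / L - c * L * p / (2 * n)) ^+ 2.
  by rewrite mulr_ge0 ?sqr_ge0// mulr_ge0// ltW.
have E : a * n * (s / L - c * L * p / (2 * n)) ^+ 2 =
    (n * a) * (L ^- 2 * s ^+ 2) + (L ^+ 2 * a) * (c ^+ 2 / (4 * n) * p ^+ 2) - c * a * (p * s).
  by field; rewrite !lt0r_neq0.
rewrite E in h3; move: h1 h2 h3; lra.
Qed.

Lemma continuous_sum {T : topologicalType} {R : realType} (I : Type) (s : seq I) (F : I -> T -> R) :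
  (forall i, continuous (F i)) -> continuous (fun x => \sum_(i <- s) F i x).
Proof.
move=> cF; elim: s => [|i s IH].
  rewrite (_ : (fun x => _) = cst 0); first exact: cst_continuous.
  by apply/funext => x; rewrite big_nil.
rewrite (_ : (fun x => _) = fun x => F i x + \sum_(i <- s) F i x).
  by move=> x; exact: (cvgD (cF i x) (IH x)).
by apply/funext => x; rewrite big_cons.
Qed.

Lemma integrable_bounded_row {R : realType} (n : nat) (A : set 'rV[R]_n) (f : 'rV[R]_n -> R) :
  measurable A -> bounded_set A -> continuous f ->
  (lebesgue_row R n).-integrable A (EFin \o f).
Proof.
move=> mA bA cf; have [C HC] := continuous_bounded_row bA cf.
have [M HM] := (bounded_setP A).1 bA.
apply: measurable_bounded_integrable => //.
- exact: bounded_lebesgue_row HM.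
- by apply: measurable_funTS; exact: continuous_measurable_row.
- by exists C; split; rewrite ?num_real // => y Cy x Ax /=; rewrite (le_trans (HC _ Ax))// ltW.
Qed.

Section restriction.
Context d (T : measurableType d) (R : realType) (mu : {measure set T -> \bar R}).
Implicit Types (A B : set T) (f : T -> R).

Lemma patch_EFin A f : EFin \o (fun x => f x * (x \in A)%:R) = (EFin \o f) \_ A.
Proof. by apply/funext => x; rewrite patchE /=; case: ifP => _; rewrite ?mulr1 ?mulr0. Qed.

Lemma Rintegral_indic_subset A B f : A `<=` B ->
  \int[mu]_(x in B) (f x * (x \in A)%:R) = \int[mu]_(x in A) f x.
Proof.
move=> AB; rewrite /Rintegral -[in RHS](setIidr AB) integral_mkcondr.
by congr fine; apply: eq_integral => x _; rewrite -patch_EFin.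
Qed.

Lemma integrable_indic_subset A B f : measurable A -> measurable B -> A `<=` B ->
  mu.-integrable A (EFin \o f) ->
  mu.-integrable B (EFin \o (fun x => f x * (x \in A)%:R)).
Proof.
move=> mA mB AB fA; rewrite patch_EFin.
by apply/integrable_restrict => //; rewrite (setIidr AB).
Qed.

Lemma Rintegral_comb A (a b : R) f g : measurable A ->
  mu.-integrable A (EFin \o f) -> mu.-integrable A (EFin \o g) ->
  mu.-integrable A (EFin \o (fun x => a * f x + b * g x)) /\
  \int[mu]_(x in A) (a * f x + b * g x) = a * \int[mu]_(x in A) f x + b * \int[mu]_(x in A) g x.
Proof.
move=> mA fA gA; have fA' := integrableZl_EFin a mA fA; have gA' := integrableZl_EFin b mA gA.
split; first exact: integrableD_EFin.
by rewrite RintegralD// RintegralZl// RintegralZl.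
Qed.

Lemma Rintegral_sum A n (F : 'I_n -> T -> R) : measurable A ->
  (forall i, mu.-integrable A (EFin \o F i)) ->
  \int[mu]_(x in A) (\sum_i F i x) = \sum_i \int[mu]_(x in A) F i x.
Proof.
move=> mA iF; rewrite /Rintegral; under eq_integral do rewrite -sumEFin.
rewrite integral_sum// sum_fine// => i _.
exact: (integrable_fin_num mA (iF i)).
Qed.

End restriction.

Section localized_inequality.
Context {R : realType} {m : nat}.
Local Notation N := m.+1.
Variables (u rho : 'rV[R]_N -> R) (x0 : 'rV[R]_N).
Hypothesis N3 : (2 < N)%N.
Hypothesis C3u : Ck 3 u.
Hypothesis u_spacelike : forall x, enorm (grad u x) < 1.
Hypothesis C1rho : Ck 1 rho.
Hypothesis u_eq : mean_curvature_eq u rho.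
Local Notation v := (spacelike_factor u).
Local Notation ell := (lorentz_sq u x0).
Local Notation sig := (sigma u x0).

Variables (g : R).
Hypothesis g0 : 0 < g.
Hypothesis gM : g <= (16 * m%:R)^-1.

Let M2 : 2 <= m%:R :> R. Proof. by rewrite ler_nat. Qed.

Let g_half : g <= 1 / 2.
Proof.
have m0 : 0 < 16 * m%:R :> R by have := M2; lra.
have : g * (16 * m%:R) <= 1 by rewrite -ler_pdivlMr// mul1r.
have : g * 2 <= g * m%:R by rewrite ler_wpM2l ?M2// ltW.
lra.
Qed.

Lemma curvature_form_ge x :
  (8 * m%:R)^-1 * shape2 u x - (2 + 4 * m%:R) * rho x ^+ 2 <=
  shape2 u x - (1 + g) * tilt2 u x - (1 + g) * rho x * tau u x - rho x ^+ 2.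
Proof.
have v0 := spacelike_factor_gt0 u_spacelike x; have v2 := spacelike_factor_sqr u_spacelike x.
apply: coercive_form => //.
  rewrite /tau /tilt2 exprMn -exprVn -exprM /= -[leLHS]add0r.
  by rewrite exprVn lerD2r mulr_ge0 ?sdot_ge0// invr_ge0 exprn_ge0// ltW.
have := @shape_operator_bound R N (d2u u x) (du u x) (v x)^-1 (rho x) N3 (d2u_sym C3u x).
rewrite (_ : N%:R - 1 = m%:R); last by rewrite -natr1 addrK.
rewrite /shape2 /tilt2 -!exprVn; apply.
- by have := exprn_gt0 2 v0; lra.
- by rewrite -v2 exprVn mulVf// expf_neq0// lt0r_neq0.
have := div_flux C3u u_spacelike u_eq x; rewrite /dflux big_split /=.
rewrite powR_inv1 ?(ltW v0)// powR_invn ?(ltW v0)// => <-.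
rewrite [RHS]addrC exprVn !mulr_sumr; congr (_ + _).
by apply: eq_bigr => i _; rewrite /hess_grad mulrAC -mulrA.
Qed.

Variables (kap : R -> R) (e e' R1 r : R).
Hypothesis e0 : 0 < e.
Hypothesis ee' : e < e'.
Hypothesis er : e' < R1.
Hypothesis R1r : R1 < r.
Hypothesis er' : e' <= 3 / 4 * r.
Hypothesis Rr : 7 / 8 * r <= R1.
Hypothesis kapc : continuous kap.
Hypothesis kap0 : forall s, 0 <= kap s.
Hypothesis kap1 : forall s, kap s <= 1.
Hypothesis kape : forall s, s <= e -> kap s = 0.
Hypothesis kapr : forall s, r <= s -> kap s = 0.
Hypothesis kap_one : forall s, e' <= s -> s <= R1 -> kap s = 1.
Hypothesis kap_decr : forall s t, e' <= s -> s <= t -> kap t <= kap s.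

Local Notation eta := (weight kap r m.+2).
Local Notation chi := (weight kap r m.+1).
Local Notation xi := (weight kap r m).
Local Notation en := (energy kap r m).

(** The divergence of [test_field] divided by v^(g+1), for the radial profile [eta], whose
    derivative is - [cutpow kap m.+3] / 2 at sqrt l, and for E = [en]. *)
Definition flux_div x : R := N%:R * eta (ell x)
  + 2 * (- (cutpow kap m.+3 (Num.sqrt (ell x)) / 2)) * (ell x + sig x ^+ 2)
  - eta (ell x) * rho x * sig x
  + g * eta (ell x) * rho x * (sig x + height u x0 x * v x)
  - g * en (ell x) * (shape2 u x - (1 + g) * tilt2 u x - (1 + g) * rho x * tau u x - rho x ^+ 2).

(** The pointwise inequality to be integrated; [flux_div] then drops out. [weight_mass] yields the
    two ball terms, the coercive form the Hessian term. The terms in rho sigma are absorbed by - 2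
    eta' sigma^2 where sqrt(ell) >= [e'], and inside K_e' they are kept with the crude bound N eta
    <= e^(-N). *)
Lemma flux_div_le x :
  r ^- N * (Num.sqrt (ell x) < R1)%R%:R
  + g * (8 * m%:R)^-1 * (5 / 256 * r ^+ 3 * r ^- m.+2) * (shape2 u x * (Num.sqrt (ell x) < r / 2)%R%:R)
  <= e ^- N * ((1 + `|rho x * sig x|) * (Num.sqrt (ell x) < e')%R%:R)
    + 3 / 2 * (rho x ^+ 2 * xi (ell x)) + 1 / 2 * (`|rho x| * chi (ell x)) - flux_div x.
Proof.
have l0 : 0 <= ell x by exact: lorentz_sq_ge0.
have M0 : 0 < m%:R :> R by have := M2; lra.
have N0 : 0 < N%:R :> R by rewrite ltr0n.
have N1 : 3 <= N%:R :> R by rewrite ler_nat.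
have eta0 : 0 <= eta (ell x) by apply: weight_ge0.
have xi0 : 0 <= xi (ell x) by apply: weight_ge0.
have chi0 : 0 <= chi (ell x) by apply: weight_ge0.
have E0 : 0 <= en (ell x) by exact: (energy_ge0 r e0 kapc kap0 kape).
have Exi : en (ell x) <= xi (ell x) / 2 by exact: (energy_le r kap0).
have A0 : 0 <= shape2 u x by exact: shape2_ge0.
have Q := curvature_form_ge x.
have mass := weight_mass e0 ee' er R1r kapc kap0 kap1 kape kapr kap_one kap_decr m (ell x).
have W : ell x * cutpow kap m.+3 (Num.sqrt (ell x)) = cutpow kap m.+1 (Num.sqrt (ell x)).
  by apply: sqr_cutpow => // _; rewrite kape// ltW.
have Letachi : Num.sqrt (ell x) * eta (ell x) <= chi (ell x).
  exact: (sqrt_weight_le r e0 kapc kap0 kape).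
have sh := @sigma_height_le _ _ u x0 C3u u_spacelike x.
have w0 : 0 <= cutpow kap m.+3 (Num.sqrt (ell x)) by apply: cutpow_ge0 => //; exact: sqrtr_ge0.
set L := Num.sqrt (ell x) in mass W Letachi sh w0 *.
have L0 : 0 <= L by exact: sqrtr_ge0.
(* The factor 1 + g collects the contributions of eta rho sigma and of g eta rho (sigma + w v).
   Young's constant (1 + g)^2/(4N) is below 3/4 because g <= 1/2 and N >= 3. *)
have young : (1 + g) * eta (ell x) * (`|rho x| * `|sig x|) <=
    cutpow kap m.+3 L * sig x ^+ 2 + 3 / 4 * (rho x ^+ 2 * xi (ell x))
    + e ^- N * (`|rho x| * `|sig x|) * (L < e')%R%:R.
  have p0 : 0 <= `|rho x| * `|sig x| by rewrite mulr_ge0.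
  have xr : 0 <= rho x ^+ 2 * xi (ell x) by rewrite mulr_ge0 ?sqr_ge0.
  have ws : 0 <= cutpow kap m.+3 L * sig x ^+ 2 by rewrite mulr_ge0 ?sqr_ge0.
  have [Le|eL] := ltP L e'.
    have h := weight_le_e e0 ee' er R1r kapc kap0 kap1 kape kapr m (ell x).
    have rN : 0 <= r ^- m.+1 by rewrite invr_ge0 exprn_ge0// (le_trans _ (ltW R1r))// (le_trans _ (ltW er))// (le_trans _ (ltW ee'))// ltW.
    have h1 : (1 + g) * eta (ell x) <= e ^- N.
      apply: (@le_trans _ _ (N%:R * eta (ell x))); last by move: h rN; lra.
      by rewrite ler_wpM2r//; have := g_half; lra.
    have := ler_wpM2r p0 h1; rewrite mulr1; lra.
  have L1 : 0 < L by apply: lt_le_trans eL; exact: lt_trans ee'.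
  have h := weight_le_kap e0 ee' er R1r kapc kap0 kape kap_decr m eL.
  have hx : L ^+ 2 * eta (ell x) <= xi (ell x).
    by rewrite sqr_sqrtr//; exact: (sq_weight_le r e0 kapc kap0 kape).
  have := @weighted_young R N%:R L _ _ _ `|rho x| `|sig x| (1 + g) N0 L1 eta0 hx h.
  rewrite !real_normK ?num_real// mulr0 addr0 => H; apply: le_trans H _.
  have -> : kap L / L ^+ m.+1 * L ^- 2 = cutpow kap m.+3 L.
    by rewrite /cutpow !exprS; field; rewrite !expf_neq0 lt0r_neq0.
  rewrite lerD2l -mulrA [xi _ * _]mulrC ler_wpM2r//.
  rewrite ler_pdivrMr ?mulr_gt0//.
  have : (1 + g) ^+ 2 <= (3 / 2) ^+ 2.
    by apply: lerXn2r; rewrite ?nnegrE; have := g_half; have := g0; lra.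
  by move: N1; lra.
have h1 : - (eta (ell x) * (`|rho x| * `|sig x|)) <= eta (ell x) * rho x * sig x.
  by rewrite -mulrA -mulrN ler_wpM2l// -normrM; have := ler_norm (- (rho x * sig x)); rewrite normrN; lra.
have h2 : g * eta (ell x) * rho x * (sig x + height u x0 x * v x) <=
    g * eta (ell x) * (`|rho x| * (L + `|sig x|)).
  have ge : 0 <= g * eta (ell x) by rewrite mulr_ge0// ltW.
  rewrite -mulrA ler_wpM2l//; apply: le_trans (ler_norm _) _.
  by rewrite normrM ler_wpM2l.
have h3 : g * (L * eta (ell x) * `|rho x|) <= 1 / 2 * (chi (ell x) * `|rho x|).
  apply: ler_pM; rewrite ?(ltW g0) ?g_half//.
    by rewrite !mulr_ge0.
  by rewrite ler_wpM2r.
have gE : 0 <= g * en (ell x) by rewrite mulr_ge0// ltW.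
have h4 := ler_wpM2l gE Q.
(* Together with [en] <= [xi]/2 this bounds the rho^2 loss of the coercive form by rho^2 xi/4; added
   to the 3/4 from Young it stays below the coefficient 3/2. *)
have gC : g * (2 + 4 * m%:R) <= 1 / 2.
  have m0 : 0 < 16 * m%:R :> R by have := M2; lra.
  have a : g * (16 * m%:R) <= 1 by rewrite -ler_pdivlMr// mul1r.
  have b : g * 2 <= g * m%:R by rewrite ler_wpM2l ?M2// ltW.
  by move: a b; lra.
have h5 : (g * (2 + 4 * m%:R)) * (en (ell x) * rho x ^+ 2) <= 1 / 2 * (xi (ell x) / 2 * rho x ^+ 2).
  apply: ler_pM => //.
  - by rewrite mulr_ge0 ?(ltW g0)//; have := M2; lra.
  - by rewrite mulr_ge0 ?sqr_ge0.
  - by rewrite ler_wpM2r ?sqr_ge0.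
have h6 : 5 / 256 * r ^+ 3 / r ^+ m.+2 * (L < r / 2)%R%:R <= en (ell x).
  have [Lr|_] := ltP L (r / 2); last by rewrite mulr0.
  by rewrite mulr1; apply: (energy_ge e0 ee' er R1r kapc kap0 kape kap_one) => //; exact: ltW.
have gl : 0 <= g * (8 * m%:R)^-1 * shape2 u x.
  by rewrite mulr_ge0// mulr_ge0 ?(ltW g0)// invr_ge0 mulr_ge0// ltW.
have h7 := ler_wpM2l gl h6.
have px : 0 <= xi (ell x) * rho x ^+ 2 by rewrite mulr_ge0 ?sqr_ge0.
rewrite /flux_div -/L normrM.
move: (5 / 256 * r ^+ 3 / r ^+ m.+2) h7 => c0 h7.
have W2 : cutpow kap m.+3 L / 2 * (ell x) * 2 = cutpow kap m.+1 L by rewrite -W; field.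
move: mass W2 young h1 h2 h3 h4 h5 h7 px; lra.
Qed.

Local Notation mu := (lebesgue_row R N).
Local Notation K := (lorentz_ball u x0).
Hypothesis bK : bounded_set (K r).

Let r0 : 0 < r.
Proof. by rewrite (lt_trans _ R1r)// (lt_trans _ er)// (lt_trans e0). Qed.

Lemma weight_outside k l : r <= Num.sqrt l -> weight kap r k l = 0.
Proof. by move=> rl; rewrite /weight set_itv_ge ?Rintegral_set0// bnd_simp -leNgt. Qed.

Lemma mem_lorentz_ball s x : (x \in K s) = (Num.sqrt (ell x) < s).
Proof. by rewrite lorentz_ballE; apply/idP/idP; rewrite inE. Qed.

Let bounded_ball s : s <= r -> bounded_set (K s).
Proof.
move=> sr; have [M HM] := (bounded_setP _).1 bK; apply/bounded_setP; exists M => x Kx.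
by apply: HM; exact: subset_lorentz_ball Kx.
Qed.

Lemma integrable_ball s f : s <= r -> continuous f -> mu.-integrable (K s) (EFin \o f).
Proof.
move=> sr cf; apply: integrable_bounded_row => //; last exact: bounded_ball.
exact: measurable_lorentz_ball.
Qed.

(** The weights vanish once sqrt(ell) >= r, so the field vanishes outside the bounded set K_r and
    each partial derivative integrates to zero over the whole space. No regularity of the boundary
    of K_r enters. *)
Lemma Rintegral_flux_div : continuous (fun x => v x `^ (g + 1) * flux_div x) /\
  \int[mu]_(x in K r) (v x `^ (g + 1) * flux_div x) = 0.
Proof.
have deta (l : R) : is_derive l 1 eta (- (cutpow kap m.+3 (Num.sqrt l) / 2)).
  exact: (is_derive_weight e0 ee' er R1r kapc kape kapr).
have cdeta : continuous ((fun l => - (cutpow kap m.+3 (Num.sqrt l) / 2)) : R -> R).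
  exact: (cont_dweight e0 kapc kape).
have dE (l : R) : is_derive l 1 en (- (eta l / 2)).
  exact: (is_derive_energy e0 ee' er R1r kapc kape kapr).
have [dF [HF sumF]] := has_grad_test_field x0 C3u u_spacelike C1rho u_eq g deta cdeta dE.
have sE : (fun x => v x `^ (g + 1) * flux_div x) = fun x => \sum_i dF i i x.
  by apply/funext => x; rewrite sumF.
have cF i : continuous (dF i i) by exact: has_grad_continuous_grad (HF i).
have out x : ~ K r x -> r <= Num.sqrt (ell x).
  by rewrite lorentz_ballE /= => /negP; rewrite -leNgt.
have [M HM] := (bounded_setP _).1 bK.
have en0 x : r <= Num.sqrt (ell x) -> en (ell x) = 0.
  by move=> rx; rewrite /energy !weight_outside// mulr0 subrr mul0r.
have suppF i x : M < `|x| -> test_field u rho x0 g eta en i x = 0.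
  move=> Mx; have rx : r <= Num.sqrt (ell x).
    by apply: out => /HM; rewrite leNgt Mx.
  by rewrite /test_field en0// weight_outside// !(mul0r, mulr0) subr0.
have PF i : partial i (test_field u rho x0 g eta en i) = dF i i by exact: partial_has_grad.
have dT i x : derivable (test_field u rho x0 g eta en i) x (delta_mx ord0 i).
  by have [_ /(_ i)[/(_ x)[]]] := HF i.
have cT i : continuous (test_field u rho x0 g eta en i) by have [] := HF i.
have cP i : continuous (partial i (test_field u rho x0 g eta en i)) by rewrite PF; exact: cF.
have IF i : \int[mu]_x dF i i x = 0.
  by rewrite -PF; exact: (Rintegral_partial (cT i) (dT i) (cP i) (suppF i)).
have IntF i : mu.-integrable setT (EFin \o dF i i).
  by rewrite -PF; exact: (integrable_partial (cP i) (suppF i)).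
rewrite sE; split.
  exact: continuous_sum.
transitivity (\int[mu]_x (\sum_i dF i i x)).
  rewrite -(@Rintegral_indic_subset _ _ _ mu (K r) setT)//.
  apply: eq_Rintegral => x _; have [//|] := boolP (x \in K r); first by rewrite mulr1.
  move=> /negP; rewrite inE => /out rx; rewrite mulr0 -[RHS]/((fun x => \sum_i dF i i x) x) -sE.
  by rewrite /flux_div en0// weight_outside// /cutpow kapr// !(mul0r, mulr0, oppr0, addr0, subr0).
have -> : \int[mu]_x (\sum_i dF i i x) = \sum_i \int[mu]_x dF i i x.
  exact: Rintegral_sum.
by rewrite big1.
Qed.

Lemma continuous_second_order :
  continuous (fun x => enorm (hessian u x) ^+ 2 + enorm (grad v x) ^+ 2).
Proof.
have /choice[dbet Hb] := has_grad_hess_grad C3u.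
have [H _] := has_gradD
  (has_grad_sum (fun i => has_grad_sum (fun j => has_gradM (has_grad_d2u C3u i j) (has_grad_d2u C3u i j))))
  (has_gradM (has_grad_powR_spacelike C3u u_spacelike (- 2)) (has_grad_sum (fun i => has_gradM (Hb i) (Hb i)))).
rewrite (_ : (fun x => _) = fun x => \sum_i \sum_j (d2u u x i j * d2u u x i j)
  + v x `^ (- 2) * \sum_i hess_grad u x i * hess_grad u x i)//.
apply/funext => x; rewrite enorm_grad_spacelike_factor// powR_invn ?(ltW (spacelike_factor_gt0 u_spacelike x))//; congr (_ + _).
rewrite /enorm sqr_sqrtr; last first.
  by apply: sumr_ge0 => i _; apply: sumr_ge0 => j _; exact: sqr_ge0.
by apply: eq_bigr => i _; apply: eq_bigr => j _; rewrite mxE expr2.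
Qed.

Lemma localized_inequality :
  r ^- N * \int[mu]_(x in K R1) (v x `^ (g + 1))
  + g * (8 * m%:R)^-1 * (5 / 256 * r ^+ 3 * r ^- m.+2) *
    \int[mu]_(x in K (r / 2)) (v x `^ (g - 1) * (enorm (hessian u x) ^+ 2 + enorm (grad v x) ^+ 2))
  <= e ^- N * \int[mu]_(x in K e') (v x `^ (g + 1) * (1 + `|rho x * sig x|))
  + 3 / 2 * \int[mu]_(x in K r) (v x `^ (g + 1) * rho x ^+ 2 * xi (ell x))
  + 1 / 2 * \int[mu]_(x in K r) (v x `^ (g + 1) * `|rho x| * chi (ell x)).
Proof.
have [cH IH] := Rintegral_flux_div.
have rhoc : continuous rho by have [] := C1rho.
have cpow a : continuous (fun x => v x `^ a) by have [] := has_grad_powR_spacelike C3u u_spacelike a.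
have ctau := continuous_second_order.
have csig := @continuous_sigma _ _ u x0 C3u u_spacelike.
have cw k : continuous (weight kap r k \o ell).
  move=> x; apply: continuous_comp; first exact: (@continuous_lorentz_sq _ _ u x0 C3u).
  apply: differentiable_continuous; apply/derivable1_diffP.
  by have [] := is_derive_weight e0 ee' er R1r kapc kape kapr k (ell x).
have cM (f h : 'rV[R]_N -> R) : continuous f -> continuous h -> continuous (fun x => f x * h x).
  by move=> cf ch x; exact: (cvgM (cf x) (ch x)).
have cA (f : 'rV[R]_N -> R) : continuous f -> continuous (fun x => `|f x|).
  by move=> cf x; exact: (cvg_norm (cf x)).
have mK s := @measurable_lorentz_ball _ _ u x0 C3u s.
have KS s : s <= r -> K s `<=` K r by exact: subset_lorentz_ball.
have e'r : e' <= r by rewrite (le_trans (ltW er))// ltW.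
have rr : r / 2 <= r by move: r0; lra.
pose f1 x := v x `^ (g + 1).
pose f2 x := v x `^ (g - 1) * (enorm (hessian u x) ^+ 2 + enorm (grad v x) ^+ 2).
pose f3 x := v x `^ (g + 1) * (1 + `|rho x * sig x|).
pose f4 x := v x `^ (g + 1) * rho x ^+ 2 * xi (ell x).
pose f5 x := v x `^ (g + 1) * `|rho x| * chi (ell x).
pose H x := v x `^ (g + 1) * flux_div x.
have c1 : continuous f1 by exact: cpow.
have c2 : continuous f2 by exact: cM.
have c3 : continuous f3.
  apply: (@cM _ _) => // x.
  exact: (cvgD (cvg_cst _) (cvg_norm (cvgM (rhoc x) (csig x)))).
have c4 : continuous f4.
  apply: (@cM _ _); last exact: cw.
  by apply: (@cM _ _) => //; apply: (@cM _ _).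
have c5 : continuous f5.
  by apply: (@cM _ _); [apply: (@cM _ _) => //; exact: cA|exact: cw].
have I s (f : 'rV[R]_N -> R) : s <= r -> continuous f ->
    mu.-integrable (K r) (EFin \o (fun x => f x * (x \in K s)%:R)).
  by move=> sr cf; apply: integrable_indic_subset; rewrite ?mK//; [exact: KS|exact: integrable_ball].
have [i1 E1] := Rintegral_comb (r ^- N) (g * (8 * m%:R)^-1 * (5 / 256 * r ^+ 3 * r ^- m.+2))
  (mK r) (I _ _ (ltW R1r) c1) (I _ _ rr c2).
have [i2 E2] := Rintegral_comb (e ^- N) (3 / 2) (mK r) (I _ _ e'r c3) (integrable_ball (lexx r) c4).
have [i3 E3] := Rintegral_comb (1 / 2) (- 1) (mK r) (integrable_ball (lexx r) c5) (integrable_ball (lexx r) cH).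
have E4 := RintegralD (mK r) i2 i3.
have i4 := integrableD_EFin (mK r) i2 i3.
have Ke := KS _ e'r; have K2 := KS _ rr; have K1 := KS _ (ltW R1r).
move: E1 E4; rewrite E2 E3 IH mulr0 addr0 !Rintegral_indic_subset// => <- <-; apply: le_Rintegral => // x _.
rewrite !mem_lorentz_ball /f1 /f2 /f3 /f4 /f5 /H.
have w0 : 0 <= v x `^ (g + 1) by exact: powR_ge0.
have F := ler_wpM2l w0 (flux_div_le x).
have S := enorm_hessian_grad_le C3u u_spacelike g x.
have c0 : 0 <= g * (8 * m%:R)^-1 * (5 / 256 * r ^+ 3 * r ^- m.+2).
  have rp k : 0 <= r ^+ k by rewrite exprn_ge0// ltW// r0.
  apply: mulr_ge0; first by apply: mulr_ge0; [exact: ltW|rewrite invr_ge0 mulr_ge0].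
  exact: divr_ge0 (mulr_ge0 (divr_ge0 (ler0n _ 5) (ler0n _ 256)) (rp 3%N)) (rp m.+2).
have b0 : 0 <= (Num.sqrt (ell x) < r / 2)%R%:R :> R by exact: ler0n.
have := ler_wpM2l c0 (ler_wpM2r b0 S).
move: F; rewrite !mulrA; lra.
Qed.

End localized_inequality.

(** * Hoelder and layer-cake inequalities *)

Lemma powR_le_base {R : realType} (w q : R) : 0 <= w <= 1 -> 1 <= q -> w `^ q <= w.
Proof.
move=> /andP[w0 w1] q1; have [->|wn0] := eqVneq w 0.
  by rewrite powR0// gt_eqF// (lt_le_trans _ q1).
rewrite -(subrKC 1 q) powRD ?wn0 ?implybT// powRr1// ler_piMr//.
apply: (@le_trans _ _ (1 `^ (q - 1))); last by rewrite powR1.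
by rewrite ge0_ler_powR ?nnegrE ?subr_ge0.
Qed.

Section hoelder_weight.
Context d (T : measurableType d) (R : realType) (mu : {measure set T -> \bar R}).
Local Open Scope ereal_scope.

Lemma integral_indic_EFin (A : set T) (f : T -> R) :
  \int[mu]_x (f x * (x \in A)%:R)%:E = \int[mu]_(x in A) (f x)%:E.
Proof.
by rewrite [RHS]integral_mkcond; apply: eq_integral => x _; rewrite -patch_EFin.
Qed.

Lemma measurable_indic_mul (A : set T) (f : T -> R) : measurable A ->
  measurable_fun setT f -> measurable_fun setT (fun x => f x * (x \in A)%:R)%R.
Proof.
move=> mA mf; apply: measurable_funM => //.
have -> : (fun x => (x \in A)%:R : R) = \1_A by apply/funext => x; rewrite indicE.
exact: measurable_indic.
Qed.

Lemma EFin_Rintegral (A : set T) (f : T -> R) : measurable A -> mu.-integrable A (EFin \o f) ->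
  (\int[mu]_(x in A) f x)%R%:E = \int[mu]_(x in A) (f x)%:E.
Proof. by move=> mA fA; rewrite /Rintegral fineK//; exact: integrable_fin_num. Qed.

Lemma Rintegral_Lnorm (p : R) (D : set T) (a : T -> R) : (0 < p)%R -> measurable D ->
  mu.-integrable D (EFin \o (fun x => `|a x| `^ p)%R) ->
  'N[mu]_p%:E [EFin \o (fun x => a x * (x \in D)%:R)%R] =
  ((\int[mu]_(x in D) (`|a x| `^ p)) `^ p^-1)%R%:E.
Proof.
move=> p0 mD aD; rewrite unlock -poweR_EFin; congr (_ `^ _).
rewrite EFin_Rintegral; [|exact: mD|exact: aD].
rewrite -[RHS]integral_indic_EFin; apply: eq_integral => x _ /=.
case: (x \in D); rewrite ?mulr1 ?mulr0 ?normr0// powR0//; exact: lt0r_neq0.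
Qed.

(** Hoelder with w itself as second factor: 0 <= w <= 1 and q >= 1 give w^q <= w, so the norm of w
    is at most a power of its integral. The norm of [a] is taken over the larger set [D], which
    makes it the same for all concentric balls. *)
Lemma hoelder_weight (K D : set T) (a w : T -> R) (p q : R) :
  measurable K -> measurable D -> K `<=` D ->
  measurable_fun setT a -> measurable_fun setT w -> (forall x, 0 <= w x <= 1)%R ->
  (0 < p)%R -> (0 < q)%R -> (p^-1 + q^-1 = 1)%R ->
  mu.-integrable D (EFin \o (fun x => `|a x| `^ p)%R) -> mu.-integrable K (EFin \o w) ->
  (\int[mu]_(x in K) (`|a x| * w x) <=
  (\int[mu]_(x in D) (`|a x| `^ p)) `^ p^-1 * (\int[mu]_(x in K) w x) `^ q^-1)%R.
Proof.
move=> mK mD KD ma mw w01 p0 q0 pq aD wK.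
pose f x : R := (a x * (x \in D)%:R)%R; pose h x : R := (w x * (x \in K)%:R)%R.
have mf : measurable_fun setT f by exact: measurable_indic_mul.
have mh : measurable_fun setT h by exact: measurable_indic_mul.
have := hoelder mu mf mh p0 q0 pq; rewrite Lnorm1 Rintegral_Lnorm//.
have -> : \int[mu]_x `|(EFin \o (f \* h)%R) x| = \int[mu]_(x in K) (`|a x| * w x)%:E.
  rewrite -[RHS]integral_indic_EFin; apply: eq_integral => x _ /=; congr (_%:E).
  rewrite /f /h !normrM (ger0_norm (proj1 (andP (w01 x)))) !normr_nat mulrACA -natrM mulnb.
  have [xK|//] := boolP (x \in K); last by rewrite andbF.
  by rewrite (_ : x \in D)// inE; apply: KD; rewrite inE in xK.
have hq : 'N[mu]_q%:E [EFin \o h] <= (((\int[mu]_(x in K) w x) `^ q^-1)%R)%:E.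
  have I0 : 0 <= (\int[mu]_(x in K) w x)%R%:E.
    by rewrite lee_fin Rintegral_ge0// => x _; case/andP: (w01 x).
  have J0 : 0 <= \int[mu]_x (`|(EFin \o h) x| `^ q).
    by apply: integral_ge0 => x _; exact: poweR_ge0.
  rewrite unlock -poweR_EFin; apply: gt0_ler_poweR.
  - by rewrite invr_ge0 ltW.
  - by rewrite in_itv /= J0 leey.
  - by rewrite in_itv /= I0 leey.
  rewrite EFin_Rintegral; [|exact: mK|exact: wK].
  rewrite -[leRHS]integral_indic_EFin; apply: ge0_le_integral.
  - exact: measurableT.
  - by move=> x _; exact: poweR_ge0.
  - apply/measurable_EFinP; apply: (measurableT_comp (measurable_powR q)).
    exact: (measurableT_comp (@normr_measurable _ _)).
  - by apply/measurable_EFinP.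
  move=> x _ /=; rewrite lee_fin /h; have /andP[w0 w1] := w01 x.
  case: (x \in K); rewrite ?mulr1 ?mulr0 ?normr0 ?powR0 ?lt0r_neq0// ger0_norm//.
  by apply: powR_le_base; rewrite ?w0// -[q]invrK -invr1 lef_pV2 ?posrE ?invr_gt0// -pq lerDr invr_ge0 ltW.
have wi : mu.-integrable K (EFin \o (fun x => `|a x| * w x)%R).
  apply: (le_integrable mK _ _ (integrableD_EFin mK (integrableS mD mK KD aD) wK)).
    by apply/measurable_EFinP/measurable_funTS/measurable_funM => //; exact: measurableT_comp.
  move=> x Kx /=; rewrite lee_fin; have /andP[w0 w1] := w01 x.
  move: (normr_ge0 (a x)); move: (`|a x|)%R => b b0.
  rewrite (@ger0_norm _ (b * w x)) ?mulr_ge0// (@ger0_norm _ (b `^ p + w x)) ?addr_ge0 ?powR_ge0//.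
  have [b1|b1] := lerP b 1%R; first by rewrite ler_wpDl ?powR_ge0// ler_piMl.
  rewrite ler_wpDr// (le_trans (ler_piMr b0 w1))// -[leLHS]powRr1//.
  rewrite ler_powR ?(ltW b1)// -[p]invrK -invr1 lef_pV2 ?posrE ?invr_gt0// -pq lerDl.
  by rewrite invr_ge0 ltW.
move=> H; have := le_trans H (lee_wpmul2l _ hq); rewrite -EFin_Rintegral//.
by move=> /(_ (powR_ge0 _ _)); rewrite -EFinM lee_fin.
Qed.

End hoelder_weight.

Lemma layer_cake d (T : measurableType d) (R : realType)
    (mu : {sigma_finite_measure set T -> \bar R}) (L f : T -> R) (k : R -> R) (r : R) :
  measurable_fun setT L -> measurable_fun setT f -> measurable_fun setT (k : measurableTypeR R -> measurableTypeR R) ->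
  (forall x, 0 <= f x) -> (forall s, 0 <= k s) ->
  (\int[mu]_x \int[lebesgue_measure]_(s in `]L x, r]) (f x * k s)%:E =
   \int[lebesgue_measure]_(s in `]-oo, r]) \int[mu]_(x in [set x | L x < s]%R) (f x * k s)%:E)%E.
Proof.
move=> mL mf mk f0 k0.
pose F (p : T * measurableTypeR R) := (if (L p.1 < p.2) && (p.2 <= r) then (f p.1 * k p.2)%:E else 0%E).
have mF : measurable_fun setT F.
  apply: measurable_fun_ifT => //.
    apply: measurable_and.
      apply: measurable_fun_ltr; last exact: measurable_snd.
      exact: (measurableT_comp mL measurable_fst).
    by apply: measurable_fun_ler => //; exact: measurable_snd.
  apply/measurable_EFinP; apply: measurable_funM.
    exact: (measurableT_comp mf measurable_fst).
  exact: (measurableT_comp mk measurable_snd).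
have F0 p : (0 <= F p)%E.
  by rewrite /F; case: ifP => // _; rewrite lee_fin mulr_ge0.
have := @fubini_tonelli _ _ T (measurableTypeR R) R mu (@lebesgue_measure R) F mF F0.
under eq_integral => x _.
  rewrite (_ : (\int[lebesgue_measure]_y F (x, y) = \int[lebesgue_measure]_(s in `]L x, r]) (f x * k s)%:E)%E).
    over.
  rewrite [RHS]integral_mkcond; apply: eq_integral => s _; rewrite patchE /F /=.
  by rewrite mem_setE in_itv.
move=> ->; rewrite [RHS]integral_mkcond; apply: eq_integral => s _; rewrite patchE mem_setE in_itv /=.
have [sr|rs] := leP s r.
  rewrite [RHS]integral_mkcond; apply: eq_integral => x _; rewrite patchE /F /= sr andbT.
  by rewrite mem_setE.
by apply: integral0_eq => x _; rewrite /F /= leNgt rs andbF.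
Qed.

(** * Volume of small Lorentz balls *)

Lemma enorm_row {R : realType} {n : nat} (x : 'rV[R]_n) : enorm x = Num.sqrt (dotr x x).
Proof.
rewrite /enorm (bigD1 ord0)//= [X in _ + X]big1 ?addr0; last by move=> i; rewrite (ord1 i) eqxx.
by congr Num.sqrt; apply: eq_bigr => j _; rewrite expr2.
Qed.

Lemma mem_set_bool T (b : T -> bool) x : (x \in [set x | b x]) = b x.
Proof. by apply/idP/idP; rewrite inE. Qed.

Section unit_ball.
Context {R : realType} {n : nat}.
Local Notation mu := (lebesgue_row R n).
Local Notation B := [set x : 'rV[R]_n | enorm x < 1].

Lemma unit_ballE : B = [set x | dotr x x < 1].
Proof.
apply/eq_set => x; rewrite enorm_row -[X in _ < X]sqrtr1 ltr_sqrt//.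
Qed.

Lemma measurable_unit_ball : measurable B.
Proof.
rewrite unit_ballE -[X in measurable X]setTI.
exact: (@measurable_dotrr R n measurableT _ (measurable_itv `]-oo, 1[)).
Qed.

Lemma unit_ball_fin : (mu B < +oo)%E.
Proof.
apply: (bounded_lebesgue_row measurable_unit_ball (M := 1)) => x.
rewrite unit_ballE /= -[`|x|]normrN -[- x]sub0r => Bx.
apply/ltW/norm_coord_lt => // i; rewrite mxE sub0r normrN.
rewrite -(@ltr_pXn2r _ 2) ?nnegrE// expr1n real_normK ?num_real//.
apply: le_lt_trans Bx; rewrite /dotr (bigD1 i)//= -expr2 lerDl.
by apply: sumr_ge0 => j _; rewrite -expr2 sqr_ge0.
Qed.

Lemma unit_ball_volumeE : (unit_ball_volume R n)%:E = mu B.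
Proof. by rewrite /unit_ball_volume fineK// ge0_fin_numE// unit_ball_fin. Qed.

Lemma unit_ball_volume_gt0 : 0 < unit_ball_volume R n.
Proof.
(* A cube of half-side c fits in the ball, since n c^2 = c (1 - c) < 1, including n = 0. *)
pose c : R := (n.+1%:R)^-1; have c0 : 0 < c by rewrite invr_gt0 ltr0n.
have n1 : 0 < n.+1%:R :> R by rewrite ltr0n.
pose A : set 'rV[R]_n := [set x | forall i, `]- c, c[%classic (x ord0 i)].
have muA : mu A = ((2 * c) ^+ n)%:E.
  rewrite (@lebesgue_row_box R n (fun=> `]- c, c[%classic)); last by move=> i; exact: measurable_itv.
  under eq_bigr => i _ do rewrite lebesgue_measure_itv /= lte_fin ifT ?gtrN// -EFinB.
  by rewrite prodEFin big_const card_ord iter_mulr_1 opprK mulr_natl mulr2n.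
have mA : measurable A.
  rewrite (_ : A = \bigcap_(i in [set: 'I_n]) ((fun x : 'rV[R]_n => x ord0 i) @^-1` `]- c, c[%classic)).
    apply: fin_bigcap_measurable => // i _; rewrite -[X in measurable X]setTI.
    exact: (measurable_coord i measurableT (measurable_itv _)).
  by apply/seteqP; split => x /= h i => [_|]; exact: h.
have AB : A `<=` B.
  move=> x Ax; rewrite unit_ballE /=.
  have : dotr x x <= \sum_(i < n) c ^+ 2.
    apply: ler_sum => i _; have := Ax i; rewrite /= in_itv /= => /andP[h1 h2].
    rewrite -expr2 -[leLHS]real_normK ?num_real//; apply: lerXn2r; rewrite ?nnegrE ?(ltW c0)//.
    by rewrite ler_norml (ltW h1) (ltW h2).
  rewrite sumr_const card_ord -mulr_natl => /le_lt_trans; apply.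
  have E1 : n%:R * c = 1 - c.
    have : n.+1%:R * c = 1 by rewrite /c mulfV// gt_eqF.
    by rewrite -natr1 mulrDl mul1r; lra.
  rewrite expr2 mulrA E1; have := sqr_ge0 (c - 1 / 2); lra.
rewrite -lte_fin unit_ball_volumeE; apply: lt_le_trans (le_measure mu _ _ AB).
- suff : (0 < lebesgue_row R n A)%E by [].
  by rewrite muA lte_fin exprn_gt0// mulr_gt0.
- by rewrite inE.
- by rewrite inE; exact: measurable_unit_ball.
Qed.

End unit_ball.

Section small_balls.
Context {R : realType} {N : nat}.
Variables (u : 'rV[R]_N -> R) (x0 : 'rV[R]_N).
Hypothesis C3u : Ck 3 u.
Hypothesis u_spacelike : forall x, enorm (grad u x) < 1.
Local Notation v := (spacelike_factor u).
Local Notation ell := (lorentz_sq u x0).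
Local Notation mu := (lebesgue_row R N).
Local Notation K := (lorentz_ball u x0).
Local Notation a := (\row_i du u x0 i).
Local Notation Q y := (dotr y y - dotr a y ^+ 2).

(** [Q] is the Lorentz form on the tangent hyperplane at x0. Its lower bound v(x0)^2 converts
    Euclidean Taylor errors into multiples of [Q]. *)
Lemma tangent_form_ge (y : 'rV[R]_N) : v x0 ^+ 2 * dotr y y <= Q y.
Proof.
have aa : dotr a a = 1 - v x0 ^+ 2.
  rewrite (spacelike_factor_sqr u_spacelike) opprB addrC subrK.
  by apply: eq_bigr => i _; rewrite !mxE.
have : dotr a y ^+ 2 <= dotr a a * dotr y y := sdot_CS (a ord0) (y ord0).
by rewrite aa; lra.
Qed.

Lemma measurable_tangent_ball (t : R) : measurable [set x | Q (x - x0) < t ^+ 2].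
Proof.
have mQ : measurable_fun [set: 'rV[R]_N] ((fun y => Q y) : _ -> measurableTypeR R).
  apply: measurable_funB; first exact: measurable_dotrr.
  apply: measurable_funX; exact: measurable_dotr.
have mS : measurable [set x : 'rV[R]_N | Q x < t ^+ 2].
  by have := mQ measurableT _ (measurable_itv `]-oo, (t ^+ 2)[); rewrite setTI.
have := @measurable_row_scale R N 1 (- x0) measurableT _ mS; rewrite setTI.
by congr measurable; apply/eq_set => x; rewrite /= scale1r.
Qed.

Lemma lebesgue_tangent_ball (t : R) : 0 < t ->
  mu [set x | Q (x - x0) < t ^+ 2] = (t ^+ N * unit_ball_volume R N / v x0)%:E.
Proof.
move=> t0.
have aa : 1 - dotr a a = v x0 ^+ 2.
  rewrite (spacelike_factor_sqr u_spacelike); congr (_ - _).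
  by apply: eq_bigr => i _; rewrite !mxE.
have v0 := spacelike_factor_gt0 u_spacelike x0.
pose h (z : R) : \bar R := (\1_(`]-oo, (t ^+ 2)[%classic : set R) z)%:E.
have mh : measurable_fun [set: measurableTypeR R] h.
  by apply/measurable_EFinP; apply: measurable_indic; exact: measurable_itv.
have h0 z : (0 <= h z)%E by rewrite lee_fin.
have mQ : measurable_fun [set: 'rV[R]_N] ((fun y => Q y) : _ -> measurableTypeR R).
  apply: measurable_funB; first exact: measurable_dotrr.
  apply: measurable_funX; exact: measurable_dotr.
have a1 : dotr a a < 1 by have := exprn_gt0 2 v0; rewrite -aa; lra.
have IL := integral_lorentz_form a1 mh h0.
transitivity (\int[mu]_x h (Q (x + - x0)))%E.
  rewrite (_ : (fun x => _) = fun x => (\1_[set x | Q (x - x0) < t ^+ 2] x)%:E).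
    rewrite integral_indic ?setIT//.
    exact: measurable_tangent_ball.
  by apply/funext => x; rewrite /h !indicE mem_setE in_itv mem_set_bool.
rewrite (@integral_row_translate R N (fun x => h (Q x))); last exact: (measurableT_comp mh mQ).
rewrite IL aa sqrtr_sqr gtr0_norm//.
have -> : (\int[mu]_y h (dotr y y) = \int[mu]_y (\1_[set x | enorm x < 1] (t^-1 *: y + 0))%:E)%E.
  apply: eq_integral => y _; rewrite addr0 unit_ballE /h !indicE mem_setE in_itv /= mem_set_bool.
  rewrite dotrZl dotrC dotrZl; congr (_%:R%:E).
  rewrite mulrA -invfM -expr2 ltr_pdivrMl ?exprn_gt0// mulr1//.
rewrite (@ge0_integral_row_affine R N t^-1 0 (fun x => (\1_[set x | enorm x < 1] x)%:E)) ?invr_gt0//.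
- rewrite integral_indic ?setIT//; last exact: measurable_unit_ball.
  rewrite exprVn invrK; transitivity ((v x0)^-1%:E * ((t ^+ N)%:E * (unit_ball_volume R N)%:E))%E.
    by rewrite unit_ball_volumeE.
  by rewrite -!EFinM; congr (_%:E); ring.
- by apply/measurable_EFinP; apply: measurable_indic; exact: measurable_unit_ball.
Qed.

(** With A = Du(x0) . y and |w - A| <= ep |y|, the error w^2 - A^2 = 2 A (w - A) + (w - A)^2 is at
    most 3 ep |y|^2. The choice of [ep] makes this (1 - k^2) v(x0)^2 |y|^2, hence at most (1 - k^2)
    Q(y). *)
Lemma lorentz_sq_ge_tangent (k : R) : 0 < k -> k < 1 ->
  exists2 d, 0 < d & forall x, `|x - x0| < d -> k ^+ 2 * Q (x - x0) <= ell x.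
Proof.
move=> k0 k1; have v0 := spacelike_factor_gt0 u_spacelike x0.
have k2 : k ^+ 2 < 1 by rewrite expr_lt1// ltW.
pose ep := v x0 ^+ 2 * (1 - k ^+ 2) / 3.
have ep0 : 0 < ep by rewrite divr_gt0// mulr_gt0 ?exprn_gt0// subr_gt0.
have ep1 : ep <= 1.
  have : v x0 ^+ 2 * (1 - k ^+ 2) <= 1 * 1.
    apply: ler_pM; rewrite ?exprn_ge0 ?subr_ge0 ?(ltW v0) ?(ltW k2)//.
      by rewrite expr_le1 ?(ltW v0)// spacelike_factor_le1.
    by rewrite gerBl exprn_ge0// ltW.
  rewrite /ep; lra.
have N1 : 0 < N.+1%:R :> R by rewrite ltr0n.
(* Cauchy-Schwarz bounds the sum of the |y_i| in the Taylor estimate by sqrt(N) |y|; N.+1 keeps the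
   divisor positive. *)
pose e := ep / Num.sqrt N.+1%:R.
have e0 : 0 < e by rewrite divr_gt0// sqrtr_gt0.
have [d d0 Hd] := (nbhs_normP _ _).1 (has_grad_taylor x0 (has_grad_u C3u) e0).
exists d => // x xd; set y := x - x0.
have := Hd y; rewrite /= sub0r normrN => /(_ xd).
rewrite [x0 + y]addrC subrK -/(height u x0 x) => T.
have aE : \sum_i y ord0 i * du u x0 i = dotr a y.
  by apply: eq_bigr => i _; rewrite !mxE mulrC.
rewrite aE in T.
have dd : dotr y y = sdot (disp x0 x) (disp x0 x).
  by apply: eq_bigr => i _; rewrite !mxE.
have T2 : (height u x0 x - dotr a y) ^+ 2 <= ep ^+ 2 * dotr y y.
  apply: (@le_trans _ _ ((e * \sum_i `|y ord0 i|) ^+ 2)).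
    rewrite -real_normK ?num_real//; apply: lerXn2r; rewrite ?nnegrE//.
    by rewrite mulr_ge0 ?(ltW e0)// sumr_ge0.
  have CS := sdot_CS (fun=> 1 : R) (fun i => `|y ord0 i|).
  have E1 : sdot (fun=> 1 : R) (fun i => `|y ord0 i|) = \sum_i `|y ord0 i|.
    by apply: eq_bigr => i _; rewrite mul1r.
  have E2 : sdot (fun i => `|y ord0 i|) (fun i => `|y ord0 i|) = dotr y y.
    by apply: eq_bigr => i _; rewrite -!expr2 real_normK ?num_real.
  have E3 : sdot (fun _ : 'I_N => 1 : R) (fun _ : 'I_N => 1 : R) = N%:R.
    rewrite /sdot (eq_bigr (fun=> 1)) => [|i _]; last by rewrite mulr1.
    by rewrite sumr_const card_ord.
  rewrite E1 E2 E3 in CS; rewrite exprMn /e exprMn exprVn sqr_sqrtr ?(ltW N1)//.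
  rewrite -mulrA ler_wpM2l ?sqr_ge0// ler_pdivrMl//; apply: le_trans CS _.
  by rewrite ler_wpM2r ?dotrr_ge0// ler_nat.
have Qy := tangent_form_ge y.
have CS : dotr a y ^+ 2 <= dotr y y.
  have := dotrr_ge0 y; have := exprn_gt0 2 v0 => h1 h2; have := mulr_ge0 (ltW h1) h2; lra.
rewrite /lorentz_sq -dd.
have D0 := dotrr_ge0 y; move: (dotr y y) D0 T2 Qy CS {dd} => D D0 T2 Qy CS.
move: (dotr a y) (height u x0 x) T2 CS Qy {T aE} => A w T2 CS Qy.
have cross : 2 * A * (w - A) <= 2 * ep * D.
  have h1 : 0 <= (ep * A - (w - A)) ^+ 2 by exact: sqr_ge0.
  have h2 : ep ^+ 2 * A ^+ 2 <= ep ^+ 2 * D by rewrite ler_wpM2l ?sqr_ge0.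
  have h3 : ep * (2 * A * (w - A)) <= ep * (2 * ep * D) by lra.
  by move: h3; rewrite ler_pM2l.
have ee : ep ^+ 2 * D <= ep * D.
  by rewrite ler_wpM2r// expr2 ler_piMl// ltW.
have : 3 * ep * D <= (1 - k ^+ 2) * (D - A ^+ 2).
  have := ler_wpM2l (ltW (_ : 0 < 1 - k ^+ 2)) Qy; rewrite subr_gt0 => /(_ k2).
  by rewrite /ep; lra.
lra.
Qed.

(** Only an upper bound is required. For small s the ball K_s lies in the ellipsoid Q < (s/k)^2,
    which costs k^(-N), and h <= h(x0)/k by continuity costs one more factor. *)
Lemma lorentz_ball_mass r (h : 'rV[R]_N -> R) (k : R) :
  0 < r -> bounded_set (K r) -> continuous h -> 0 < h x0 -> 0 < k -> k < 1 ->
  exists2 s0, 0 < s0 <= r & forall s, 0 < s -> s <= s0 ->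
    \int[mu]_(x in K s) h x <=
    k ^- N.+1 * (h x0 * unit_ball_volume R N / v x0) * s ^+ N.
Proof.
move=> r0 bK ch h0 k0 k1; have v0 := spacelike_factor_gt0 u_spacelike x0.
have [d1 d10 H1] := lorentz_sq_ge_tangent k0 k1.
have hk : h x0 < h x0 / k by rewrite ltr_pdivlMr// gtr_pMr.
have [d2 d20 H2] := (nbhs_normP _ _).1 (cvgr_lt _ (ch x0) _ hk).
have H2' x : `|x - x0| < d2 -> h x < h x0 / k.
  by move=> xd; apply: (H2 x); rewrite /= distrC.
have d12 : 0 < Num.min d1 d2 by rewrite lt_min d10.
have [s0 /andP[s00 s0r] Hs0] := @lorentz_ball_shrink _ _ u x0 C3u u_spacelike r _ r0 bK d12.
exists s0 => [|s sp ss0]; first by rewrite s00.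
have mK : measurable (K s) by exact: (@measurable_lorentz_ball _ _ u x0 C3u s).
have bKs : bounded_set (K s).
  have [M HM] := (bounded_setP _).1 bK; apply/bounded_setP; exists M => x Kx.
  by apply: HM; apply: subset_lorentz_ball Kx; exact: le_trans s0r.
have [M HM] := (bounded_setP _).1 bKs.
have near x : K s x -> `|x - x0| < d1 /\ `|x - x0| < d2.
  by move=> Kx; apply/andP; rewrite -lt_min; apply: Hs0; exact: subset_lorentz_ball Kx.
have muK : fine (mu (K s)) <= (s / k) ^+ N * unit_ball_volume R N / v x0.
  have sk : 0 < s / k by exact: divr_gt0.
  rewrite -lee_fin -(lebesgue_tangent_ball sk) fineK; last first.
    by rewrite ge0_fin_numE//; exact: bounded_lebesgue_row HM.
  apply: (@le_measure _ _ _ mu); rewrite ?inE//.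
    exact: measurable_tangent_ball.
  move=> x Kx; have [/H1 h1 _] := near _ Kx.
  rewrite /= expr_div_n ltr_pdivlMr ?exprn_gt0// mulrC; apply: le_lt_trans h1 _.
  move: Kx; rewrite lorentz_ballE /= => Kx.
  rewrite -(sqr_sqrtr (lorentz_sq_ge0 x0 C3u u_spacelike x)).
  by rewrite ltr_pXn2r// ?nnegrE ?sqrtr_ge0// ltW.
have hk0 : 0 <= h x0 / k by rewrite divr_ge0// ltW.
apply: (@le_trans _ _ (\int[mu]_(x in K s) (h x0 / k))).
  apply: le_Rintegral => //; first exact: integrable_bounded_row.
    exact: (integrable_bounded_row (f := cst (h x0 / k)) mK bKs (@cst_continuous _ _ _)).
  by move=> x /near[_ /H2' xd]; exact/ltW.
rewrite Rintegral_cst//; apply: le_trans (ler_wpM2l hk0 muK) _.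
rewrite le_eqVlt; apply/orP; left; apply/eqP.
by rewrite exprS expr_div_n; field; rewrite ?expf_neq0 ?lt0r_neq0.
Qed.

End small_balls.

(** * A Gronwall comparison *)

Lemma cvg_powR {R : realType} {T : Type} (F : set_system T) {FF : Filter F} (f : T -> R) (q l : R) :
  0 < l -> f x @[x --> F] --> l -> f x `^ q @[x --> F] --> l `^ q.
Proof.
move=> l0 fl; have H : {for l, continuous (fun t : R => t `^ q)}.
  apply: differentiable_continuous; apply/derivable1_diffP.
  by have [] := is_derive1_powR q l0.
exact: (@continuous_cvg _ R R _ _ f (fun t => t `^ q) _ H fl).
Qed.

(* The point s is the infimum of the zero superlevel set of D. *)
Lemma first_touch {R : realType} (D : R -> R) (a b s1 : R) :
  {within `[a, b], continuous D} -> D a < 0 -> a <= s1 -> s1 <= b -> 0 <= D s1 ->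
  exists s, [/\ a < s, s <= b, 0 <= D s & forall t, a <= t -> t < s -> D t < 0].
Proof.
move=> cD Da as1 s1b Ds1; pose Z := [set s | (a <= s) && (s <= b) && (0 <= D s)].
have Z1 : Z s1 by rewrite /Z /= as1 s1b Ds1.
have hZ : has_inf Z.
  by split; [exists s1|exists a => s /andP[/andP[]]].
have ai : a <= inf Z by apply: lb_le_inf; [exists s1|move=> s /andP[/andP[]]].
have ib : inf Z <= b.
  by apply: le_trans s1b; apply: ge_inf => //; case: hZ.
have below t : a <= t -> t < inf Z -> D t < 0.
  move=> at_ ti; rewrite ltNge; apply/negP => Dt.
  suff : inf Z <= t by rewrite leNgt ti.
  apply: ge_inf; first by case: hZ.
  by rewrite /Z /= at_ Dt (le_trans (ltW ti) ib).
have Di : 0 <= D (inf Z).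
  rewrite leNgt; apply/negP => Dlt.
  have iab : `[a, b]%classic (inf Z) by rewrite /= in_itv /= ai ib.
  have /subspace_continuousP/(_ _ iab) := cD.
  move=> /cvgr_lt/(_ _ Dlt); rewrite near_withinE => /nbhs_ballP[d /= d0 Hd].
  have [z Zz zd] := inf_adherent d0 hZ.
  have iz : inf Z <= z by apply: ge_inf => //; case: hZ.
  move: Zz => /andP[/andP[az zb] Dz].
  suff : D z < 0 by rewrite ltNge Dz.
  apply: (Hd z); last by rewrite /= in_itv /= az zb.
  rewrite /ball /= distrC ger0_norm ?subr_ge0// ltrBlDl//.
exists (inf Z); split => //.
rewrite lt_neqAle ai andbT; apply/negP => /eqP aE.
by move: Di; rewrite -aE leNgt Da.
Qed.

(** The power may be singular at 0. The intervals [r/(k+2), r] exhaust ]0, r], their integrals are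
    bounded through an explicit primitive, and monotone convergence applies; k+2 makes already the
    first interval nondegenerate. *)
Lemma integrable_powR_itv {R : realType} (a r : R) : -1 < a -> 0 < r ->
  (@lebesgue_measure R).-integrable `[0, r] (EFin \o (fun t => t `^ a)).
Proof.
move=> a1 r0; set mu := @lebesgue_measure R.
have a10 : 0 < a + 1 by lra.
have mp (A : set (measurableTypeR R)) : measurable_fun A ((fun t : R => t `^ a) : _ -> measurableTypeR R).
  exact: measurable_funTS (measurable_powR a).
pose F k : set (measurableTypeR R) := `[r / k.+2%:R, r]%classic.
have mF k : measurable (F k) by exact: measurable_itv.
have rk k : 0 < r / k.+2%:R by rewrite divr_gt0// ltr0n.
have rkr k : r / k.+2%:R < r by rewrite ltr_pdivrMr// ltr_pMr// ltr1n.
have IF k : (\int[mu]_(t in F k) (t `^ a)%:E <= (r `^ (a + 1) / (a + 1))%:E)%E.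
  have cp t : r / k.+2%:R <= t -> {for t, continuous (fun t : R => t `^ a)}.
    move=> tr; have t0 : 0 < t by exact: lt_le_trans tr.
    apply: differentiable_continuous; apply/derivable1_diffP.
    by have [] := is_derive1_powR a t0.
  have ik : mu.-integrable (F k) (EFin \o (fun t => t `^ a)).
    apply: continuous_compact_integrable; first exact: segment_compact.
    apply: continuous_in_subspaceT => t; rewrite inE /F /= in_itv /= => /andP[h _].
    exact: cp.
  rewrite -[leLHS]fineK; last exact: (integrable_fin_num (mF k) ik).
  rewrite lee_fin -/(Rintegral mu (F k) (fun t => t `^ a)).
  apply: (@le_trans _ _ (r `^ (a + 1) / (a + 1) - (r / k.+2%:R) `^ (a + 1) / (a + 1))); last first.
    by rewrite gerBl divr_ge0 ?powR_ge0// ltW.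
  rewrite le_eqVlt; apply/orP; left; apply/eqP.
  apply: (@Rintegral_FTC2 _ (fun t => t `^ a) (fun t => t `^ (a + 1) / (a + 1)) _ _ (rkr k)).
  - move=> t tr _; have t0 : 0 < t by exact: lt_le_trans tr.
    have H := is_derive1_powR (a + 1) t0.
    have D := is_deriveM H (is_derive_cst ((a + 1)^-1 : R) t 1).
    apply: (is_derive_eq D); rewrite scaler0 add0r /GRing.scale /= addrK.
    by field; rewrite lt0r_neq0.
  - by move=> t tr _; exact: cp.
have ndF : nondecreasing_seq F.
  move=> i j ij; apply/subsetPset => t; rewrite /F /= !in_itv /= => /andP[h ->]; rewrite andbT.
  by apply: le_trans h; rewrite ler_pM2l// lef_pV2 ?posrE ?ltr0n// ler_nat.
have UF : \bigcup_k F k = `]0, r]%classic.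
  apply/seteqP; split => t /=.
    move=> [k _]; rewrite /F /= !in_itv /= => /andP[h ->]; rewrite andbT.
    exact: lt_le_trans h.
  rewrite in_itv /= => /andP[t0 tr]; exists (Num.truncn (r / t)) => //.
  rewrite /F /= in_itv /= tr andbT ler_pdivrMr ?ltr0n// mulrC -ler_pdivrMr//.
  apply/ltW/(lt_le_trans (truncnS_gt _)).
  by rewrite ler_nat.
have mE i : measurable_fun (F i) (EFin \o (fun t : R => t `^ a)).
  by apply/measurable_EFinP; exact: mp.
have pE i x : F i x -> (0 <= (x `^ a)%R%:E)%E.
  by rewrite lee_fin powR_ge0.
have C := ge0_nondecreasing_set_cvg_integral (mu := mu) ndF mF mE pE.
rewrite UF in C.
have B : (\int[mu]_(t in `]0%R, r]) (t `^ a)%:E <= (r `^ (a + 1) / (a + 1))%:E)%E.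
  rewrite -(cvg_lim _ C)//; apply: lime_le; first exact: (cvgP _ C).
  by apply: nearW.
apply/integrableP; split; first by apply/measurable_EFinP; exact: mp.
under eq_integral do rewrite gee0_abs ?lee_fin ?powR_ge0//.
rewrite -integral_itv_obnd_cbnd; last by apply/measurable_EFinP; exact: mp.
by apply: le_lt_trans B _; rewrite ltry.
Qed.

Lemma integrable_powR_mul {R : realType} (a p r C : R) (G : R -> R) : -1 < a -> 0 <= p -> 0 < r ->
  (forall s, 0 <= s -> s <= r -> 0 <= G s <= C) ->
  measurable_fun `[0, r] (G : measurableTypeR R -> measurableTypeR R) ->
  (@lebesgue_measure R).-integrable `[0, r] (EFin \o (fun t => t `^ a * G t `^ p)).
Proof.
move=> aN p0 r0 G0 mG; have Ia := integrable_powR_itv aN r0.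
have mf : measurable_fun `[0, r] ((fun t => t `^ a * G t `^ p) : measurableTypeR R -> measurableTypeR R).
  apply: measurable_funM; first exact: measurable_funTS (measurable_powR a).
  exact: (measurableT_comp (measurable_powR p) mG).
have mI : measurable (`[0, r]%classic : set (measurableTypeR R)) by exact: measurable_itv.
apply: (le_integrable mI _ _ (integrableZl_EFin (C `^ p) mI Ia)).
  exact/measurable_EFinP.
move=> t; rewrite /= in_itv /= => /andP[t0 tr]; rewrite lee_fin.
have /andP[g0 gC] := G0 t t0 tr.
rewrite !ger0_norm ?mulr_ge0 ?powR_ge0// mulrC ler_wpM2r ?powR_ge0//.
by rewrite ge0_ler_powR ?nnegrE// (le_trans g0).
Qed.

Lemma lerB_exchange {R : realType} (x1 x2 y1 y2 : R) : x1 - x2 <= y1 - y2 -> x1 - y1 <= x2 - y2.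
Proof. lra. Qed.

Section gronwall.
Context {R : realType}.
Local Notation mu := (@lebesgue_measure R).
Variables (A B w q a1 a2 r C : R) (G : R -> R).
Hypothesis A0 : 0 <= A.
Hypothesis B0 : 0 <= B.
Hypothesis w0 : 0 < w.
Hypothesis q2 : 2 < q.
Hypothesis a1N : -1 < a1.
Hypothesis a2N : -1 < a2.
Hypothesis r0 : 0 < r.
Hypothesis G0 : forall s, 0 <= s -> s <= r -> 0 <= G s <= C.
Hypothesis mG : measurable_fun `[0, r] (G : measurableTypeR R -> measurableTypeR R).

(* [S] of the theorem, with [a1 = 1 - beta] and [a2 = - beta / 2]. *)
Definition bound_fun (s : R) : R :=
  w `^ q^-1 + A * w `^ (- q^-1) / (q * (a1 + 1)) * s `^ (a1 + 1) + B / (q * (a2 + 1)) * s `^ (a2 + 1).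

Let h1 t := t `^ a1 * G t `^ (1 - 2 / q).
Let h2 t := t `^ a2 * G t `^ (1 - 1 / q).

Let q0 : 0 < q. Proof. by apply: lt_trans q2. Qed.
Let a1p : 0 < a1 + 1. Proof. by rewrite -ltrBlDr sub0r. Qed.
Let a2p : 0 < a2 + 1. Proof. by rewrite -ltrBlDr sub0r. Qed.

Let ih a p : -1 < a -> 0 <= p ->
  mu.-integrable `[0, r] (EFin \o (fun t => t `^ a * G t `^ p)).
Proof. by move=> aN p0; exact: (integrable_powR_mul aN p0 r0 G0 mG). Qed.

Lemma bound_fun_ge s : w `^ q^-1 <= bound_fun s.
Proof.
have c1 : 0 <= A * w `^ (- q^-1) / (q * (a1 + 1)).
  by rewrite divr_ge0 ?mulr_ge0 ?powR_ge0 ?(ltW q0) ?(ltW a1p).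
have c2 : 0 <= B / (q * (a2 + 1)).
  by rewrite divr_ge0 ?mulr_ge0 ?(ltW q0) ?(ltW a2p).
have := mulr_ge0 c1 (powR_ge0 s (a1 + 1)); have := mulr_ge0 c2 (powR_ge0 s (a2 + 1)).
rewrite /bound_fun; lra.
Qed.

Lemma bound_fun_gt0 s : 0 < bound_fun s.
Proof. by apply: lt_le_trans (bound_fun_ge s); exact: powR_gt0. Qed.

Hypothesis GH : forall s, 0 < s -> s <= r ->
  G s <= w + A * \int[mu]_(t in `[0, s]) h1 t + B * \int[mu]_(t in `[0, s]) h2 t.

Let exp1 : 0 <= 1 - 2 / q.
Proof. by rewrite subr_ge0 ler_pdivrMr ?mul1r ?(ltW q2) ?q0. Qed.
Let exp2 : 0 <= 1 - 1 / q.
Proof. by rewrite subr_ge0 ler_pdivrMr ?q0// mul1r ltW// (lt_trans _ q2)// ltr1n. Qed.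

(** The comparison is run on this majorant of G, because it is continuous while G is only bounded
    and measurable. *)
Let M s := w + A * \int[mu]_(t in `[0, s]) h1 t + B * \int[mu]_(t in `[0, s]) h2 t.

Let M_cont : {within `[0, r], continuous M}.
Proof.
have c1 := @parameterized_integral_continuous R 0 r h1 (ltW r0) (ih a1N exp1).
have c2 := @parameterized_integral_continuous R 0 r h2 (ltW r0) (ih a2N exp2).
move=> s; apply: cvgD; first apply: cvgD.
- exact: cvg_cst.
- by apply: cvgM; [exact: cvg_cst|exact: c1].
- by apply: cvgM; [exact: cvg_cst|exact: c2].
Qed.

(** The margin m > 0 makes the comparison strict at s = 0, where M equals w = [bound_fun 0 ^ q]; it
    is sent to 0 at the end. *)
Let T (m s : R) := (bound_fun s + m) `^ q.

Let dT (m s : R) := q * (bound_fun s + m) `^ (q - 1) *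
  (A * w `^ (- q^-1) / q * s `^ a1 + B / q * s `^ a2).

Let is_derive_T (m s : R) : 0 <= m -> 0 < s -> is_derive s 1 (T m) (dT m s).
Proof.
move=> m0 s0; have S0 : 0 < bound_fun s + m by have := bound_fun_gt0 s; lra.
have p1 := is_derive1_powR (a1 + 1) s0; have p2 := is_derive1_powR (a2 + 1) s0.
pose c1 := A * w `^ (- q^-1) / (q * (a1 + 1)); pose c2 := B / (q * (a2 + 1)).
have D1 := is_deriveM (is_derive_cst (c1 : R) s 1) p1.
have D2 := is_deriveM (is_derive_cst (c2 : R) s 1) p2.
have DS := is_deriveD (is_deriveD (is_deriveD (is_derive_cst (w `^ q^-1 : R) s 1) D1) D2) (is_derive_cst m s 1).
have DT := @is_derive1_comp R (fun x => x `^ q) (fun s => bound_fun s + m) s _ _ (is_derive1_powR q S0) DS.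
apply: (is_derive_eq DT); rewrite !scaler0 !addr0 add0r /GRing.scale /= !addrK /dT.
rewrite /c1 /c2; field.
by rewrite !lt0r_neq0 ?a1p ?a2p ?q0.
Qed.

Let cont_powR (a s : R) : 0 < s -> {for s, continuous (fun t => t `^ a)}.
Proof.
move=> s0; apply: differentiable_continuous; apply/derivable1_diffP.
by have [] := is_derive1_powR a s0.
Qed.

Lemma continuous_bound_fun (s : R) : 0 < s -> {for s, continuous bound_fun}.
Proof.
move=> s0; apply: cvgD; first apply: cvgD.
- exact: cvg_cst.
- by apply: cvgM; [exact: cvg_cst|exact: cont_powR].
- by apply: cvgM; [exact: cvg_cst|exact: cont_powR].
Qed.


Let cont_dT (m s : R) : 0 <= m -> 0 < s -> {for s, continuous (dT m)}.
Proof.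
move=> m0 s0; have S0 : 0 < bound_fun s + m by have := bound_fun_gt0 s; lra.
have cS : {for s, continuous (fun s => bound_fun s + m)}.
  by apply: cvgD; [exact: continuous_bound_fun|exact: cvg_cst].
have cSq : {for s, continuous (fun s => (bound_fun s + m) `^ (q - 1))}.
  apply: (@continuous_comp _ _ _ (fun s => bound_fun s + m) (fun t => t `^ (q - 1))) => //.
  exact: cont_powR.
apply: cvgM; first by apply: cvgM; [exact: cvg_cst|exact: cSq].
by apply: cvgD; apply: cvgM; [exact: cvg_cst|exact: cont_powR|exact: cvg_cst|exact: cont_powR].
Qed.

Let T_cont (m : R) : 0 <= m -> {within `[0, r], continuous (T m)}.
Proof.
move=> m0; have cT (s : R) : 0 < s -> {for s, continuous (T m)}.
  move=> s0; apply: differentiable_continuous; apply/derivable1_diffP.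
  by have [] := is_derive_T m0 s0.
apply/continuous_within_itvP => //; split.
- by move=> s; rewrite in_itv /= => /andP[s0 _]; exact: cT.
- have S0 : 0 < bound_fun 0 + m by have := bound_fun_gt0 0; move: m0; lra.
  have cS : bound_fun s + m @[s --> 0^'+] --> bound_fun 0 + m.
    apply: cvgD; last exact: cvg_cst.
    apply: cvgD; first apply: cvgD.
    + exact: cvg_cst.
    + apply: cvgM; first exact: cvg_cst.
      by rewrite powR0 ?lt0r_neq0//; exact: powR_cvg0.
    + apply: cvgM; first exact: cvg_cst.
      by rewrite powR0 ?lt0r_neq0//; exact: powR_cvg0.
  exact: (@cvg_powR _ _ _ _ _ q _ S0 cS).
- by apply: cvg_at_left_filter; apply: cT.
Qed.

(** The origin of the coefficients of [bound_fun]. If G <= S^q, the integrands involve S^(q-2) and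
    S^(q-1); since S >= w^(1/q), the former is at most w^(-1/q) S^(q-1). The common factor S^(q-1)
    then cancels against (S^q)' = q S^(q-1) S', and S' becomes an explicit sum of powers. *)
Let h_le_dT (m t : R) : 0 < m -> 0 < t -> t <= r -> G t <= T m t ->
  A * h1 t + B * h2 t <= dT m t.
Proof.
move=> m0 t0 tr GT; have S0 := bound_fun_gt0 t; have Sw := bound_fun_ge t.
have S1 : 0 < bound_fun t + m by lra.
have /andP[g0 _] := G0 (ltW t0) tr.
set S := bound_fun t + m in S1 *.
have e1 : G t `^ (1 - 2 / q) <= S `^ (q - 2).
  apply: (@le_trans _ _ (T m t `^ (1 - 2 / q))).
    by apply: ge0_ler_powR; rewrite ?nnegrE ?powR_ge0.
  rewrite /T -powRrM -/S (_ : q * (1 - 2 / q) = q - 2)//.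
  by field; rewrite lt0r_neq0.
have e2 : G t `^ (1 - 1 / q) <= S `^ (q - 1).
  apply: (@le_trans _ _ (T m t `^ (1 - 1 / q))).
    by apply: ge0_ler_powR; rewrite ?nnegrE ?powR_ge0.
  rewrite /T -powRrM -/S (_ : q * (1 - 1 / q) = q - 1)//.
  by field; rewrite lt0r_neq0.
have wS : w `^ q^-1 <= S by rewrite /S; move: Sw m0; lra.
have e3 : S `^ (q - 2) <= S `^ (q - 1) * w `^ (- q^-1).
  have -> : S `^ (q - 1) = S `^ (q - 2) * S.
    rewrite -[X in _ * X]powRr1 ?(ltW S1)// -powRD ?(lt0r_neq0 S1) ?implybT//.
    by congr (_ `^ _); ring.
  rewrite -mulrA ler_peMr ?powR_ge0// powRN ler_pdivlMr ?powR_gt0//.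
  by rewrite mul1r.
rewrite /dT -/S.
have k1 : A * h1 t <= A * (t `^ a1 * (S `^ (q - 1) * w `^ (- q^-1))).
  by rewrite ler_wpM2l// ler_wpM2l ?powR_ge0// (le_trans e1).
have k2 : B * h2 t <= B * (t `^ a2 * S `^ (q - 1)).
  by rewrite ler_wpM2l// ler_wpM2l ?powR_ge0.
apply: le_trans (lerD k1 k2) _; rewrite le_eqVlt; apply/orP; left; apply/eqP.
by field; rewrite lt0r_neq0.
Qed.

(** At the first point s' where M reaches T one has G <= M < T before s', so [h_le_dT] integrated up
    to s' shows that M - T does not increase. It was negative at the left end, hence cannot be
    nonnegative at s'. *)
Let M_lt_T (m s : R) : 0 < m -> 0 <= s -> s <= r -> M s < T m s.
Proof.
move=> m0 s0 sr; rewrite ltNge; apply/negP => TM.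
pose D t := M t - T m t.
have cD : {within `[0, r], continuous D}.
  by move=> x; apply: cvgB; [exact: M_cont|exact: (T_cont (ltW m0))].
have D0 : D 0 < 0.
  rewrite /D subr_lt0 /M set_itv1 !Rintegral_set1 !mulr0 !addr0 /T /bound_fun.
  rewrite !powR0 ?lt0r_neq0 ?a1p ?a2p// !mulr0 !addr0.
  rewrite -[X in X < _](@powRr1 _ w) ?(ltW w0)// -[X in w `^ X](@mulVf _ q) ?lt0r_neq0// powRrM.
  by rewrite gt0_ltr_powR ?nnegrE ?powR_ge0 ?addr_ge0 ?powR_ge0 ?(ltW m0)// ltrDl.
have Ds : 0 <= D s by rewrite subr_ge0.
have [s' [s'0 s'r Ds' below]] := first_touch cD D0 s0 sr Ds.
(* Starting at s'/2 and not at 0 keeps [dT], which has powers with possibly negative exponents,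
   continuous on the interval. *)
pose a := s' / 2; have a0 : 0 < a by rewrite divr_gt0.
have as' : a < s' by rewrite ltr_pdivrMr// ltr_pMr// ltr1n.
suff : D s' <= D a by move=> /(le_trans Ds'); rewrite leNgt below// ltW.
have mI0 : measurable (`[0, r]%classic : set (measurableTypeR R)) by exact: measurable_itv.
have mI : measurable (`[a, s']%classic : set (measurableTypeR R)) by exact: measurable_itv.
have mI' : measurable (`[a, s'[%classic : set (measurableTypeR R)) by exact: measurable_itv.
have sub : `[a, s']%classic `<=` (`[0, r]%classic : set (measurableTypeR R)).
  move=> t; rewrite /= !in_itv /= => /andP[t1 t2].
  by rewrite (le_trans (ltW a0) t1) (le_trans t2 s'r).
have inc h : mu.-integrable `[0, r] (EFin \o h) ->
    mu.-integrable `[a, s'] (EFin \o h) /\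
    \int[mu]_(t in `[0, s']) h t - \int[mu]_(t in `[0, a]) h t = \int[mu]_(t in `[a, s']) h t.
  move=> ih0; have iI := integrableS mI0 mI sub ih0; split => //.
  rewrite (@Rintegral_itvB _ h (BLeft 0) (BRight s') a) ?bnd_simp ?ltW//.
    apply: Rintegral_itv_obnd_cbnd; apply: integrableS iI => //; exact: subset_itv_oc_cc.
  apply: integrableS ih0 => //; apply: subset_itvl; by rewrite bnd_simp.
have [i1 E1] := inc h1 (ih a1N exp1); have [i2 E2] := inc h2 (ih a2N exp2).
have [i3 E3] := @Rintegral_comb _ _ _ mu _ A B h1 h2 mI i1 i2.
have {E1 E2} EM : M s' - M a = A * \int[mu]_(t in `[a, s']) h1 t + B * \int[mu]_(t in `[a, s']) h2 t.
  rewrite -E1 -E2 /M.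
  move: (\int[mu]_(t in `[0, s']) h1 t) (\int[mu]_(t in `[0, a]) h1 t) => x1 x2.
  move: (\int[mu]_(t in `[0, s']) h2 t) (\int[mu]_(t in `[0, a]) h2 t) => y1 y2.
  ring.
have cdT t : a <= t -> t <= s' -> {for t, continuous (dT m)}.
  by move=> t1 _; apply: cont_dT; [exact: ltW|exact: lt_le_trans t1].
have i4 : mu.-integrable `[a, s'] (EFin \o dT m).
  apply: continuous_compact_integrable; first exact: segment_compact.
  by apply: continuous_in_subspaceT => t; rewrite inE /= in_itv /= => /andP[t1 t2]; exact: cdT.
have FT : \int[mu]_(t in `[a, s']) dT m t = T m s' - T m a.
  apply: Rintegral_FTC2 => // t t1 t2.
  by apply: is_derive_T; [exact: ltW|exact: lt_le_trans t1].
have oc h : mu.-integrable `[a, s'] (EFin \o h) -> mu.-integrable `[a, s'[ (EFin \o h).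
  by move=> H; apply: integrableS H => //; exact: subset_itv_co_cc.
suff : \int[mu]_(t in `[a, s']) (A * h1 t + B * h2 t) <= \int[mu]_(t in `[a, s']) dT m t.
  rewrite E3 -EM FT /D.
  exact: lerB_exchange.
rewrite -(Rintegral_itv_bndo_bndc (oc _ i3)) -(Rintegral_itv_bndo_bndc (oc _ i4)).
apply: le_Rintegral => //; [exact: oc|exact: oc|].
move=> t; rewrite /= in_itv /= => /andP[t1 t2].
have t0 : 0 < t by exact: lt_le_trans t1.
have tr : t <= r by rewrite (le_trans (ltW t2)).
apply: h_le_dT => //; apply: (le_trans (GH t0 tr)).
by have := below t (ltW t0) t2; rewrite /D subr_lt0 => /ltW.
Qed.

Lemma gronwall (s : R) : 0 < s -> s <= r -> G s <= bound_fun s `^ q.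
Proof.
move=> s0 sr; have S0 := bound_fun_gt0 s.
have H m : 0 < m -> G s <= (bound_fun s + m) `^ q.
  move=> m0; apply: le_trans (GH s0 sr) _; apply/ltW.
  exact: (M_lt_T m0 (ltW s0) sr).
have c : (bound_fun s + m) `^ q @[m --> 0^'+] --> bound_fun s `^ q.
  have cS : bound_fun s + m @[m --> (0 : R)^'+] --> bound_fun s.
    rewrite -[X in _ --> X]addr0; apply: cvgD; first exact: cvg_cst.
    exact: cvg_at_right_filter.
  exact: (@cvg_powR _ _ _ _ _ q _ S0 cS).
rewrite -(cvg_lim _ c)//; apply: limr_ge; first exact: (cvgP _ c).
by near=> m; apply: H.
Unshelve. all: by end_near. Qed.

Lemma bound_fun_le (s : R) : 0 <= s -> s <= r -> bound_fun s <= bound_fun r.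
Proof.
move=> s0 sr; have H a : 0 < a -> s `^ a <= r `^ a.
  by move=> a0; rewrite ge0_ler_powR ?nnegrE ?(ltW a0) ?(ltW r0).
rewrite /bound_fun lerD// ?lerD2l ler_wpM2l ?H//.
- by rewrite divr_ge0 ?mulr_ge0 ?powR_ge0 ?(ltW q0) ?(ltW a1p).
- by rewrite divr_ge0 ?mulr_ge0 ?(ltW q0) ?(ltW a2p).
Qed.

Lemma integrable_bound_fun (a p : R) : -1 < a -> 0 <= p ->
  mu.-integrable `[0, r] (EFin \o (fun t => t `^ a * bound_fun t `^ p)).
Proof.
move=> aN p0; apply: (integrable_powR_mul (C := bound_fun r) aN p0 r0) => [s s0 sr|].
  by rewrite (ltW (bound_fun_gt0 s)) bound_fun_le.
apply: measurable_funTS; apply: measurable_funD; first apply: measurable_funD => //.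
- by apply: measurable_funM => //; exact: measurable_powR.
- by apply: measurable_funM => //; exact: measurable_powR.
Qed.

Hypothesis Gz : G 0 = 0.

Lemma gronwall_integral :
  A * \int[mu]_(t in `[0, r]) h1 t + B * \int[mu]_(t in `[0, r]) h2 t <=
  A * \int[mu]_(t in `[0, r]) (t `^ a1 * bound_fun t `^ (q - 2)) +
  B * \int[mu]_(t in `[0, r]) (t `^ a2 * bound_fun t `^ (q - 1)).
Proof.
have q1 : 1 < q by apply: lt_trans q2; rewrite ltr1n.
have q20 : 0 <= q - 2 by rewrite subr_ge0 ltW.
have q10 : 0 <= q - 1 by rewrite subr_ge0 ltW.
have mI : measurable (`[0, r]%classic : set (measurableTypeR R)) by exact: measurable_itv.
have GS t : 0 <= t -> t <= r -> G t <= bound_fun t `^ q.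
  rewrite le_eqVlt => /predU1P[<- _|t0 tr]; last exact: gronwall.
  by rewrite Gz powR_ge0.
have key a c t : 0 <= t -> t <= r -> 0 <= c -> c <= q ->
    t `^ a * G t `^ (1 - c / q) <= t `^ a * bound_fun t `^ (q - c).
  move=> t0 tr c0 cq; have /andP[g0 _] := G0 t0 tr.
  rewrite ler_wpM2l ?powR_ge0//; apply: (@le_trans _ _ ((bound_fun t `^ q) `^ (1 - c / q))).
    by rewrite ge0_ler_powR ?nnegrE ?powR_ge0 ?GS// subr_ge0 ler_pdivrMr ?q0// mul1r.
  rewrite -powRrM (_ : q * (1 - c / q) = q - c)//.
  by field; rewrite lt0r_neq0 ?q0.
have I1 : mu.-integrable `[0, r] (EFin \o h1) by exact: ih.
have I2 : mu.-integrable `[0, r] (EFin \o h2) by exact: ih.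
apply: lerD; apply: ler_wpM2l; [exact: A0| |exact: B0|].
  apply: (le_Rintegral mI I1 (integrable_bound_fun a1N q20)) => t.
  by rewrite /= in_itv /= => /andP[t0 tr]; apply: (key _ _ _ t0 tr); [|exact: ltW].
apply: (le_Rintegral mI I2 (integrable_bound_fun a2N q10)) => t.
by rewrite /= in_itv /= => /andP[t0 tr]; apply: (key _ _ _ t0 tr); [|exact: ltW].
Qed.

End gronwall.

(** * The mean value inequality *)

Section mean_value.
Context {R : realType} {m : nat}.
Local Notation N := m.+1.
Variables (u rho : 'rV[R]_N -> R) (x0 : 'rV[R]_N).
Hypothesis N3 : (2 < N)%N.
Hypothesis C3u : Ck 3 u.
Hypothesis u_spacelike : forall x, enorm (grad u x) < 1.
Hypothesis C1rho : Ck 1 rho.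
Hypothesis u_eq : mean_curvature_eq u rho.
Local Notation v := (spacelike_factor u).
Local Notation ell := (lorentz_sq u x0).
Local Notation sig := (sigma u x0).
Local Notation mu := (lebesgue_row R N).
Local Notation leb := (@lebesgue_measure R).
Local Notation K := (lorentz_ball u x0).
Variables (g r q : R).
Hypothesis g0 : 0 < g.
Hypothesis gM : g <= (16 * m%:R)^-1.
Hypothesis r0 : 0 < r.
Hypothesis bK : bounded_set (K r).
Hypothesis Nq : N%:R < q.

Let mK s : measurable (K s). Proof. exact: measurable_lorentz_ball. Qed.

Let bKs s : s <= r -> bounded_set (K s).
Proof.
move=> sr; have [M HM] := (bounded_setP _).1 bK; apply/bounded_setP; exists M => x Kx.
by apply: HM; exact: subset_lorentz_ball Kx.
Qed.

Let iK s (f : 'rV[R]_N -> R) : s <= r -> continuous f -> mu.-integrable (K s) (EFin \o f).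
Proof. by move=> sr cf; apply: integrable_bounded_row => //; exact: bKs. Qed.

(** Monotonicity in the radius gives measurability; truncating the radius at r keeps all integrals
    finite, so that the monotone function is defined on the whole line. *)
Lemma measurable_ball_integral (f : 'rV[R]_N -> R) : continuous f -> (forall x, 0 <= f x) ->
  measurable_fun `[0, r] ((fun t => \int[mu]_(x in K t) f x) : measurableTypeR R -> measurableTypeR R).
Proof.
move=> cf f0; pose F t := \int[mu]_(x in K (Num.min t r)) f x.
apply: (@eq_measurable_fun _ _ _ _ _ (F : measurableTypeR R -> measurableTypeR R)).
  by move=> t; rewrite inE /= in_itv /= => /andP[_ tr]; rewrite /F min_l.
apply: nondecreasing_measurable; first exact: measurable_itv.
move=> s t st; apply: ge0_subset_Rintegral => //.
- by apply: subset_lorentz_ball; rewrite le_min !ge_min st lexx orbT.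
- by apply: iK; rewrite // ge_min lexx orbT.
Qed.

(** By the layer-cake formula the left side is the integral over t of [cutpow kap k t] times the
    integral of f over K_t. Since kap <= 1 the cutoff is then dropped, so the bound does not depend
    on the inner radii, which can tend to 0. *)
Lemma weight_layer_le (kap : R -> R) (e s : R) (k : nat) (f : 'rV[R]_N -> R) (h : R -> R) :
  0 < e -> continuous kap -> (forall t, 0 <= kap t <= 1) -> (forall t, t <= e -> kap t = 0) ->
  0 < s -> s <= r -> continuous f -> (forall x, 0 <= f x) ->
  leb.-integrable `[0, s] (EFin \o h) -> (forall t, 0 <= t -> t <= s -> 0 <= h t) ->
  (forall t, 0 < t -> t <= s -> t ^- k * \int[mu]_(x in K t) f x <= h t) ->
  \int[mu]_(x in K s) (f x * weight kap s k (ell x)) <= \int[leb]_(t in `[0, s]) h t.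
Proof.
move=> e0 kc k01 ke s0 sr cf f0 ih h0 hle.
have wk0 t : 0 <= cutpow kap k t.
  have [te|et] := leP t e; first by rewrite /cutpow ke// mul0r.
  apply: mulr_ge0; first by case/andP: (k01 t).
  by rewrite invr_ge0 exprn_ge0// (le_trans (ltW e0))// ltW.
have cwk : continuous (cutpow kap k) by exact: (cutpow_cont e0 kc ke).
have mwk : measurable_fun setT (cutpow kap k : measurableTypeR R -> measurableTypeR R).
  exact: continuous_measurable_fun.
have cL := @continuous_sqrt_lorentz _ _ u x0 C3u.
have mL : measurable_fun setT ((fun x => Num.sqrt (ell x)) : 'rV[R]_N -> measurableTypeR R).
  exact: (@continuous_measurable_row _ _ _ cL).
have mf : measurable_fun setT (f : 'rV[R]_N -> measurableTypeR R).
  exact: (@continuous_measurable_row _ _ _ cf).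
have mI : measurable (`[0, s]%classic : set (measurableTypeR R)) by exact: measurable_itv.
suff H : (\int[mu]_(x in K s) (f x * weight kap s k (ell x))%:E <= (\int[leb]_(t in `[0, s]) h t)%R%:E)%E.
  rewrite -lee_fin /Rintegral fineK// ge0_fin_numE ?(le_lt_trans H) ?ltry//.
  by apply: integral_ge0 => x _; rewrite lee_fin mulr_ge0// weight_ge0// => t; case/andP: (k01 t).
have -> : (\int[mu]_(x in K s) (f x * weight kap s k (ell x))%:E =
    \int[mu]_x \int[leb]_(t in `]Num.sqrt (ell x), s]) (f x * cutpow kap k t)%:E)%E.
  rewrite integral_mkcond; apply: eq_integral => x _; rewrite patchE mem_lorentz_ball.
  have [Ls|sL] := ltP (Num.sqrt (ell x)) s; last first.
    by rewrite set_itv_ge ?integral_set0// bnd_simp -leNgt.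
  have mJ : measurable (`]Num.sqrt (ell x), s]%classic : set (measurableTypeR R)) by exact: measurable_itv.
  have iw : leb.-integrable `]Num.sqrt (ell x), s] (EFin \o cutpow kap k).
    by apply: (cutpow_intS e0 kc ke k mJ); exact: subset_itv_oc_cc.
  rewrite /weight -RintegralZl// EFin_Rintegral//; exact: integrableZl_EFin.
rewrite (layer_cake mu s mL mf mwk f0 wk0).
have LK t : [set x | Num.sqrt (ell x) < t] = K t by rewrite lorentz_ballE.
under eq_integral do rewrite LK.
have -> : (\int[leb]_(t in `]-oo, s]) \int[mu]_(x in K t) (f x * cutpow kap k t)%:E =
    \int[leb]_(t in `[0%R, s]) (cutpow kap k t * \int[mu]_(x in K t) f x)%R%:E)%E.
  rewrite integral_mkcond [RHS]integral_mkcond; apply: eq_integral => t _; rewrite !patchE.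
  have -> : (t \in [set` `]-oo, s]]) = (t <= s) by rewrite mem_setE in_itv.
  have -> : (t \in [set` `[0%R, s]]) = (0 <= t) && (t <= s) by rewrite mem_setE in_itv.
  have [ts|ts] := leP t s; last by rewrite andbF.
  have [t0|t0] := leP 0 t; last first.
    transitivity (0 : \bar R); last by [].
    apply: integral0_eq => x Kx; rewrite /cutpow ke ?mul0r ?mulr0//.
    by rewrite (le_trans (ltW t0))// ltW.
  have iF := iK (le_trans ts sr) cf.
  transitivity ((cutpow kap k t * \int[mu]_(x in K t) f x)%:E); last by [].
  rewrite -(RintegralZl _ (mK t) iF) EFin_Rintegral//; last exact: integrableZl_EFin.
  by apply: eq_integral => x _; rewrite mulrC.
rewrite EFin_Rintegral//; apply: ge0_le_integral => //.
- move=> t; rewrite /= in_itv /= => /andP[t0 _].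
  by rewrite lee_fin mulr_ge0// Rintegral_ge0.
- apply/measurable_EFinP; apply: measurable_funM; first exact: measurable_funTS.
  apply: measurable_funS (measurable_ball_integral cf f0); first exact: measurable_itv.
  by apply: subset_itvl; rewrite bnd_simp.
- exact: measurable_int ih.
move=> t; rewrite /= in_itv /= => /andP[t0 ts]; rewrite lee_fin.
move: t0; rewrite le_eqVlt => /predU1P[<-|t0].
  by rewrite /cutpow ke ?(ltW e0)// !mul0r h0// ltW.
apply: le_trans (hle t t0 ts); rewrite ler_wpM2r ?Rintegral_ge0//.
rewrite /cutpow ler_piMl ?invr_ge0 ?exprn_ge0 ?(ltW t0)//; by case/andP: (k01 t).
Qed.

Local Notation P := (Lq_norm q (K r) rho).

Let q0 : 0 < q. Proof. by apply: lt_trans Nq; rewrite ltr0n. Qed.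
Let q2 : 2 < q. Proof. by apply: lt_trans Nq; rewrite ltr_nat. Qed.

Let rhoc : continuous rho. Proof. by have [] := C1rho. Qed.

Let cpow a : continuous (fun x => v x `^ a).
Proof. by have [] := has_grad_powR_spacelike C3u u_spacelike a. Qed.

Let cM (f h : 'rV[R]_N -> R) : continuous f -> continuous h -> continuous (fun x => f x * h x).
Proof. by move=> cf ch x; exact: (cvgM (cf x) (ch x)). Qed.

Let cA (f : 'rV[R]_N -> R) : continuous f -> continuous (fun x => `|f x|).
Proof. by move=> cf x; exact: (cvg_norm (cf x)). Qed.

Let irho : mu.-integrable (K r) (EFin \o (fun x => `|rho x| `^ q)).
Proof.
have [C HC] := continuous_bounded_row bK rhoc.
have [M HM] := (bounded_setP _).1 bK.
apply: measurable_bounded_integrable => //.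
- exact: bounded_lebesgue_row HM.
- apply: measurable_funTS; apply: (measurableT_comp (measurable_powR q)).
  by apply: measurableT_comp => //; exact: continuous_measurable_row.
- exists (C `^ q); split; rewrite ?num_real // => y Cy x Kx /=; rewrite (le_trans _ (ltW Cy))//.
  rewrite ger0_norm ?powR_ge0// ge0_ler_powR ?nnegrE ?(ltW q0)//; last exact: HC.
  exact: le_trans (HC _ Kx).
Qed.

Lemma Lq_normE : P = (\int[mu]_(x in K r) (`|rho x| `^ q)) `^ q^-1.
Proof.
rewrite /Lq_norm (_ : EFin \o (rho \_ (K r)) = EFin \o (fun x => rho x * (x \in K r)%:R)).
  by rewrite (Rintegral_Lnorm q0).
by apply/funext => x; rewrite /= patchE; case: ifP => _; rewrite ?mulr1 ?mulr0.
Qed.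

Lemma Lq_norm_ge0 : 0 <= P. Proof. by rewrite Lq_normE powR_ge0. Qed.

Let vg01 x : 0 <= v x `^ (g + 1) <= 1.
Proof.
rewrite powR_ge0 /=; apply: (@le_trans _ _ (1 `^ (g + 1))); last by rewrite powR1.
rewrite ge0_ler_powR ?nnegrE ?(ltW (spacelike_factor_gt0 u_spacelike x)) ?spacelike_factor_le1//.
by rewrite addr_ge0// ltW.
Qed.

Lemma ball_hoelder1 s : s <= r ->
  \int[mu]_(x in K s) (v x `^ (g + 1) * `|rho x|) <=
  P * (\int[mu]_(x in K s) v x `^ (g + 1)) `^ (1 - 1 / q).
Proof.
move=> sr; have q1 : 1 < q by apply: lt_trans q2; rewrite ltr1n.
have qm : 0 < q - 1 by rewrite subr_gt0.
under eq_Rintegral do rewrite mulrC.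
have -> : 1 - 1 / q = (q / (q - 1))^-1 by field; rewrite !lt0r_neq0.
rewrite Lq_normE; apply: hoelder_weight => //.
- exact: subset_lorentz_ball.
- exact: continuous_measurable_row.
- by apply: continuous_measurable_row; exact: cpow.
- exact: divr_gt0.
- by field; rewrite !lt0r_neq0.
- by apply: iK => //; exact: cpow.
Qed.

(** Hoelder is applied to rho^2 with exponent q/2, which exceeds 1 because q > N >= 3. *)
Lemma ball_hoelder2 s : s <= r ->
  \int[mu]_(x in K s) (v x `^ (g + 1) * rho x ^+ 2) <=
  P ^+ 2 * (\int[mu]_(x in K s) v x `^ (g + 1)) `^ (1 - 2 / q).
Proof.
move=> sr; have q1 : 1 < q by apply: lt_trans q2; rewrite ltr1n.
have qm : 0 < q - 2 by rewrite subr_gt0.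
have E x : `|rho x ^+ 2| `^ (q / 2) = `|rho x| `^ q.
  rewrite normrX -powR_mulrn// -powRrM; congr (_ `^ _); by field.
have P2 : P ^+ 2 = (\int[mu]_(x in K r) (`|rho x ^+ 2| `^ (q / 2))) `^ (q / 2)^-1.
  under eq_Rintegral do rewrite E.
  rewrite Lq_normE -powR_mulrn ?powR_ge0// -powRrM; congr (_ `^ _); field.
  by rewrite lt0r_neq0.
have -> : \int[mu]_(x in K s) (v x `^ (g + 1) * rho x ^+ 2) =
    \int[mu]_(x in K s) (`|rho x ^+ 2| * v x `^ (g + 1)).
  by apply: eq_Rintegral => x _; rewrite mulrC ger0_norm// sqr_ge0.
have -> : 1 - 2 / q = (q / (q - 2))^-1 by field; rewrite !lt0r_neq0.
rewrite P2; apply: hoelder_weight => //.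
- exact: subset_lorentz_ball.
- by apply: continuous_measurable_row; apply: cM.
- by apply: continuous_measurable_row; exact: cpow.
- exact: divr_gt0.
- exact: divr_gt0.
- by field; rewrite !lt0r_neq0.
- by rewrite (_ : (fun x => _) = fun x => `|rho x| `^ q)//; apply/funext => x; exact: E.
- by apply: iK => //; exact: cpow.
Qed.

Local Notation beta := (2 * N%:R / q).

Definition ball_mean (s : R) : R := s ^- N * \int[mu]_(x in K s) v x `^ (g + 1).

Lemma ball_mean_ge0 s : 0 <= s -> 0 <= ball_mean s.
Proof.
move=> s0; rewrite mulr_ge0 ?invr_ge0 ?exprn_ge0// Rintegral_ge0// => x _.
exact: powR_ge0.
Qed.

Lemma ball_meanM s : 0 < s -> \int[mu]_(x in K s) v x `^ (g + 1) = s ^+ N * ball_mean s.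
Proof. by move=> s0; rewrite /ball_mean mulrA divff ?mul1r// expf_neq0// lt0r_neq0. Qed.

(** Bookkeeping of exponents: -(N-1) + N (1 - 2/q) = 1 - beta and -N + N (1 - 1/q) = - beta/2. *)
Let scaling (k : nat) (a p s G : R) : 0 < s -> 0 <= G -> - k%:R + N%:R * p = a ->
  s ^- k * (s ^+ N * G) `^ p = s `^ a * G `^ p.
Proof.
move=> s0 G1 <-; rewrite powRM ?exprn_ge0 ?(ltW s0)// mulrA; congr (_ * _).
rewrite powRD ?(lt0r_neq0 s0) ?implybT// powRN powR_mulrn ?(ltW s0)// powRrM.
by rewrite powR_mulrn ?(ltW s0).
Qed.

Lemma ball_bound2 s : 0 < s -> s <= r ->
  s ^- m * \int[mu]_(x in K s) (v x `^ (g + 1) * rho x ^+ 2) <=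
  P ^+ 2 * (s `^ (1 - beta) * ball_mean s `^ (1 - 2 / q)).
Proof.
move=> s0 sr; rewrite -(@scaling m) ?ball_mean_ge0 ?(ltW s0)//; last first.
  by rewrite -natr1; field; rewrite lt0r_neq0.
rewrite mulrCA ler_wpM2l ?invr_ge0 ?exprn_ge0 ?(ltW s0)//.
by rewrite -ball_meanM//; exact: ball_hoelder2.
Qed.

Lemma ball_bound1 s : 0 < s -> s <= r ->
  s ^- N * \int[mu]_(x in K s) (v x `^ (g + 1) * `|rho x|) <=
  P * (s `^ (- (beta / 2)) * ball_mean s `^ (1 - 1 / q)).
Proof.
move=> s0 sr; rewrite -(@scaling N) ?ball_mean_ge0 ?(ltW s0)//; last first.
  by field; rewrite lt0r_neq0.
rewrite mulrCA ler_wpM2l ?invr_ge0 ?exprn_ge0 ?(ltW s0)//.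
by rewrite -ball_meanM//; exact: ball_hoelder1.
Qed.

Lemma measurable_ball_mean :
  measurable_fun `[0, r] (ball_mean : measurableTypeR R -> measurableTypeR R).
Proof.
apply: measurable_funM; last first.
  by apply: measurable_ball_integral => [|x]; [exact: cpow|exact: powR_ge0].
apply: (@eq_measurable_fun _ _ _ _ _ ((fun s => s `^ (- N%:R)) : measurableTypeR R -> measurableTypeR R)).
  by move=> s; rewrite inE /= in_itv /= => /andP[s0 _]; rewrite powR_invn.
exact: measurable_funTS (measurable_powR _).
Qed.

(** Near 0 the volume estimate for small balls with k = 1/2 bounds the mean; beyond [s0] the total
    integral over K_r divided by s0^N does. The Gronwall argument takes its integrability from this
    bound. *)
Lemma ball_mean_bounded : exists C, forall s, 0 <= s -> s <= r -> 0 <= ball_mean s <= C.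
Proof.
have v0 := spacelike_factor_gt0 u_spacelike x0.
have h0 : 0 < v x0 `^ (g + 1) by exact: powR_gt0.
have k0 : 0 < 1 / 2 :> R by rewrite divr_gt0.
have k1 : 1 / 2 < 1 :> R by rewrite ltr_pdivrMr// mul1r ltr1n.
have [s0 /andP[s00 s0r] Hs0] :=
  @lorentz_ball_mass _ _ u x0 C3u u_spacelike r _ (1 / 2) r0 bK (@cpow (g + 1)) h0 k0 k1.
set D := (1 / 2) ^- N.+1 * _ in Hs0.
have D0 : 0 <= D.
  rewrite /D !mulr_ge0 ?invr_ge0 ?exprn_ge0 ?(ltW v0) ?(ltW k0) ?(ltW h0)//.
  exact/ltW/unit_ball_volume_gt0.
pose F := \int[mu]_(x in K r) v x `^ (g + 1).
have F0 : 0 <= F by apply: Rintegral_ge0 => x _; exact: powR_ge0.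
exists (D + s0 ^- N * F) => s sp sr; rewrite ball_mean_ge0//=.
have sF : 0 <= s0 ^- N * F by rewrite mulr_ge0// invr_ge0 exprn_ge0// ltW.
have [->|s1] := eqVneq s 0.
  by rewrite /ball_mean expr0n /= invr0 mul0r addr_ge0.
have s2 : 0 < s by rewrite lt0r s1.
have [ss0|ss0] := leP s s0.
  apply: ler_wpDr => //; rewrite /ball_mean ler_pdivrMl ?exprn_gt0// mulrC.
  exact: Hs0.
apply: ler_wpDl => //; rewrite /ball_mean; apply: ler_pM.
- by rewrite invr_ge0 exprn_ge0.
- by apply: Rintegral_ge0 => x _; exact: powR_ge0.
- rewrite lef_pV2 ?posrE ?exprn_gt0//; apply: lerXn2r; rewrite ?nnegrE ?(ltW s00)//; exact: ltW.
apply: ge0_subset_Rintegral; [exact: mK|exact: mK|exact: subset_lorentz_ball| |].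
  by apply: iK => //; exact: cpow.
by move=> x _; exact: powR_ge0.
Qed.

Let q1 : 1 < q. Proof. by apply: lt_trans q2; rewrite ltr1n. Qed.

Lemma beta_lt2 : beta < 2.
Proof. by rewrite ltr_pdivrMr ?q0// ltr_pM2l. Qed.

Let a1N : -1 < 1 - beta. Proof. by have := beta_lt2; lra. Qed.
Let a2N : -1 < - (beta / 2). Proof. by have := beta_lt2; lra. Qed.
Let p1 : 0 <= 1 - 2 / q. Proof. by rewrite subr_ge0 ler_pdivrMr ?q0// mul1r ltW. Qed.
Let p2 : 0 <= 1 - 1 / q. Proof. by rewrite subr_ge0 ler_pdivrMr ?q0// mul1r ltW. Qed.

Let ibm a p s : s <= r -> -1 < a -> 0 <= p ->
  leb.-integrable `[0, s] (EFin \o (fun t => t `^ a * ball_mean t `^ p)).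
Proof.
move=> sr aN p0; have [C HC] := ball_mean_bounded.
apply: (integrableS _ _ _ (integrable_powR_mul aN p0 r0 HC measurable_ball_mean)) => //.
by apply: subset_itvl; rewrite bnd_simp.
Qed.

Local Notation I2 s := (\int[leb]_(t in `[0, s]) (t `^ (1 - beta) * ball_mean t `^ (1 - 2 / q))).
Local Notation I1 s := (\int[leb]_(t in `[0, s]) (t `^ (- (beta / 2)) * ball_mean t `^ (1 - 1 / q))).
Local Notation J s := (\int[mu]_(x in K (s / 2))
  (v x `^ (g - 1) * (enorm (hessian u x) ^+ 2 + enorm (grad v x) ^+ 2))).
Local Notation c s := (g * (8 * m%:R)^-1 * (5 / 256 * s ^+ 3 * s ^- m.+2)).

Lemma mean_value_cutoff (s R1 e e' : R) : s <= r -> 0 < e -> e < e' -> e' <= 3 / 4 * s ->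
  7 / 8 * s <= R1 -> R1 < s ->
  s ^- N * \int[mu]_(x in K R1) (v x `^ (g + 1)) + c s * J s
  <= e ^- N * \int[mu]_(x in K e') (v x `^ (g + 1) * (1 + `|rho x * sig x|))
  + 3 / 2 * P ^+ 2 * I2 s + 1 / 2 * P * I1 s.
Proof.
move=> sr e0 ee' es Rs R1s.
have s0 : 0 < s by have := lt_trans e0 ee'; lra.
have eR : e' < R1 by lra.
have [kap [kc k01 ke kr [ko kd]]] := cutoff_ex ee' eR R1s.
have k0 t : 0 <= kap t by case/andP: (k01 t).
have k1 t : kap t <= 1 by case/andP: (k01 t).
apply: le_trans (localized_inequality N3 C3u u_spacelike C1rho u_eq g0 gM e0 ee' eR R1s es Rs kc k0 k1 ke kr ko kd (bKs sr)) _.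
have P0 := Lq_norm_ge0.
have iZ (C : R) f : leb.-integrable `[0, s] (EFin \o f) -> leb.-integrable `[0, s] (EFin \o (fun t => C * f t)).
  by move=> H; apply: integrableZl_EFin H; exact: measurable_itv.
have mI : measurable (`[0, s]%classic : set (measurableTypeR R)) by exact: measurable_itv.
rewrite -!addrA lerD2l; apply: lerD.
  rewrite -[X in _ <= X]mulrA ler_wpM2l// -RintegralZl//; last exact: ibm.
  apply: (@weight_layer_le kap e s m (fun x => v x `^ (g + 1) * rho x ^+ 2)
      (fun t => P ^+ 2 * (t `^ (1 - beta) * ball_mean t `^ (1 - 2 / q)))) => //.
  - by apply: cM; [exact: cpow|apply: cM].
  - by move=> x; rewrite mulr_ge0 ?powR_ge0 ?sqr_ge0.
  - by apply: iZ; exact: ibm.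
  - by move=> t t0 ts; rewrite mulr_ge0 ?exprn_ge0// mulr_ge0 ?powR_ge0.
  - by move=> t t0 ts; apply: ball_bound2 => //; exact: le_trans sr.
rewrite -[X in _ <= X]mulrA ler_wpM2l// -RintegralZl//; last exact: ibm.
apply: (@weight_layer_le kap e s m.+1 (fun x => v x `^ (g + 1) * `|rho x|)
    (fun t => P * (t `^ (- (beta / 2)) * ball_mean t `^ (1 - 1 / q)))) => //.
- by apply: cM; [exact: cpow|apply: cA].
- by move=> x; rewrite mulr_ge0 ?powR_ge0.
- by apply: iZ; exact: ibm.
- by move=> t t0 ts; rewrite mulr_ge0// mulr_ge0 ?powR_ge0.
- by move=> t t0 ts; apply: ball_bound1 => //; exact: le_trans sr.
Qed.

Local Notation omega := (unit_ball_volume R N).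

(* Letting the inner radii of the cutoff tend to 0. *)
Lemma mean_value_inner (s R1 : R) : 0 < s -> s <= r -> 7 / 8 * s <= R1 -> R1 < s ->
  s ^- N * \int[mu]_(x in K R1) (v x `^ (g + 1)) + c s * J s
  <= omega * v x0 `^ g + 3 / 2 * P ^+ 2 * I2 s + 1 / 2 * P * I1 s.
Proof.
move=> s0 sr Rs R1s; have v0 := spacelike_factor_gt0 u_spacelike x0.
pose h x := v x `^ (g + 1) * (1 + `|rho x * sig x|).
have hx0 : h x0 = v x0 `^ g * v x0.
  rewrite /h sigma_center mulr0 normr0 addr0 mulr1 -[X in _ * X]powRr1 ?(ltW v0)//.
  by rewrite -powRD// (lt0r_neq0 v0) implybT.
have h0 : 0 < h x0 by rewrite hx0 mulr_gt0// powR_gt0.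
have ch : continuous h.
  apply: cM; first exact: cpow.
  have csig := @continuous_sigma _ _ u x0 C3u u_spacelike.
  by move=> x; exact: (cvgD (cvg_cst _) (cvg_norm (cvgM (@rhoc x) (csig x)))).
set X := (X in X <= _); set Y := _ * I2 s; set Z := _ * I1 s.
(* One parameter k < 1 governs both losses: e = k e' costs k^(-N), and the mass estimate for K_e'
   costs k^(-(N+1)). *)
have H k : 0 < k -> k < 1 -> (X - Y - Z) * k ^+ (N + N.+1) <= omega * v x0 `^ g.
  move=> k0 k1; have [s1 /andP[s10 s1r] Hs1] :=
    @lorentz_ball_mass _ _ u x0 C3u u_spacelike r h k r0 bK ch h0 k0 k1.
  pose e' := Num.min s1 (3 / 4 * s); pose e := k * e'.
  have e'0 : 0 < e' by rewrite lt_min s10 mulr_gt0.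
  have e0 : 0 < e by rewrite mulr_gt0.
  have ee' : e < e' by rewrite /e gtr_pMl.
  have es : e' <= 3 / 4 * s by rewrite ge_min lexx orbT.
  have es1 : e' <= s1 by rewrite ge_min lexx.
  have M := mean_value_cutoff sr e0 ee' es Rs R1s.
  have B := Hs1 e' e'0 es1.
  have kn : 0 < k ^+ (N + N.+1) by rewrite exprn_gt0.
  rewrite -ler_pdivlMr//; rewrite -/X -/Y -/Z -/(h _) in M.
  have eN : 0 <= e ^- N by rewrite invr_ge0 exprn_ge0// ltW.
  have E : e ^- N * (k ^- N.+1 * (h x0 * omega / v x0) * e' ^+ N) = omega * v x0 `^ g / k ^+ (N + N.+1).
    rewrite hx0 /e exprMn exprD; field.
    by rewrite !expf_neq0 ?lt0r_neq0.
  have := le_trans M (lerD (lerD (ler_wpM2l eN B) (lexx Y)) (lexx Z)).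
  rewrite E; lra.
have Hl : (X - Y - Z) * k ^+ (N + N.+1) @[k --> 1^'-] --> (X - Y - Z) * 1 ^+ (N + N.+1).
  by apply: cvg_at_left_filter; apply: cvgM; [exact: cvg_cst|exact: exprn_continuous].
suff : X - Y - Z <= omega * v x0 `^ g by lra.
rewrite -[leLHS]mulr1 -[X in _ * X <= _](expr1n _ (N + N.+1)) -(cvg_lim _ Hl)//.
apply: limr_le; first exact: (cvgP _ Hl).
near=> k; apply: H => //.
Unshelve. all: by end_near. Qed.

(* Letting the outer cutoff radius tend to the radius of the ball. *)
Lemma mean_value_ineq (s : R) : 0 < s -> s <= r ->
  ball_mean s + c s * J s
  <= omega * v x0 `^ g + 3 / 2 * P ^+ 2 * I2 s + 1 / 2 * P * I1 s.
Proof.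
move=> s0 sr; set Y := _ + _ + _.
(* The radii increase to s, starting at exactly the least admissible value 7s/8; as Lorentz balls
   are defined by a strict inequality, they exhaust K_s. *)
pose Rn (n : nat) := s - s / (8 * n.+1%:R).
have Rn7 n : 7 / 8 * s <= Rn n.
  have : s / (8 * n.+1%:R) <= s / 8 * 1.
    by rewrite invfM mulrA ler_wpM2l ?invf_le1 ?ltr0n ?ler1n// divr_ge0// ltW.
  by rewrite /Rn; move: (s / (8 * n.+1%:R)) => z; lra.
have Rns n : Rn n < s by rewrite gtrBl divr_gt0// mulr_gt0// ltr0n.
have ndK : nondecreasing_seq (fun n => K (Rn n)).
  move=> i j ij; apply/subsetPset; apply: subset_lorentz_ball; rewrite lerD2l lerN2.
  by rewrite ler_pM2l// lef_pV2 ?posrE ?mulr_gt0 ?ltr0n// ler_pM2l// ler_nat.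
have UK : \bigcup_n K (Rn n) = K s.
  apply/seteqP; split => x; first by move=> [n _]; apply: subset_lorentz_ball; exact: ltW.
  rewrite lorentz_ballE => /= xs; pose n := Num.truncn (s / (s - Num.sqrt (ell x))).
  have d0 : 0 < s - Num.sqrt (ell x) by rewrite subr_gt0.
  exists n => //; rewrite lorentz_ballE /= /Rn ltrBrDr -ltrBrDl.
  have := truncnS_gt (s / (s - Num.sqrt (ell x))); rewrite -/n ltr_pdivrMr// => h.
  rewrite ltr_pdivrMr ?mulr_gt0 ?ltr0n//.
  have : 0 < n.+1%:R * (s - Num.sqrt (ell x)) by rewrite mulr_gt0// ltr0n.
  by move: h; lra.
have mv n : measurable_fun (K (Rn n)) (fun x => (v x `^ (g + 1))%:E).
  apply/measurable_EFinP; apply: measurable_funTS.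
  exact: (@continuous_measurable_row _ _ _ (@cpow (g + 1))).
have C := ge0_nondecreasing_set_cvg_integral (mu := mu) ndK (fun n => mK (Rn n)) mv
  (fun n x _ => powR_ge0 _ _).
rewrite UK in C.
have sN : 0 < s ^+ N by rewrite exprn_gt0.
suff H : (\int[mu]_(x in K s) (v x `^ (g + 1))%:E <= (s ^+ N * (Y - c s * J s))%:E)%E.
  rewrite -lerBrDr /ball_mean ler_pdivrMl// -lee_fin EFin_Rintegral//.
  by apply: iK => //; exact: cpow.
rewrite -(cvg_lim _ C)//; apply: lime_le; first exact: (cvgP _ C).
apply: nearW => n; rewrite -EFin_Rintegral//; last first.
  by apply: iK; [rewrite (le_trans (ltW (Rns n)))|exact: cpow].
rewrite lee_fin -ler_pdivrMl// lerBrDr; exact: mean_value_inner.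
Qed.

Lemma mean_value_final :
  ball_mean r + c r * J r <= omega * v x0 `^ g
  + 3 / 2 * P ^+ 2 * \int[leb]_(s in `[0, r])
     (s `^ (1 - beta) * bound_fun (3 / 2 * P ^+ 2) (1 / 2 * P) omega q (1 - beta) (- (beta / 2)) s `^ (q - 2))
  + 1 / 2 * P * \int[leb]_(s in `[0, r])
     (s `^ (- (beta / 2)) * bound_fun (3 / 2 * P ^+ 2) (1 / 2 * P) omega q (1 - beta) (- (beta / 2)) s `^ (q - 1)).
Proof.
have [C HC] := ball_mean_bounded.
have w0 : 0 < omega by exact: unit_ball_volume_gt0.
have A0 : 0 <= 3 / 2 * P ^+ 2 by rewrite mulr_ge0// exprn_ge0// Lq_norm_ge0.
have B0 : 0 <= 1 / 2 * P by rewrite mulr_ge0// Lq_norm_ge0.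
have vg1 : v x0 `^ g <= 1.
  apply: (@le_trans _ _ (1 `^ g)); last by rewrite powR1.
  by rewrite ge0_ler_powR ?nnegrE ?(ltW g0) ?(ltW (spacelike_factor_gt0 u_spacelike x0)) ?spacelike_factor_le1.
(* For the a priori bound on G the Hessian term is discarded and v(x0)^g is replaced by 1; the final
   inequality starts again from the sharp form and keeps both. *)
have GH s : 0 < s -> s <= r ->
    ball_mean s <= omega + 3 / 2 * P ^+ 2 * I2 s + 1 / 2 * P * I1 s.
  move=> s0 sr; have M := mean_value_ineq s0 sr.
  have cJ : 0 <= c s * J s.
    apply: mulr_ge0; last first.
      apply: Rintegral_ge0 => x _; rewrite mulr_ge0 ?powR_ge0 ?addr_ge0 ?exprn_ge0//; exact: sqrtr_ge0.
    apply: mulr_ge0; first by rewrite mulr_ge0 ?(ltW g0)// invr_ge0 mulr_ge0.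
    have sp k : 0 <= s ^+ k by rewrite exprn_ge0// ltW.
    exact: divr_ge0 (mulr_ge0 (divr_ge0 (ler0n _ 5) (ler0n _ 256)) (sp 3%N)) (sp m.+2).
  have wv : omega * v x0 `^ g <= omega by rewrite ler_piMr// ltW.
  apply: le_trans (lerD (lerD wv (lexx _)) (lexx _)).
  by apply: le_trans M; rewrite lerDl.
(* The inverse of 0 being 0, the mean at radius 0 is 0, so the comparison with the bound holds at
   the left end as well. *)
have Gz : ball_mean 0 = 0 by rewrite /ball_mean expr0n /= invr0 mul0r.
have H := gronwall_integral A0 B0 w0 q2 a1N a2N r0 HC measurable_ball_mean GH Gz.
apply: le_trans (mean_value_ineq r0 (lexx r)) _.
have aux (a x y x' y' : R) : x + y <= x' + y' -> a + x + y <= a + x' + y'.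
  by move=> xy; rewrite -!addrA lerD2l.
exact: (aux _ _ _ _ _ H).
Qed.

End mean_value.

(** * Choice of the constants and the mean value inequality in closed form *)

Theorem theorem1p1 (R : realType) (N : nat) (hN : (3 <= N)%N) :
  exists gamma c : R, [/\ 0 < gamma, gamma < N%:R^-1, 0 < c &
  forall (x0 : 'rV[R]_N) (r : R) (rho : 'rV[R]_N -> R) (q : R)
         (u : 'rV[R]_N -> R),
  0 < r -> Ck 1 rho -> N%:R < q ->
  Ck 3 u -> strictly_spacelike u -> mean_curvature_eq u rho ->
  bounded_set (lorentz_ball u x0 r) ->
  let beta := 2 * N%:R / q in
  let v := spacelike_factor u in
  let omega := unit_ball_volume R N in
  let P := Lq_norm q (lorentz_ball u x0 r) rho in
  let S := fun s : R =>
    omega `^ q^-1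
    + 3 * omega `^ (- q^-1) * P ^+ 2 / (2 * q * (2 - beta)) * s `^ (2 - beta)
    + P / (2 * q * (1 - beta / 2)) * s `^ (1 - beta / 2) in
  omega * v x0 `^ gamma >=
    r ^- N * \int[lebesgue_row R N]_(x in lorentz_ball u x0 r)
               v x `^ (gamma + 1)
    + c * r `^ (2 - N%:R) *
        \int[lebesgue_row R N]_(x in lorentz_ball u x0 (r / 2))
          (v x `^ (gamma - 1) *
           (enorm (hessian u x) ^+ 2 + enorm (grad v x) ^+ 2))
    - 3 / 2 * P ^+ 2 *
        \int[lebesgue_measure]_(s in `[0, r])
          (s `^ (1 - beta) * S s `^ (q - 2))
    - 1 / 2 * P *
        \int[lebesgue_measure]_(s in `[0, r])
          (s `^ (- (beta / 2)) * S s `^ (q - 1))].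
Proof.
case: N hN => [//|m] m2.
have m0 : 2 <= m%:R :> R by rewrite ler_nat.
pose g : R := (16 * m%:R)^-1; pose c : R := g * (8 * m%:R)^-1 * (5 / 256).
have mp : 0 < m%:R :> R by exact: lt_le_trans m0.
have g0 : 0 < g by rewrite invr_gt0 mulr_gt0.
exists g, c; split => //.
- by rewrite -(natr1 m) /g ltf_pV2 ?posrE ?mulr_gt0 ?addr_gt0//; lra.
- by rewrite !mulr_gt0 ?invr_gt0 ?mulr_gt0// ltr0n.
move=> x0 r rho q u r0 C1rho Nq C3u [_ usl] ueq bK; cbv zeta.
pose beta : R := 2 * m.+1%:R / q; pose v := spacelike_factor u.
pose om := unit_ball_volume R m.+1; pose P := Lq_norm q (lorentz_ball u x0 r) rho.
pose S s := om `^ q^-1 + 3 * om `^ (- q^-1) * P ^+ 2 / (2 * q * (2 - beta)) * s `^ (2 - beta)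
  + P / (2 * q * (1 - beta / 2)) * s `^ (1 - beta / 2).
have H := @mean_value_final R m u rho x0 m2 C3u usl C1rho ueq g r q g0 (lexx _) r0 bK Nq.
have q0 : 0 < q by apply: lt_trans Nq; rewrite ltr0n.
rewrite -/beta -/om -/P -/v in H.
have b2 : beta < 2 by rewrite ltr_pdivrMr// ltr_pM2l.
(* The Gronwall coefficients 3 P^2/2 and P/2, divided by q (2 - beta) and q (1 - beta/2), are those
   of S. *)
have SE : bound_fun (3 / 2 * P ^+ 2) (1 / 2 * P) om q (1 - beta) (- (beta / 2)) =
    S.
  apply/funext => s; rewrite /bound_fun /S.
  have -> : 1 - beta + 1 = 2 - beta by ring.
  have -> : - (beta / 2) + 1 = 1 - beta / 2 by ring.
  have h1 : 2 - beta != 0 by rewrite lt0r_neq0// subr_gt0.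
  have h2 : 1 - beta / 2 != 0 by rewrite lt0r_neq0// subr_gt0 ltr_pdivrMr// mul1r.
  congr (_ + _ * _ + _ * _).
    by move: (om `^ (- q^-1)) => z; field; rewrite h1 lt0r_neq0.
  by field; rewrite h1 lt0r_neq0.
rewrite SE in H.
(* The powers combine to r^3 r^(-(N+1)) = r^(2-N). *)
have cE : g * (8 * m%:R)^-1 * (5 / 256 * r ^+ 3 * r ^- m.+2) = c * r `^ (2 - m.+1%:R).
  have -> : r `^ (2 - m.+1%:R) = r ^+ 3 * r ^- m.+2.
    have -> : 2 - m.+1%:R = 3%:R + - m.+2%:R :> R by rewrite -!natr1; ring.
    by rewrite powRD ?(lt0r_neq0 r0) ?implybT// powRN !powR_mulrn ?(ltW r0).
  by rewrite /c; move: (r ^+ 3) (r ^- m.+2) => a b; ring.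
rewrite cE /ball_mean in H.
have aux (a b y z : R) : a <= b + y + z -> a - y - z <= b by lra.
exact: (aux _ _ _ _ H).
Qed.
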